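(* Let $\gamma>1$, $\mu>0$, $\overline{S}\in\mathbb{R}$, and $A=(\gamma e^{\overline{S}})^{-1}$. Let $\rho_0,S_0:\mathbb{R}^3\to\mathbb{R}$ and $u_0,B_0:\mathbb{R}^3\to\mathbb{R}^3$ be smooth functions, all supported in $\{x\in\mathbb{R}^3:|x|\le 1\}$, with $\nabla\cdot B_0=0$. For $\varepsilon>0$ consider the initial data $$\rho(0,x)=1+\varepsilon\rho_0(x),\quad u(0,x)=\varepsilon u_0(x),\quad B(0,x)=\varepsilon B_0(x),\quad S(0,x)=\overline{S}+\varepsilon S_0(x),\qquad x\in\mathbb{R}^3 .$$ Assume that $S(0,x)\ge\overline{S}$ for all $x\in\mathbb{R}^3$, and that $$\int_{\mathbb{R}^3}\rho_0(x)F(x)\,dx+\int_{\mathbb{R}^3}\nabla F(x)\cdot u_0(x)\,dx>0,\qquad\text{where } F(x)=\int_{S^2}e^{\omega\cdot x}\,d\omega .$$ Then any axisymmetric $C^1$-solution (in the sense defined in the context) of the compressible magnetohydrodynamics system with these initial data blows up in finite time, i.e. it cannot be continued as a $C^1$-solution for all $t\ge 0$, and its existence time is bounded above by $\exp(C\varepsilon^{-1})$. Precisely: there exist constants $\varepsilon_0>0$ and $C>0$, with $C$ independent of $\varepsilon$, such that for every $0<\varepsilon\le\varepsilon_0$, if an axisymmetric $C^1$-solution $(\rho,u,S,B)$ with initial data $\rho(0,x)=1+\varepsilon\rho_0(x)$, $u(0,x)=\varepsilon u_0(x)$, $B(0,x)=\varepsilon B_0(x)$, $S(0,x)=\overline{S}+\varepsilon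 S_0(x)$ exists on $[0,T)\times\mathbb{R}^3$, then $T\le\exp(C\varepsilon^{-1})$.
   Context: The compressible magnetohydrodynamics system in $\mathbb{R}^3$ for the density $\rho$ (positive), velocity $u=(u_1,u_2,u_3)$, pressure $p$, specific entropy $S$ and magnetic field $B=(B^1,B^2,B^3)$, all functions of $(t,x)$, $t\ge 0$, $x\in\mathbb{R}^3$, is $$\begin{cases}\rho_t+\nabla\cdot(\rho u)=0,\\ \rho(\partial_t u+u\cdot\nabla u)+\nabla p-\mu^{-1}(\nabla\times B)\times B=0,\\ S_t+u\cdot\nabla S=0,\\ B_t-\nabla\times(u\times B)=0,\\ p=A\rho^{\gamma}e^{S},\\ \nabla\cdot B=0,\end{cases}$$ with $\mu>0$ the magnetic permeability, $A>0$ and $\gamma>1$ constants. The normalization $A=(\gamma e^{\overline{S}})^{-1}$ makes the sound speed $\sqrt{\partial p/\partial\rho}$ equal to $1$ at the constant state $\rho=1$, $S=\overline{S}$. Cylindrical coordinates: $r=\sqrt{x_1^2+x_2^2}$, $z=x_3$, with $e^r=(x_1/r,x_2/r,0)^T$, $e^\theta=(-x_2/r,x_1/r,0)^T$, $e^z=(0,0,1)^T$. An axisymmetric $C^1$-solution on $[0,T)\times\mathbb{R}^3$ is a solution $(\rho,u,S,B)\in C^1([0,T)\times\mathbb{R}^3)$ of the system of the form $$u(t,x)=u^r(t,r,z)e^r+u^z(t,r,z)e^z,\quad B(t,x)=B^\theta(t,r,z)e^\theta,\quad p(t,x)=p(t,r,z),\quad S(t,x)=S(t,r,z)$$ (no angular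 dependence, and $u^\theta=B^r=B^z=0$). In particular the initial data are of this form. $S^2$ is the unit sphere in $\mathbb{R}^3$ and $d\omega$ its surface measure. *)

(* Defs.v *)
From HB Require Import structures.
From mathcomp Require Import all_boot all_order all_algebra.
From mathcomp Require Import all_classical all_reals all_analysis.

Set Implicit Arguments.
Unset Strict Implicit.
Unset Printing Implicit Defensive.

Import Order.TTheory GRing.Theory Num.Theory.
Import numFieldNormedType.Exports.

Local Open Scope classical_set_scope.
Local Open Scope ring_scope.

Definition vec3 (R : realType) (a b c : R) : 'rV[R]_3 :=
  \row_(i < 3) [:: a; b; c]`_i.

Definition dotp (R : realType) (v w : 'rV[R]_3) : R :=
  \sum_(i < 3) v 0 i * w 0 i.

(* The library norm `|v| on 'rV[R]_3 is the sup norm. *)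
Definition enorm (R : realType) (v : 'rV[R]_3) : R := Num.sqrt (dotp v v).

(* Coordinates are numbered from 0: x_1, x_2, x_3 are x 0 0, x 0 1, x 0 2%:R. *)
Definition cross (R : realType) (v w : 'rV[R]_3) : 'rV[R]_3 :=
  vec3 (v 0 1 * w 0 2%:R - v 0 2%:R * w 0 1)
       (v 0 2%:R * w 0 0 - v 0 0 * w 0 2%:R)
       (v 0 0 * w 0 1 - v 0 1 * w 0 0).

Definition partial (R : realType) (W : normedModType R) (i : 'I_3)
    (f : 'rV[R]_3 -> W) (x : 'rV[R]_3) : W :=
  'D_(delta_mx 0 i) f x.

Definition grad (R : realType) (f : 'rV[R]_3 -> R) (x : 'rV[R]_3) :
    'rV[R]_3 :=
  \row_(i < 3) partial i (f : _ -> R^o) x.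

Definition divg (R : realType) (v : 'rV[R]_3 -> 'rV[R]_3) (x : 'rV[R]_3) : R :=
  \sum_(i < 3) partial i (fun y => v y 0 i : R^o) x.

Definition curl (R : realType) (v : 'rV[R]_3 -> 'rV[R]_3) (x : 'rV[R]_3) :
    'rV[R]_3 :=
  let d i j : R := partial i (fun y => v y 0 j : R^o) x in
  vec3 (d 1 2%:R - d 2%:R 1) (d 2%:R 0 - d 0 2%:R) (d 0 1 - d 1 0).

Fixpoint class_Ck (R : realType) (W : normedModType R) (k : nat)
    (f : 'rV[R]_3 -> W) : Prop :=
  match k with
  | 0 => continuous f
  | k'.+1 => continuous f /\ forall i : 'I_3,
      (forall x, derivable f x (delta_mx 0 i)) /\ class_Ck k' (partial i f)
  end.

Definition smooth (R : realType) (W : normedModType R) (f : 'rV[R]_3 -> W) :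
    Prop :=
  forall k, class_Ck k f.

Definition supported_in_unit_ball (R : realType) (W : normedModType R)
    (f : 'rV[R]_3 -> W) : Prop :=
  forall x, 1 < enorm x -> f x = 0.

(* Time derivative relative to the half-line t >= 0: the usual derivative when
   0 < t, the right derivative when t = 0. *)
Definition time_quotient (R : realType) (W : normedModType R)
    (f : R -> 'rV[R]_3 -> W) (t : R) (x : 'rV[R]_3) : set_system W :=
  (h^-1 *: (f (t + h) x - f t x)) @[h --> within [set h | 0 <= t + h] 0^'].

Definition time_derivable (R : realType) (W : normedModType R)
    (f : R -> 'rV[R]_3 -> W) (t : R) (x : 'rV[R]_3) : Prop :=
  cvg (time_quotient f t x).

Definition dt (R : realType) (W : normedModType R)
    (f : R -> 'rV[R]_3 -> W) (t : R) (x : 'rV[R]_3) : W :=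
  lim (time_quotient f t x).

(* [0, T) x R^3, where T = +oo is allowed. *)
Definition slab (R : realType) (T : \bar R) : set (R * 'rV[R]_3) :=
  [set q | 0 <= q.1 /\ (q.1%:E < T)%E].

Definition class_C1 (R : realType) (W : normedModType R) (T : \bar R)
    (f : R -> 'rV[R]_3 -> W) : Prop :=
  [/\ {within slab T, continuous (fun q => f q.1 q.2)},
      forall t x, slab T (t, x) -> time_derivable f t x,
      {within slab T, continuous (fun q => dt f q.1 q.2)},
      forall t x (i : 'I_3), slab T (t, x) ->
        derivable (f t) x (delta_mx 0 i)
    & forall i : 'I_3,
        {within slab T, continuous (fun q => partial i (f q.1) q.2)}].

Definition pressure (R : realType) (A gamma : R) (rho S : R -> 'rV[R]_3 -> R)
    (t : R) (x : 'rV[R]_3) : R :=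
  A * (rho t x `^ gamma) * expR (S t x).

Definition mhd_at (R : realType) (A gamma mu : R)
    (rho : R -> 'rV[R]_3 -> R) (u : R -> 'rV[R]_3 -> 'rV[R]_3)
    (S : R -> 'rV[R]_3 -> R) (B : R -> 'rV[R]_3 -> 'rV[R]_3)
    (t : R) (x : 'rV[R]_3) : Prop :=
  let p := pressure A gamma rho S in
  [/\ dt (rho : _ -> _ -> R^o) t x + divg (fun y => rho t y *: u t y) x = 0,
      rho t x *: (dt u t x + \sum_(j < 3) u t x 0 j *: partial j (u t) x)
        + grad (p t) x - mu^-1 *: cross (curl (B t) x) (B t x) = 0,
      dt (S : _ -> _ -> R^o) t x + dotp (u t x) (grad (S t) x) = 0,
      dt B t x - curl (fun y => cross (u t y) (B t y)) x = 0
    & divg (B t) x = 0].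

Definition C1_mhd_solution (R : realType) (A gamma mu : R) (T : \bar R)
    (rho : R -> 'rV[R]_3 -> R) (u : R -> 'rV[R]_3 -> 'rV[R]_3)
    (S : R -> 'rV[R]_3 -> R) (B : R -> 'rV[R]_3 -> 'rV[R]_3) : Prop :=
  [/\ class_C1 T (rho : _ -> _ -> R^o), class_C1 T u,
      class_C1 T (S : _ -> _ -> R^o) & class_C1 T B] /\
  forall t x, slab T (t, x) ->
    0 < rho t x /\ mhd_at A gamma mu rho u S B t x.

Definition cyl_r (R : realType) (x : 'rV[R]_3) : R :=
  Num.sqrt (x 0 0 ^+ 2 + x 0 1 ^+ 2).

Definition e_r (R : realType) (x : 'rV[R]_3) : 'rV[R]_3 :=
  vec3 (x 0 0 / cyl_r x) (x 0 1 / cyl_r x) 0.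

Definition e_theta (R : realType) (x : 'rV[R]_3) : 'rV[R]_3 :=
  vec3 (- x 0 1 / cyl_r x) (x 0 0 / cyl_r x) 0.

Definition e_z (R : realType) : 'rV[R]_3 := vec3 0 0 1.

(* Required off the axis r = 0, where e_r and e_theta are undefined. *)
Definition axisymmetric (R : realType) (T : \bar R)
    (u B : R -> 'rV[R]_3 -> 'rV[R]_3) (p S : R -> 'rV[R]_3 -> R) : Prop :=
  exists ur uz Btheta pc Sc : R -> R -> R -> R,
  forall t x, slab T (t, x) -> 0 < cyl_r x ->
    let r := cyl_r x in let z := x 0 2%:R in
    [/\ u t x = ur t r z *: e_r x + uz t r z *: e_z R,
        B t x = Btheta t r z *: e_theta x,
        p t x = pc t r z
      & S t x = Sc t r z].

Definition axisymmetric_C1_solution (R : realType) (A gamma mu : R)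
    (T : \bar R)
    (rho : R -> 'rV[R]_3 -> R) (u : R -> 'rV[R]_3 -> 'rV[R]_3)
    (S : R -> 'rV[R]_3 -> R) (B : R -> 'rV[R]_3 -> 'rV[R]_3) : Prop :=
  C1_mhd_solution A gamma mu T rho u S B /\
  axisymmetric T u B (pressure A gamma rho S) S.

Definition integral_R3 (R : realType) (f : 'rV[R]_3 -> R) : R :=
  \int[((@lebesgue_measure R \x @lebesgue_measure R)
          \x @lebesgue_measure R)%E]_q f (vec3 q.1.1 q.1.2 q.2).

(* Surface integral over S^2 in spherical coordinates, with area element
   sin phi dphi dtheta. *)
Definition integral_S2 (R : realType) (f : 'rV[R]_3 -> R) : R :=
  \int[@lebesgue_measure R]_(theta in `[0, 2 * pi])
    \int[@lebesgue_measure R]_(phi in `[0, pi])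
      (f (vec3 (sin phi * cos theta) (sin phi * sin theta) (cos phi))
       * sin phi).

Definition sphere_exp (R : realType) (x : 'rV[R]_3) : R :=
  integral_S2 (fun omega => expR (dotp omega x)).

(* Main.v *)
Require Import Defs.
From HB Require Import structures.
From mathcomp Require Import all_boot all_order all_algebra.
From mathcomp Require Import ring lra.
From mathcomp Require Import all_classical all_reals all_analysis.
From mathcomp Require Import measurable_realfun.

Set Implicit Arguments.
Unset Strict Implicit.
Unset Printing Implicit Defensive.

Import Order.TTheory GRing.Theory Num.Theory.
Import numFieldNormedType.Exports.

Local Open Scope classical_set_scope.
Local Open Scope ring_scope.

(* For |x| > 1 + t the solution stays at the constant state, by energy estimates on backward cones
   of speed slightly above 1, and S >= Sbar persists because rho max(0, Sbar - S)^2 has a conserved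
   integral. Put P = int (rho - 1) F and Q = int rho u . grad F, so that P' = Q. Since Lap F = F and
   D^2 F >= 0, the momentum equation gives Q' >= int (p - p(1)) F: the magnetic stress contributes
   with the good sign, because B is orthogonal to x and 2 D^2 F(b, b) <= |b|^2 F for b orthogonal
   to x. Convexity of the pressure yields p - p(1) >= (1 + l) (rho - 1) - C l^2 for 0 <= l <= 1, and
   int_{|x| < 2 + t} F <= C (2 + t) e^t, hence Q' >= (1 + l) P - C l^2 (2 + t) e^t, whereas
   conservation of mass bounds P by C (3 + t)^3 e^t. Optimizing in l, the quantity e^-t (P + Q),
   initially of size eps, grows like a sequence with y_(n+1) >= y_n + c y_n min(1, y_n / n), which
   exceeds the polynomial bound before the time exp(C / eps). *)

(** * One-dimensional calculus *)

(** [e^t F] and [e^(-t) F] solve the wave equation, so for the linearized isentropic flow P'' = P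
    and e^-t (P + Q) is constant; it is the convexity of the pressure that makes it grow. A family
    of tangent lines, indexed by l, replaces an integral inequality for (rho - 1)^2. Since F has
    size e^|x| / |x|, the loss carries 2 + t rather than its square: the gain per unit of time is
    y^2 / t, and the divergence of the sum of 1 / n makes the lifespan exponential in 1 / eps. Axial
    symmetry enters through B . x = 0: tangentially to spheres the Hessian of F is at most F / 2, so
    magnetic pressure outweighs magnetic tension.

    The solution is only C^1, with a one-sided time derivative at 0, so the proof runs on
    first-order balance laws, integrated over a fixed cube containing the light cone. Sound speed is
    1 at rest but only close to 1 nearby; the bound |x| <= 1 + t on the disturbed region therefore
    uses cones of speed 1 + 2 k, k as small as the point requires, on time steps so short that the
    state remains near rest. *)

Section ContinuityKit.
Variables (R : realType) (T : topologicalType).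
Implicit Types f g : T -> R.

Lemma cst_cont (k : R) : continuous (fun _ : T => k).
Proof. by move=> x; apply: (@cst_continuous T R). Qed.

Lemma add_cont f g : continuous f -> continuous g -> continuous (fun x => f x + g x).
Proof. by move=> hf hg x; apply: (@continuousD _ R^o); [apply: hf|apply: hg]. Qed.

Lemma opp_cont f : continuous f -> continuous (fun x => - f x).
Proof. by move=> hf x; apply: (@continuousN _ R^o); apply: hf. Qed.

Lemma sub_cont f g : continuous f -> continuous g -> continuous (fun x => f x - g x).
Proof. by move=> hf hg; apply: add_cont => //; apply: opp_cont. Qed.

Lemma mul_cont f g : continuous f -> continuous g -> continuous (fun x => f x * g x).
Proof. by move=> hf hg x; apply: continuousM; [apply: hf|apply: hg]. Qed.

Lemma sum_cont (I : finType) (F : I -> T -> R) : (forall i, continuous (F i)) ->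
  continuous (fun x => \sum_i F i x).
Proof.
move=> h; elim: (index_enum I) => [|i s IHs].
  rewrite [X in continuous X](_ : _ = fun=> 0); first exact: cst_cont.
  by apply: funext => x; rewrite big_nil.
rewrite [X in continuous X](_ : _ = fun x => F i x + \sum_(j <- s) F j x).
  exact: add_cont.
by apply: funext => x; rewrite big_cons.
Qed.

End ContinuityKit.

(* A plain proposition in place of the class [is_derive], whose instance resolution diverges on
   hypotheses about derivatives. *)
Definition deriv_at (R : realType) (V W : normedModType R) (f : V -> W) (x v : V) (d : W) : Prop :=
  is_derive x v f d.

Section DerivativeKit.
Variables (R : realType) (V : normedModType R).
Implicit Types (f g : V -> R) (x v : V).

(** The two difference quotients are the same function of h. This reduces the chain rule and
    differentiation under the integral to the real line. *)
Lemma deriv_at_line (W : normedModType R) (f : V -> W) x v (d : W) :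
  deriv_at f x v d <-> deriv_at (fun h : R => f (h *: v + x)) 0 1 d.
Proof.
have E : (fun h : R => h^-1 *: (((fun h => f (h *: v + x)) \o shift (0 : R)) (h *: 1) - f (0 *: v + x)))
  = (fun h => h^-1 *: ((f \o shift x) (h *: v) - f x)).
  by apply: funext => h /=; rewrite addr0 scale0r add0r [_%:A]mulr1.
by split=> -[d1 d2]; split; move: d1 d2; rewrite /derivable /derive E.
Qed.

Lemma deriv_at_eq (W : normedModType R) (f : V -> W) x v (d d' : W) :
  deriv_at f x v d -> d = d' -> deriv_at f x v d'.
Proof. by move=> + <-. Qed.

Lemma deriv_at_unique (W : normedModType R) (f : V -> W) x v (d d' : W) :
  deriv_at f x v d -> deriv_at f x v d' -> d = d'.
Proof. by move=> [_ <-] [_ <-]. Qed.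

Lemma deriv_at_cst (k : R) x v : deriv_at (fun _ : V => k) x v 0.
Proof. exact: (@is_derive_cst _ _ R^o). Qed.

Lemma deriv_atD f g x v df dg : deriv_at f x v df -> deriv_at g x v dg ->
  deriv_at (fun y => f y + g y) x v (df + dg).
Proof. exact: (@is_deriveD _ _ R^o). Qed.

Lemma deriv_atN f x v df : deriv_at f x v df -> deriv_at (fun y => - f y) x v (- df).
Proof. exact: (@is_deriveN _ _ R^o). Qed.

Lemma deriv_atB f g x v df dg : deriv_at f x v df -> deriv_at g x v dg ->
  deriv_at (fun y => f y - g y) x v (df - dg).
Proof. exact: (@is_deriveB _ _ R^o). Qed.

Lemma deriv_atM f g x v df dg : deriv_at f x v df -> deriv_at g x v dg ->
  deriv_at (fun y => f y * g y) x v (df * g x + f x * dg).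
Proof.
move=> hf hg; have := @is_deriveM _ _ f g x v df dg hf hg.
by move/deriv_at_eq; apply; rewrite addrC /GRing.scale /= [g x * df]mulrC.
Qed.

Lemma deriv_atZ k f x v df : deriv_at f x v df -> deriv_at (fun y => k * f y) x v (k * df).
Proof.
move=> h; have := deriv_atM (deriv_at_cst k x v) h.
by move/deriv_at_eq; apply; rewrite mul0r add0r.
Qed.

Lemma deriv_at_comp (phi : R -> R) f x v (d df : R) :
  deriv_at phi (f x) 1 d -> deriv_at f x v df ->
  deriv_at (fun y => phi (f y)) x v (d * df).
Proof.
move=> h1 /deriv_at_line h2; apply/deriv_at_line.
apply: (@is_derive1_comp _ phi (fun h => f (h *: v + x))) => //.
by rewrite scale0r add0r.
Qed.

Lemma deriv_at_sum n (F : 'I_n -> V -> R) x v (dF : 'I_n -> R) :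
  (forall i, deriv_at (F i) x v (dF i)) ->
  deriv_at (fun y => \sum_i F i y) x v (\sum_i dF i).
Proof.
move=> h; have := @is_derive_sum R V R^o n F x v dF h.
by congr is_derive; apply: funext => y; rewrite fct_sumE.
Qed.

Lemma deriv_at_near f g x v d : (\forall y \near x, f y = g y) ->
  deriv_at f x v d -> deriv_at g x v d.
Proof.
(* Locality of the derivative is applied in a nonzero direction; in direction 0 every derivative is
   0. *)
move=> e; have [->|v0] := eqVneq v 0.
  by move/(@deriv_at_unique _ _ _ _ _ _)/(_ (is_derive0 _ _)) ->; apply: is_derive0.
move=> h; apply: (near_eq_is_derive (f := f)) => //.
Qed.

End DerivativeKit.

Section Calculus.
Variable R : realType.
Implicit Types (f g F : R -> R) (a b x : R).

Lemma deriv_at_id x : deriv_at (fun y : R => y) x 1 1.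
Proof. exact: is_derive_id. Qed.

Lemma deriv_at_cont f x d : deriv_at f x 1 d -> {for x, continuous f}.
Proof.
by move=> [h _]; apply: differentiable_continuous; apply/derivable1_diffP.
Qed.

Lemma deriv_at_shift f x c d :
  deriv_at f (x + c) 1 d -> deriv_at (fun y => f (y + c)) x 1 d.
Proof.
move=> h; rewrite -[d]mulr1.
apply: (deriv_at_comp (f := fun y => y + c)) => //.
by rewrite -[1 in X in deriv_at _ _ _ X]addr0; apply: deriv_atD; [apply: deriv_at_id|apply: deriv_at_cst].
Qed.

Lemma le_of_deriv_ge0 f g a b : a <= b ->
  (forall x, a <= x <= b -> {for x, continuous f}) ->
  (forall x, a < x < b -> deriv_at f x 1 (g x)) ->
  (forall x, a < x < b -> 0 <= g x) -> f a <= f b.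
Proof.
move=> ab fc fd g0; case: (ltgtP a b) ab => // [ab _|-> //].
have [||x xab e] := @MVT R f g a b ab.
- by move=> x xab; apply: fd; rewrite !(itvP xab).
- apply: continuous_in_subspaceT => x.
  by rewrite mem_setE in_itv /= => /fc.
rewrite -subr_ge0 e; apply: mulr_ge0; last by rewrite subr_ge0 ltW.
by apply: g0; rewrite !(itvP xab).
Qed.

Lemma eq_of_deriv0 f a b : a <= b ->
  (forall x, a <= x <= b -> {for x, continuous f}) ->
  (forall x, a < x < b -> deriv_at f x 1 0) -> f a = f b.
Proof.
move=> ab fc fd; apply/eqP; rewrite eq_le (@le_of_deriv_ge0 f (fun=> 0))//=.
rewrite -lerN2; apply: (@le_of_deriv_ge0 (fun x => - f x) (fun=> 0)) => // x h.
- by apply: continuousN; apply: fc.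
- by rewrite -oppr0; apply: deriv_atN; apply: fd.
Qed.

Lemma mean_value f g a b : a < b ->
  (forall x, a <= x <= b -> deriv_at f x 1 (g x)) ->
  exists2 c, a < c < b & f b - f a = g c * (b - a).
Proof.
move=> ab fd.
have [||x xab e] := @MVT R f g a b ab.
- by move=> x xab; apply: fd; rewrite !ltW ?(itvP xab).
- apply: continuous_in_subspaceT => x.
  by rewrite mem_setE in_itv /= => /fd/deriv_at_cont.
by exists x => //; rewrite !(itvP xab).
Qed.

Definition seg_int a b f : R := \int[@lebesgue_measure R]_(x in `[a, b]) f x.

Lemma seg_intE a b f : seg_int a b f = \int[@lebesgue_measure R]_(x in `[a, b]) f x.
Proof. by []. Qed.

Lemma eq_seg_int a b f g : (forall x, a <= x <= b -> f x = g x) ->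
  seg_int a b f = seg_int a b g.
Proof.
by move=> e; apply: eq_Rintegral => x; rewrite inE /= in_itv /=; apply: e.
Qed.

Lemma seg_int_FTC f F a b : a <= b -> continuous f ->
  (forall x, a <= x <= b -> deriv_at F x 1 (f x)) -> seg_int a b f = F b - F a.
Proof.
case: (ltgtP a b) => // [ab _|-> _] fc Fd; last first.
  rewrite /seg_int set_itv1 subrr; exact: Rintegral_set1.
rewrite /seg_int /Rintegral (@continuous_FTC2 _ f F)//.
- exact: continuous_subspaceT.
- split => [x| |].
  + by rewrite in_itv /= => /andP[? ?]; case: (Fd x _) => //; lra.
  + by apply: cvg_at_right_filter; apply: (@deriv_at_cont F _ (f a)); apply: Fd; lra.
  + by apply: cvg_at_left_filter; apply: (@deriv_at_cont F _ (f b)); apply: Fd; lra.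
- move=> x; rewrite in_itv /= => /andP[? ?].
  by rewrite derive1E; apply: derive_val; apply: Fd; lra.
Qed.

(** The primitive starts at [a - 1] and is differentiated inside an interval ending at [b + 1], so
    that the derivatives at [a] and [b] are two-sided. *)
Lemma antiderivative f a b : continuous f ->
  exists F : R -> R, forall x, a <= x <= b -> deriv_at F x 1 (f x).
Proof.
move=> fc; exists (fun x => \int[@lebesgue_measure R]_(t in `[a - 1, x]) f t) => x xab.
have [] := @continuous_FTC1_closed R f (a - 1) x (b + 1).
- lra.
- apply: continuous_compact_integrable; first exact: segment_compact.
  exact: continuous_subspaceT.
- lra.
- exact: fc.
by move=> h1 h2; apply: (DeriveDef h1); rewrite -derive1E; exact: h2.
Qed.

(** Linearity goes through primitives, so that continuity replaces integrability as the side
    condition. *)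
Lemma seg_intD a b f g : a <= b -> continuous f -> continuous g ->
  seg_int a b (fun x => f x + g x) = seg_int a b f + seg_int a b g.
Proof.
move=> ab fc gc.
have [F Fd] := antiderivative a b fc; have [G Gd] := antiderivative a b gc.
rewrite (seg_int_FTC ab fc Fd) (seg_int_FTC ab gc Gd).
rewrite (@seg_int_FTC _ (fun x => F x + G x))// => [/=||x xab]; first by ring.
- exact: add_cont.
- by apply: deriv_atD; [apply: Fd|apply: Gd].
Qed.

Lemma seg_intZ a b k f : a <= b -> continuous f ->
  seg_int a b (fun x => k * f x) = k * seg_int a b f.
Proof.
move=> ab fc; have [F Fd] := antiderivative a b fc.
rewrite (seg_int_FTC ab fc Fd).
rewrite (@seg_int_FTC _ (fun x => k * F x))// => [/=||x xab]; first by ring.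
- by apply: mul_cont => //; apply: cst_cont.
- by apply: deriv_atZ; apply: Fd.
Qed.

Lemma seg_int_cst a b k : a <= b -> seg_int a b (fun=> k) = k * (b - a).
Proof.
move=> ab; rewrite (@seg_int_FTC _ (fun x => k * x))// => [||x xab]; first by ring.
- exact: cst_cont.
- by rewrite -[X in deriv_at _ _ _ X]mulr1; apply: deriv_atZ; apply: deriv_at_id.
Qed.

Lemma seg_int_ge0 a b f : (forall x, a <= x <= b -> 0 <= f x) -> 0 <= seg_int a b f.
Proof. by move=> h; apply: Rintegral_ge0 => x /=; rewrite in_itv /=; apply: h. Qed.

Lemma seg_int_le a b f g : a <= b -> continuous f -> continuous g ->
  (forall x, a <= x <= b -> f x <= g x) -> seg_int a b f <= seg_int a b g.
Proof.
move=> ab fc gc fg; rewrite -subr_ge0.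
rewrite -[- _]mulN1r -seg_intZ// -seg_intD//; last first.
  by apply: mul_cont => //; apply: cst_cont.
by apply: seg_int_ge0 => x /fg; rewrite mulN1r subr_ge0.
Qed.

Lemma seg_int_norm_le a b f (K : R) : a <= b -> continuous f ->
  (forall x, a <= x <= b -> `|f x| <= K) -> `|seg_int a b f| <= K * (b - a).
Proof.
move=> ab fc fK; rewrite ler_norml -mulNr -!seg_int_cst//.
have cc (k : R) : continuous (fun _ : R => k) by apply: cst_cont.
by apply/andP; split; apply: seg_int_le => // x /fK; rewrite ler_norml => /andP[].
Qed.

(* A primitive is monotone with equal end values, hence constant. *)
Lemma seg_int_eq0 a b f : continuous f -> (forall x, a <= x <= b -> 0 <= f x) ->
  seg_int a b f = 0 -> forall x, a < x < b -> f x = 0.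
Proof.
move=> fc f0 i0 x xab; have ab : a <= b by lra.
have [F Fd] := antiderivative a b fc.
move: i0; rewrite (seg_int_FTC ab fc Fd) => e.
have mono y z : a <= y -> y <= z -> z <= b -> F y <= F z.
  move=> ay yz zb; apply: (@le_of_deriv_ge0 F f) => // t ht.
  - by apply: (@deriv_at_cont F _ (f t)); apply: Fd; lra.
  - by apply: Fd; lra.
  - by apply: f0; lra.
have Fc y : a <= y <= b -> F y = F a.
  move=> /andP[ay yb]; have := mono _ _ (lexx a) ay yb.
  by have := mono _ _ ay yb (lexx b); lra.
have xI : deriv_at F x 1 (f x) by apply: Fd; lra.
apply: (deriv_at_unique (f := fun=> F a) (x := x) (v := 1)); last exact: deriv_at_cst.
apply: deriv_at_near xI.
have : x \in `]a, b[%R by rewrite in_itv /=.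
move=> /near_in_itvoo h; near=> y; apply: Fc.
have : y \in `]a, b[%R by near: y.
by rewrite in_itv /= => /andP[? ?]; lra.
Unshelve. all: by end_near. Qed.

(** A primitive is constant where the integrand vanishes. *)
Lemma seg_int_shrink a b c d f : a <= c -> c <= d -> d <= b -> continuous f ->
  (forall x, x <= c -> f x = 0) -> (forall x, d <= x -> f x = 0) ->
  seg_int a b f = seg_int c d f.
Proof.
move=> ac cd db fc f0 f1; have [F Fd] := antiderivative a b fc.
have ab : a <= b by lra.
rewrite (seg_int_FTC ab fc Fd) (@seg_int_FTC f F c d)//; last by move=> x xab; apply: Fd; lra.
have Fc y : a <= y <= b -> {for y, continuous F}.
  by move=> yab; apply: (@deriv_at_cont F _ (f y)); apply: Fd; lra.
congr (_ - _).
- apply/esym/eq_of_deriv0 => // x hx; first by apply: Fc; lra.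
  by apply: deriv_at_eq (Fd x _) (f1 x _); lra.
- apply: eq_of_deriv0 => // x hx; first by apply: Fc; lra.
  by apply: deriv_at_eq (Fd x _) (f0 x _); lra.
Qed.

End Calculus.

#[global] Opaque seg_int.

Lemma pair_cont (T U V : topologicalType) (f : T -> U) (g : T -> V) :
  continuous f -> continuous g -> continuous (fun x => (f x, g x)).
Proof. by move=> hf hg x; apply: cvg_pair; [apply: hf|apply: hg]. Qed.

Lemma comp_cont (T U V : topologicalType) (g : U -> V) (f : T -> U) :
  continuous g -> continuous f -> continuous (fun x => g (f x)).
Proof. by move=> hg hf x; apply: continuous_comp; [apply: hf|apply: hg]. Qed.

Lemma id_cont (T : topologicalType) : continuous (fun x : T => x).
Proof. by move=> x; apply: cvg_id. Qed.

Lemma fst_cont (T U : topologicalType) : continuous (fun q : T * U => q.1).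
Proof. by move=> x; apply: cvg_fst. Qed.

Lemma snd_cont (T U : topologicalType) : continuous (fun q : T * U => q.2).
Proof. by move=> x; apply: cvg_snd. Qed.

Lemma constant_cont (T U : topologicalType) (k : U) : continuous (fun _ : T => k).
Proof. by move=> x; apply: cvg_cst. Qed.

(** * Continuity and differentiation of integrals with a parameter *)

Section ParametricIntegrals.
Variable R : realType.

Lemma section_cont (T U V : topologicalType) (f : T -> U -> V) (u : T) :
  continuous (fun q : T * U => f q.1 q.2) -> continuous (f u).
Proof.
move=> fc; apply: (comp_cont (f := fun s => (u, s)) fc).
by apply: pair_cont; [apply: constant_cont|apply: id_cont].
Qed.

(** Tube-lemma argument: joint continuity gives the bound near each point of K, and compactness of K
    gives one neighbourhood of [u0] for all of them. *)
Lemma near_uniform (U V : topologicalType) (f : U -> V -> R) (K : set V) (u0 : U) (e : R) :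
  compact K -> continuous (fun q : U * V => f q.1 q.2) -> 0 < e ->
  \forall u \near u0, forall s, K s -> `|f u s - f u0 s| < e.
Proof.
move=> cpt fc e0.
have := (compact_near_coveringP _).1 cpt U (nbhs u0)
  (fun u s => `|f u s - f u0 s| < e) _.
apply=> s _.
have e2 : 0 < e / 2 by rewrite divr_gt0.
have /cvgrPdist_lt/(_ _ e2) h1 := fc (u0, s).
have h2 : \forall s' \near s, `|f u0 s - f u0 s'| < e / 2.
  have sc := @section_cont _ _ _ f u0 fc s.
  by move/cvgrPdist_lt : sc => /(_ _ e2).
have h3 : \forall s' \near s & u \near u0, `|f u0 s - f u s'| < e / 2.
  case: h1 => -[A B] /= [hA hB] hAB; exists (B, A) => //= -[s' u] /= [? ?].
  exact: (hAB (u, s')).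
have h4 : \forall s' \near s & u \near u0, `|f u0 s - f u0 s'| < e / 2.
  exists ([set s' | `|f u0 s - f u0 s'| < e / 2], setT) => /=; first by split => //; apply: filterT.
  by move=> -[s' u] [].
apply: filterS2 h3 h4 => -[s' u] /=.
move=> h h'; rewrite (_ : f u s' - f u0 s' = (f u0 s - f u0 s') - (f u0 s - f u s')); last by ring.
by rewrite (le_lt_trans (ler_normB _ _))//; lra.
Qed.

Lemma near_uniform_seg (U : topologicalType) (f : U -> R -> R) (a b : R) (u0 : U) (e : R) :
  continuous (fun q : U * R => f q.1 q.2) -> 0 < e ->
  \forall u \near u0, forall s, a <= s <= b -> `|f u s - f u0 s| < e.
Proof.
move=> fc e0; apply: filterS (near_uniform u0 (@segment_compact R a b) fc e0) => u h s sab.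
by apply: h; rewrite /= in_itv.
Qed.

Lemma seg_int_param_cont (U : topologicalType) (f : U -> R -> R) (a b : R) : a <= b ->
  continuous (fun q : U * R => f q.1 q.2) -> continuous (fun u => seg_int a b (f u)).
Proof.
move=> ab fc u0; apply/cvgrPdist_lt => e e0.
have e1 : 0 < e / (b - a + 1) by apply: divr_gt0 => //; lra.
have := @near_uniform_seg U f a b u0 _ fc e1; apply: filterS => u h.
have fcu v := section_cont (u := v) fc.
rewrite distrC -[X in _ - X]mul1r -mulNr -seg_intZ// -seg_intD//; last first.
  by apply: mul_cont => //; apply: cst_cont.
apply: (@le_lt_trans _ _ (e / (b - a + 1) * (b - a))).
  apply: seg_int_norm_le => // [|s /h].
    by apply: add_cont => //; apply: mul_cont => //; apply: cst_cont.
  by rewrite mulN1r => /ltW.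
rewrite mulrAC ltr_pdivrMr; last by lra.
by rewrite ltr_pM2l//; lra.
Qed.

Lemma deriv_at_intro (f : R -> R) (t0 d : R) :
  (forall e, 0 < e -> \forall t \near t0, `|f t - f t0 - d * (t - t0)| <= e * `|t - t0|) ->
  deriv_at f t0 1 d.
Proof.
move=> H.
have L : (fun h : R => h^-1 *: ((f \o shift t0) (h *: 1) - f t0)) @ 0^' --> d.
  apply/cvgrPdist_le => e e0.
  have /nbhs_ballP[r /= r0 h] := H _ e0.
  near=> y.
  have y0 : y != 0 by near: y; apply: nbhs_dnbhs_neq.
  have yr : `|y| < r by near: y; apply: dnbhs0_lt.
  rewrite /GRing.scale /= mulr1.
  have := h (y + t0); rewrite /ball /= addrK opprD addrCA subrr addr0 normrN => /(_ yr).
  rewrite -(ler_pM2l (x := `|y|^-1)) ?invr_gt0 ?normr_gt0//.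
  rewrite [_^-1 * (e * _)]mulrC mulfK ?normr_eq0// -normfV -normrM => h'.
  by move: h'; rewrite mulrBr [_^-1 * (d * y)]mulrC mulfK// distrC.
apply: DeriveDef; first exact: (cvgP _ L).
exact: (cvg_lim _ L).
Unshelve. all: by end_near. Qed.

(** By the mean value theorem the remainder of the integrand is [(g c s - g t0 s) * (t - t0)], which
    [near_uniform_seg] makes small uniformly in s. *)
Lemma seg_int_param_deriv (f g : R -> R -> R) (a b t0 : R) : a <= b ->
  (\forall t \near t0, continuous (f t) /\ forall s, deriv_at (fun t => f t s) t 1 (g t s)) ->
  continuous (fun q : R * R => g q.1 q.2) ->
  deriv_at (fun t => seg_int a b (f t)) t0 1 (seg_int a b (g t0)).
Proof.
move=> ab /nbhs_ballP[r /= r0 H] gc; apply: deriv_at_intro => e e0.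
have e1 : 0 < e / (b - a + 1) by apply: divr_gt0 => //; lra.
have /nbhs_ballP[r' /= r0' H'] := @near_uniform_seg R g a b t0 _ gc e1.
near=> t.
have tr : `|t0 - t| < r by near: t; apply: (nbhsx_ballx _ _ r0).
have tr' : `|t0 - t| < r' by near: t; apply: (nbhsx_ballx _ _ r0').
have fc : continuous (f t) by have [] := H t tr.
have fc0 : continuous (f t0) by have [] := H t0 (ballxx _ r0).
have gc0 : continuous (g t0) := section_cont (u := t0) gc.
pose D s := f t s + (- 1) * f t0 s + (- (t - t0)) * g t0 s.
have cZ (k : R) (u : R -> R) : continuous u -> continuous (fun s => k * u s).
  by move=> uc; apply: mul_cont => //; apply: cst_cont.
have -> : seg_int a b (f t) - seg_int a b (f t0) - seg_int a b (g t0) * (t - t0) = seg_int a b D.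
  rewrite /D !seg_intD ?seg_intZ//; first by ring.
  - exact: cZ.
  - by apply: add_cont => //; exact: cZ.
  - exact: cZ.
apply: (@le_trans _ _ (e / (b - a + 1) * `|t - t0| * (b - a))); last first.
  rewrite mulrAC ler_wpM2r// mulrAC ler_pdivrMr; last by lra.
  by rewrite ler_wpM2l ?ltW//; lra.
apply: seg_int_norm_le => // [|s sab].
  by apply: add_cont; [apply: add_cont => //|]; exact: cZ.
(* The intermediate point depends on s, but the ball that contains it does not. *)
have mv x y : x < y -> `|t0 - x| < Num.min r r' -> `|t0 - y| < Num.min r r' ->
    exists2 c, `|t0 - c| < Num.min r r' & f y s - f x s = g c s * (y - x).
  rewrite !ltr_norml => xy /andP[x1 x2] /andP[y1 y2].
  have [z hz|c hc ->] := @mean_value R (fun t => f t s) (fun t => g t s) x y xy.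
    have [|_] := H z; last by apply.
    rewrite /ball /= ltr_norml; have : Num.min r r' <= r by rewrite ge_min lexx.
    by move=> ?; apply/andP; split; lra.
  by exists c => //; rewrite ltr_norml; apply/andP; split; lra.
have m0 : 0 < Num.min r r' by rewrite lt_min r0 r0'.
have mt : `|t0 - t| < Num.min r r' by rewrite lt_min tr tr'.
have mt0 : `|t0 - t0| < Num.min r r' by rewrite subrr normr0.
have [c hc ec] : exists2 c, `|t0 - c| < Num.min r r' & f t s - f t0 s = g c s * (t - t0).
  case: (ltgtP t t0) => tt0.
  - have [c hc ec] := mv _ _ tt0 mt mt0; exists c => //; lra.
  - exact: mv.
  - by exists t0 => //; rewrite tt0 !subrr mulr0.
have -> : D s = (g c s - g t0 s) * (t - t0) by rewrite mulrBl -ec /D; ring.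
rewrite normrM ler_wpM2r//; apply/ltW/H' => //.
by move: hc; rewrite lt_min => /andP[].
Unshelve. all: by end_near. Qed.

Lemma seg_int_param_deriv_all (f g : R -> R -> R) (a b t0 : R) : a <= b ->
  (forall t, continuous (f t)) -> (forall s t, deriv_at (fun t => f t s) t 1 (g t s)) ->
  continuous (fun q : R * R => g q.1 q.2) ->
  deriv_at (fun t => seg_int a b (f t)) t0 1 (seg_int a b (g t0)).
Proof. by move=> ab fc fd gc; apply: seg_int_param_deriv => //; near=> t; split.
Unshelve. all: by end_near. Qed.

Lemma swap_cont (U V T : topologicalType) (f : U -> V -> T) :
  continuous (fun q : U * V => f q.1 q.2) -> continuous (fun q : V * U => f q.2 q.1).
Proof.
move=> fc; apply: (comp_cont (f := fun q => (q.2, q.1)) fc).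
by apply: pair_cont; [apply: snd_cont|apply: fst_cont].
Qed.

(* Both sides have the same derivative in the upper end [b]. *)
Lemma seg_int_swap (f : R -> R -> R) (a b c d : R) : a <= b -> c <= d ->
  continuous (fun q : R * R => f q.1 q.2) ->
  seg_int a b (fun x => seg_int c d (f x)) = seg_int c d (fun y => seg_int a b (fun x => f x y)).
Proof.
move=> ab cd fc; have fc' := swap_cont fc.
have ic : continuous (fun x => seg_int c d (f x)) by exact: seg_int_param_cont.
have jc z : a - 1 <= z -> continuous (fun y => seg_int (a - 1) z (fun x => f x y)).
  by move=> az; exact: (@seg_int_param_cont _ (fun y x => f x y)).
have fy y : continuous (fun x => f x y) := section_cont (f := fun y x => f x y) (u := y) fc'.
(* Starting at [a - 1] makes z = a an interior point, where the derivative is two-sided. *)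
pose B z := seg_int c d (fun y => seg_int (a - 1) z (fun x => f x y)).
have Bd z : a <= z <= b -> deriv_at B z 1 (seg_int c d (f z)).
  move=> zab; apply: seg_int_param_deriv => //.
  have : z \in `](a - 1), (b + 1)[%R by rewrite in_itv /=; lra.
  move=> /near_in_itvoo zn; near=> t.
  have : t \in `](a - 1), (b + 1)[%R by near: t.
  rewrite in_itv /= => /andP[t1 t2]; split; first by apply: jc; lra.
  move=> y; have [F Fd] := antiderivative (a - 1) (b + 1) (fy y).
  apply: (@deriv_at_near _ _ (fun z => F z - F (a - 1))).
    have : t \in `](a - 1), (b + 1)[%R by rewrite in_itv /=; lra.
    move=> /near_in_itvoo tn; near=> s.
    have : s \in `](a - 1), (b + 1)[%R by near: s.
    rewrite in_itv /= => /andP[s1 s2]; rewrite (seg_int_FTC (F := F))//; first by lra.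
    by move=> x hx; apply: Fd; lra.
  rewrite -[X in deriv_at _ _ _ X]subr0; apply: deriv_atB; last exact: deriv_at_cst.
  by apply: Fd; lra.
rewrite (seg_int_FTC ab ic Bd) /B -[- seg_int c d _]mulN1r -seg_intZ//; last by apply: jc; lra.
rewrite -seg_intD//; last 2 first.
  - by apply: jc; lra.
  - by apply: mul_cont; [apply: cst_cont|apply: jc; lra].
apply: eq_seg_int => y _; have [F Fd] := antiderivative (a - 1) (b + 1) (fy y).
rewrite !(seg_int_FTC (F := F))//; first by ring.
all: try (move=> x hx; apply: Fd); lra.
Unshelve. all: by end_near. Qed.

End ParametricIntegrals.

(** * Integrals over boxes *)

Section Space.
Variable R : realType.
Local Notation E := 'rV[R]_3.

Lemma ord3_ind (P : 'I_3 -> Prop) : P 0 -> P 1 -> P 2%:R -> forall i, P i.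
Proof.
move=> h0 h1 h2 i; have [->|[->|->]] // : i = 0 \/ i = 1 \/ i = 2%:R.
case: i => -[|[|[|//]]] hi; [left|right; left|right; right]; exact: val_inj.
Qed.

Lemma sum3E (V : nmodType) (F : 'I_3 -> V) : \sum_(i < 3) F i = F 0 + F 1 + F 2%:R.
Proof.
rewrite !big_ord_recr big_ord0 /= add0r.
by congr (F _ + F _ + F _); apply: val_inj.
Qed.

Lemma vec3_0 (a b c : R) : vec3 a b c 0 0 = a. Proof. by rewrite mxE. Qed.
Lemma vec3_1 (a b c : R) : vec3 a b c 0 1 = b. Proof. by rewrite mxE. Qed.
Lemma vec3_2 (a b c : R) : vec3 a b c 0 2%:R = c. Proof. by rewrite mxE. Qed.
Definition vec3E := (vec3_0, vec3_1, vec3_2).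

Lemma rV3P (x y : E) : x 0 0 = y 0 0 -> x 0 1 = y 0 1 -> x 0 2%:R = y 0 2%:R -> x = y.
Proof. by move=> h0 h1 h2; apply/rowP; apply: ord3_ind. Qed.

Lemma vec3_eta (x : E) : vec3 (x 0 0) (x 0 1) (x 0 2%:R) = x.
Proof. by apply: rV3P; rewrite vec3E. Qed.

Lemma coord_cont (i : 'I_3) : continuous (fun x : E => x 0 i).
Proof. exact: coord_continuous. Qed.

Lemma vec3_cont (T : topologicalType) (f g h : T -> R) : continuous f -> continuous g ->
  continuous h -> continuous (fun t => vec3 (f t) (g t) (h t)).
Proof.
move=> fc gc hc t.
have -> : (fun t => vec3 (f t) (g t) (h t)) = (fun t => f t *: (delta_mx 0 0 : E) +
    g t *: (delta_mx 0 1 : E) + h t *: (delta_mx 0 2%:R : E)).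
  by apply: funext => s; apply: rV3P; rewrite !mxE /=; ring.
apply: cvgD; first apply: cvgD.
- by apply: cvgZr_tmp; apply: fc.
- by apply: cvgZr_tmp; apply: gc.
- by apply: cvgZr_tmp; apply: hc.
Qed.

Definition set_coord (i : 'I_3) (s : R) (x : E) : E := x + (s - x 0 i) *: delta_mx 0 i.

Lemma set_coordE i s (x : E) j : set_coord i s x 0 j = if j == i then s else x 0 j.
Proof. by rewrite !mxE eqxx /= eq_sym; case: eqVneq => [->|_]; rewrite ?mulr1 ?mulr0; ring. Qed.

Lemma set_coord_vec0 s a b c : set_coord 0 s (vec3 a b c) = vec3 s b c.
Proof. by apply: rV3P; rewrite set_coordE ?vec3E. Qed.
Lemma set_coord_vec1 s a b c : set_coord 1 s (vec3 a b c) = vec3 a s c.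
Proof. by apply: rV3P; rewrite set_coordE ?vec3E. Qed.
Lemma set_coord_vec2 s a b c : set_coord 2%:R s (vec3 a b c) = vec3 a b s.
Proof. by apply: rV3P; rewrite set_coordE ?vec3E. Qed.

Lemma set_coord_cont i (x : E) : continuous (fun s => set_coord i s x).
Proof.
have -> : (fun s => set_coord i s x) =
    (fun s => vec3 (if 0 == i then s else x 0 0) (if 1 == i then s else x 0 1)
       (if 2%:R == i then s else x 0 2%:R)).
  by apply: funext => s; apply: rV3P; rewrite set_coordE ?vec3E.
have K (b : bool) (c : R) : continuous (fun s : R => if b then s else c).
  by case: b; [exact: id_cont|exact: cst_cont].
by apply: vec3_cont; exact: K.
Qed.

Lemma deriv_at_set_coord (f : E -> R) i (x : E) (s d : R) :
  deriv_at f (set_coord i s x) (delta_mx 0 i) d ->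
  deriv_at (fun s => f (set_coord i s x)) s 1 d.
Proof.
move=> /deriv_at_line h; apply/deriv_at_line.
move: h; congr deriv_at; apply: funext => h; congr f.
by rewrite /set_coord /GRing.scale /= mulr1 addrCA -scalerDl addrA.
Qed.

(** An iterated integral, so that all of its calculus is one-dimensional. It is identified with the
    Lebesgue integral on R^3 in [integral_R3E], which is applied to the initial data. *)
Definition box_int (M : R) (f : E -> R) : R :=
  seg_int (- M) M (fun a => seg_int (- M) M (fun b => seg_int (- M) M (fun c => f (vec3 a b c)))).

Lemma box_intE M f : box_int M f = seg_int (- M) M (fun a => seg_int (- M) M (fun b =>
  seg_int (- M) M (fun c => f (vec3 a b c)))).
Proof. by []. Qed.

Definition in_box (M : R) (x : E) := forall i, - M <= x 0 i <= M.

Lemma in_box_vec3 M a b c : - M <= a <= M -> - M <= b <= M -> - M <= c <= M ->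
  in_box M (vec3 a b c).
Proof. by move=> ? ? ?; apply: ord3_ind; rewrite vec3E. Qed.

Lemma vec3_cont3 : continuous (fun q : R * R * R => vec3 q.1.1 q.1.2 q.2).
Proof.
apply: vec3_cont; last exact: snd_cont.
- by apply: (comp_cont (@fst_cont _ _)); exact: fst_cont.
- by apply: (comp_cont (@snd_cont _ _)); exact: fst_cont.
Qed.

Section Fixed.
Variable M : R.
Hypothesis M0 : 0 <= M.
Let MM : - M <= M. Proof. by rewrite ge0_cp. Qed.

Lemma box_int_inner_cont (T : topologicalType) (f : T -> E -> R) :
  continuous (fun q : T * E => f q.1 q.2) ->
  [/\ continuous (fun q : T * R * R * R => f q.1.1.1 (vec3 q.1.1.2 q.1.2 q.2)),
      continuous (fun q : T * R * R => seg_int (- M) M (fun c => f q.1.1 (vec3 q.1.2 q.2 c))),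
      continuous (fun q : T * R => seg_int (- M) M (fun b => seg_int (- M) M (fun c => f q.1 (vec3 q.2 b c))))
   & continuous (fun t => box_int M (f t))].
Proof.
move=> fc.
have c1 : continuous (fun q : T * R * R * R => f q.1.1.1 (vec3 q.1.1.2 q.1.2 q.2)).
  apply: (comp_cont (f := fun q : T * R * R * R => (q.1.1.1, vec3 q.1.1.2 q.1.2 q.2)) fc).
  have f1 := @fst_cont (T * R * R)%type R; have f2 := comp_cont (@fst_cont (T * R)%type R) f1.
  apply: pair_cont; first exact: (comp_cont (@fst_cont T R) f2).
  apply: vec3_cont; last exact: snd_cont.
    exact: (comp_cont (@snd_cont T R) f2).
  exact: (comp_cont (@snd_cont (T * R)%type R) f1).
have c2 := @seg_int_param_cont R (T * R * R)%type (fun q c => f q.1.1 (vec3 q.1.2 q.2 c)) _ _ MM c1.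
have c3 := @seg_int_param_cont R (T * R)%type
  (fun q b => seg_int (- M) M (fun c => f q.1 (vec3 q.2 b c))) _ _ MM c2.
split => //; exact: (@seg_int_param_cont R T
  (fun t a => seg_int (- M) M (fun b => seg_int (- M) M (fun c => f t (vec3 a b c)))) _ _ MM c3).
Qed.

Lemma box_int_conts (f : E -> R) : continuous f ->
  [/\ forall a b, continuous (fun c => f (vec3 a b c)),
      continuous (fun q : R * R => seg_int (- M) M (fun c => f (vec3 q.1 q.2 c))),
      forall a, continuous (fun b => seg_int (- M) M (fun c => f (vec3 a b c)))
    & continuous (fun a => seg_int (- M) M (fun b => seg_int (- M) M (fun c => f (vec3 a b c))))].
Proof.
move=> fc.
have h1 a b : continuous (fun c => f (vec3 a b c)).
  by apply: (comp_cont fc); apply: vec3_cont; [exact: cst_cont|exact: cst_cont|exact: id_cont].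
have h2 : continuous (fun q : R * R => seg_int (- M) M (fun c => f (vec3 q.1 q.2 c))).
  apply: (@seg_int_param_cont R (R * R)%type (fun q c => f (vec3 q.1 q.2 c)) _ _ MM).
  exact: (comp_cont fc vec3_cont3).
have h3 a := section_cont (f := fun a b => seg_int (- M) M (fun c => f (vec3 a b c))) (u := a) h2.
split => //; exact: (@seg_int_param_cont R R
  (fun a b => seg_int (- M) M (fun c => f (vec3 a b c))) _ _ MM h2).
Qed.

Lemma eq_box_int (f g : E -> R) : (forall x, in_box M x -> f x = g x) -> box_int M f = box_int M g.
Proof.
move=> e; do 3 (apply: eq_seg_int => ? ?).
by apply: e; exact: in_box_vec3.
Qed.

Lemma box_intD (f g : E -> R) : continuous f -> continuous g ->
  box_int M (fun x => f x + g x) = box_int M f + box_int M g.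
Proof.
move=> /box_int_conts[f1 _ f3 f4] /box_int_conts[g1 _ g3 g4].
rewrite /box_int -(seg_intD MM f4 g4); apply: eq_seg_int => a _.
rewrite -(seg_intD MM (f3 a) (g3 a)); apply: eq_seg_int => b _.
by rewrite -(seg_intD MM (f1 a b) (g1 a b)).
Qed.

Lemma box_intZ k (f : E -> R) : continuous f ->
  box_int M (fun x => k * f x) = k * box_int M f.
Proof.
move=> /box_int_conts[f1 _ f3 f4].
rewrite /box_int -(seg_intZ k MM f4); apply: eq_seg_int => a _.
rewrite -(seg_intZ k MM (f3 a)); apply: eq_seg_int => b _.
by rewrite -(seg_intZ k MM (f1 a b)).
Qed.

Lemma box_intN (f : E -> R) : continuous f -> box_int M (fun x => - f x) = - box_int M f.
Proof.
move=> fc; rewrite -[RHS]mulN1r -(box_intZ (-1) fc); apply: eq_box_int => x _.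
by rewrite mulN1r.
Qed.

Lemma box_intB (f g : E -> R) : continuous f -> continuous g ->
  box_int M (fun x => f x - g x) = box_int M f - box_int M g.
Proof. by move=> fc gc; rewrite (box_intD fc (opp_cont gc)) (box_intN gc). Qed.

Lemma box_int_sum (I : finType) (F : I -> E -> R) : (forall i, continuous (F i)) ->
  box_int M (fun x => \sum_i F i x) = \sum_i box_int M (F i).
Proof.
move=> h; elim: (index_enum I) => [|i s IHs].
  rewrite big_nil -[RHS](mul0r (box_int M (fun=> 0))) -box_intZ; last exact: cst_cont.
  by apply: eq_box_int => x _; rewrite big_nil mul0r.
have hs : continuous (fun x => \sum_(j <- s) F j x).
  elim: s {IHs} => [|j s IHs].
    rewrite [X in continuous X](_ : _ = fun=> 0); first exact: cst_cont.
    by apply: funext => x; rewrite big_nil.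
  rewrite [X in continuous X](_ : _ = fun x => F j x + \sum_(k <- s) F k x).
    by apply: add_cont; [exact: h|exact: IHs].
  by apply: funext => x; rewrite big_cons.
rewrite big_cons -IHs -(box_intD (h i) hs); apply: eq_box_int => x _.
by rewrite big_cons.
Qed.

Lemma box_int_ge0 (f : E -> R) : (forall x, in_box M x -> 0 <= f x) -> 0 <= box_int M f.
Proof.
by move=> h; do 3 (apply: seg_int_ge0 => ? ?); apply: h; exact: in_box_vec3.
Qed.

Lemma box_int_le (f g : E -> R) : continuous f -> continuous g ->
  (forall x, in_box M x -> f x <= g x) -> box_int M f <= box_int M g.
Proof.
move=> fc gc fg; rewrite -subr_ge0 -box_intB//; apply: box_int_ge0 => x /fg.
by rewrite subr_ge0.
Qed.

Lemma box_int_cst k : box_int M (fun=> k) = k * (2 * M) ^+ 3.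
Proof.
rewrite /box_int.
under eq_seg_int => a _ do under eq_seg_int => b _ do rewrite seg_int_cst//.
under eq_seg_int => a _ do rewrite seg_int_cst//.
by rewrite seg_int_cst//; ring.
Qed.

Lemma box_int_eq0 (f : E -> R) : continuous f -> (forall x, in_box M x -> 0 <= f x) ->
  box_int M f = 0 -> forall x : E, (forall i, - M < x 0 i < M) -> f x = 0.
Proof.
move=> fc f0 + x hx; have [f1 _ f3 f4] := box_int_conts fc.
have w i : - M <= x 0 i <= M by move: (hx i) => /andP[? ?]; lra.
move/(seg_int_eq0 f4) => /(_ _ _ (hx 0)) e1.
have {}e1 := e1 (fun a ha => seg_int_ge0 (fun b hb => seg_int_ge0 (fun c hc =>
  f0 _ (in_box_vec3 ha hb hc)))).
have e2 := seg_int_eq0 (f3 _) (fun b hb => seg_int_ge0 (fun c hc =>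
  f0 _ (in_box_vec3 (w 0) hb hc))) e1 (hx 1).
have := seg_int_eq0 (f1 _ _) (fun c hc => f0 _ (in_box_vec3 (w 0) (w 1) hc)) e2 (hx 2%:R).
by rewrite vec3_eta.
Qed.

(** Fubini makes direction i the innermost one. The case K = 0 yields the divergence theorem; a
    positive K serves to bound the integral of F over a ball. *)
Lemma box_int_line_le (f : E -> R) i K : continuous f ->
  (forall x, seg_int (- M) M (fun s => f (set_coord i s x)) <= K) ->
  box_int M f <= K * (2 * M) ^+ 2.
Proof.
move=> fc; have [f1 f2 f3 f4] := box_int_conts fc.
have cc (k : R) : continuous (fun _ : R => k) by apply: cst_cont.
have e2 (g : R -> R -> R) : continuous (fun q : R * R => g q.1 q.2) ->
    (forall a b, g a b <= K) ->
    seg_int (- M) M (fun a => seg_int (- M) M (g a)) <= K * (2 * M) ^+ 2.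
  move=> gc gK; apply: (@le_trans _ _ (seg_int (- M) M (fun a => K * (M - - M)))).
    apply: seg_int_le => //; first exact: seg_int_param_cont.
    move=> a _; rewrite -seg_int_cst//; apply: seg_int_le => //.
    exact: section_cont.
  by rewrite seg_int_cst// le_eqVlt; apply/orP; left; apply/eqP; ring.
have sw (a : R) : seg_int (- M) M (fun b => seg_int (- M) M (fun c => f (vec3 a b c))) =
    seg_int (- M) M (fun c => seg_int (- M) M (fun b => f (vec3 a b c))).
  rewrite (@seg_int_swap R (fun b c => f (vec3 a b c)))//.
  apply: (comp_cont fc); apply: vec3_cont; [exact: cst_cont|exact: fst_cont|exact: snd_cont].
elim/ord3_ind : i => H.
- rewrite /box_int (@seg_int_swap R (fun a b => seg_int (- M) M (fun c => f (vec3 a b c))))//.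
  have sw' (b : R) : seg_int (- M) M (fun a => seg_int (- M) M (fun c => f (vec3 a b c))) =
      seg_int (- M) M (fun c => seg_int (- M) M (fun a => f (vec3 a b c))).
    rewrite (@seg_int_swap R (fun a c => f (vec3 a b c)))//.
    apply: (comp_cont fc); apply: vec3_cont; [exact: fst_cont|exact: cst_cont|exact: snd_cont].
  rewrite (@eq_seg_int _ _ _ _ (fun b => seg_int (- M) M (fun c => seg_int (- M) M (fun a => f (vec3 a b c)))))//.
  apply: (e2 (fun b c => seg_int (- M) M (fun a => f (vec3 a b c)))).
    apply: (@seg_int_param_cont R (R * R)%type (fun q a => f (vec3 a q.1 q.2)) _ _ MM).
    apply: (comp_cont fc); apply: vec3_cont; first exact: snd_cont.
      by apply: (comp_cont (@fst_cont _ _)); exact: fst_cont.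
    by apply: (comp_cont (@snd_cont _ _)); exact: fst_cont.
  move=> b c; rewrite (le_trans _ (H (vec3 0 b c)))// le_eqVlt; apply/orP; left; apply/eqP.
  by apply: eq_seg_int => s _; rewrite set_coord_vec0.
- rewrite /box_int.
  rewrite (@eq_seg_int _ _ _ _ (fun a => seg_int (- M) M (fun c => seg_int (- M) M (fun b => f (vec3 a b c)))))//.
  apply: (e2 (fun a c => seg_int (- M) M (fun b => f (vec3 a b c)))).
    apply: (@seg_int_param_cont R (R * R)%type (fun q b => f (vec3 q.1 b q.2)) _ _ MM).
    apply: (comp_cont fc); apply: vec3_cont; last 1 first.
    + by apply: (comp_cont (@snd_cont _ _)); exact: fst_cont.
    + by apply: (comp_cont (@fst_cont _ _)); exact: fst_cont.
    + exact: snd_cont.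
  move=> a c; rewrite (le_trans _ (H (vec3 a 0 c)))// le_eqVlt; apply/orP; left; apply/eqP.
  by apply: eq_seg_int => s _; rewrite set_coord_vec1.
- apply: (e2 (fun a b => seg_int (- M) M (fun c => f (vec3 a b c)))) => // a b.
  rewrite (le_trans _ (H (vec3 a b 0)))// le_eqVlt; apply/orP; left; apply/eqP.
  by apply: eq_seg_int => s _; rewrite set_coord_vec2.
Qed.

(** Each line integral in direction i is a difference of values on two opposite faces, hence 0;
    [box_int_line_le] with K = 0 is used for [dg] and for its opposite. *)
Lemma box_int_partial (g dg : E -> R) i : continuous dg ->
  (forall x : E, deriv_at g x (delta_mx 0 i) (dg x)) ->
  (forall x : E, `|x 0 i| = M -> g x = 0) -> box_int M dg = 0.
Proof.
move=> dc gd g0.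
have l0 x : seg_int (- M) M (fun s => dg (set_coord i s x)) = 0.
  rewrite (seg_int_FTC (F := fun s => g (set_coord i s x)))//.
  - by rewrite !g0 ?subrr// set_coordE eqxx ?normrN ger0_norm.
  - by apply: (comp_cont dc); exact: set_coord_cont.
  - by move=> s _; apply: deriv_at_set_coord.
apply/eqP; rewrite eq_le; apply/andP; split.
  rewrite -(mul0r ((2 * M) ^+ 2)); apply: (@box_int_line_le dg i 0 dc) => x.
  by rewrite l0.
rewrite -oppr_le0 -box_intN// -(mul0r ((2 * M) ^+ 2)).
apply: (@box_int_line_le _ i 0) => [|x]; first exact: opp_cont.
rewrite (@eq_seg_int _ _ _ _ (fun s => -1 * dg (set_coord i s x))); last by move=> ? _; rewrite mulN1r.
rewrite seg_intZ ?l0 ?mulr0//.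
by apply: (comp_cont dc); exact: set_coord_cont.
Qed.

Lemma box_int_param_deriv (f g : R -> E -> R) (t0 : R) :
  (\forall t \near t0, continuous (f t) /\ forall x, deriv_at (fun t => f t x) t 1 (g t x)) ->
  continuous (fun q : R * E => g q.1 q.2) ->
  deriv_at (fun t => box_int M (f t)) t0 1 (box_int M (g t0)).
Proof.
move=> H gc; have [g1 g2 g3 _] := box_int_inner_cont gc.
have G1 a b : continuous (fun q : R * R => g q.1 (vec3 a b q.2)).
  apply: (comp_cont (f := fun q : R * R => (q.1, a, b, q.2)) g1).
  apply: pair_cont; last exact: snd_cont.
  apply: pair_cont; last exact: constant_cont.
  by apply: pair_cont; [exact: fst_cont|exact: constant_cont].
have G2 a : continuous (fun q : R * R => seg_int (- M) M (fun c => g q.1 (vec3 a q.2 c))).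
  apply: (comp_cont (f := fun q : R * R => (q.1, a, q.2)) g2).
  apply: pair_cont; last exact: snd_cont.
  by apply: pair_cont; [exact: fst_cont|exact: constant_cont].
(* Each of the three nested differentiations needs its hypothesis in a neighbourhood, so the
   assumption is iterated: near each point near each point near t0. *)
have {}H : \forall t \near t0, \forall t \near t, continuous (f t) /\ forall x, deriv_at (fun t => f t x) t 1 (g t x).
  by have := near_join H.
have H2 : \forall t \near t0, \forall t \near t, continuous (f t) /\ forall x, deriv_at (fun t => f t x) t 1 (g t x).
  exact: H.
have D1 t a b : (\forall t \near t, continuous (f t) /\ forall x, deriv_at (fun t => f t x) t 1 (g t x)) ->
    deriv_at (fun t => seg_int (- M) M (fun c => f t (vec3 a b c))) t 1
      (seg_int (- M) M (fun c => g t (vec3 a b c))).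
  move=> Ht; apply: (@seg_int_param_deriv R (fun t c => f t (vec3 a b c)) (fun t c => g t (vec3 a b c))) => //.
  apply: filterS Ht => s [fc fd]; split => // c.
  by have [h _ _ _] := box_int_conts fc; apply: h.
have D2 t a : (\forall t \near t, \forall t \near t, continuous (f t) /\ forall x, deriv_at (fun t => f t x) t 1 (g t x)) ->
    deriv_at (fun t => seg_int (- M) M (fun b => seg_int (- M) M (fun c => f t (vec3 a b c)))) t 1
      (seg_int (- M) M (fun b => seg_int (- M) M (fun c => g t (vec3 a b c)))).
  move=> Ht; apply: (@seg_int_param_deriv R (fun t b => seg_int (- M) M (fun c => f t (vec3 a b c)))
    (fun t b => seg_int (- M) M (fun c => g t (vec3 a b c)))) => //.
  apply: filterS Ht => s Hs; split; last by move=> b; exact: D1.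
  have [fc _] := nbhs_singleton Hs.
  by have [_ _ h _] := box_int_conts fc; apply: h.
apply: (@seg_int_param_deriv R (fun t a => seg_int (- M) M (fun b => seg_int (- M) M (fun c => f t (vec3 a b c))))
  (fun t a => seg_int (- M) M (fun b => seg_int (- M) M (fun c => g t (vec3 a b c))))) => //.
have := near_join H2; apply: filterS => s Hs; split; last by move=> a; exact: D2.
have [fc _] := nbhs_singleton (nbhs_singleton Hs).
by have [_ _ _ h] := box_int_conts fc; apply: h.
Qed.

End Fixed.

Lemma box_int_shrink (m M : R) (f : E -> R) : 0 <= m -> m <= M -> continuous f ->
  (forall x : E, (exists i, m <= `|x 0 i|) -> f x = 0) -> box_int M f = box_int m f.
Proof.
move=> m0 mM fc f0; have M0 : 0 <= M by lra.
have [f1 _ f3 f4] := box_int_conts M0 fc.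
have [_ _ f3' _] := box_int_conts m0 fc.
have sh (g : R -> R) : continuous g -> (forall s, m <= `|s| -> g s = 0) ->
    seg_int (- M) M g = seg_int (- m) m g.
  move=> gc g0; apply: seg_int_shrink => //; [lra|lra| |] => s hs; apply: g0.
    by rewrite ler_normr orbC lerNr hs.
  by rewrite ler_normr hs.
have z1 a b : seg_int (- M) M (fun c => f (vec3 a b c)) = seg_int (- m) m (fun c => f (vec3 a b c)).
  by apply: sh => [|s hs]; [exact: f1|apply: f0; exists 2%:R; rewrite vec3E].
have zz (u v k : R) : u <= v -> k = 0 -> seg_int u v (fun=> k) = 0.
  by move=> uv ->; rewrite seg_int_cst// mul0r.
have z2 a : seg_int (- M) M (fun b => seg_int (- M) M (fun c => f (vec3 a b c))) =
    seg_int (- m) m (fun b => seg_int (- m) m (fun c => f (vec3 a b c))).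
  rewrite (sh _ (f3 a)); first by apply: eq_seg_int => b _; exact: z1.
  move=> s hs; rewrite (@eq_seg_int _ _ _ _ (fun=> 0)); first by apply: zz => //; lra.
  by move=> c _; apply: f0; exists 1; rewrite vec3E.
rewrite /box_int (sh _ f4); first by apply: eq_seg_int => a _; exact: z2.
move=> s hs; rewrite (@eq_seg_int _ _ _ _ (fun=> 0)); first by apply: zz => //; lra.
move=> b _; rewrite (@eq_seg_int _ _ _ _ (fun=> 0)); first by apply: zz => //; lra.
by move=> c _; apply: f0; exists 0; rewrite vec3E.
Qed.

#[global] Opaque box_int.

End Space.

(** * The Lebesgue integral on R^3 as an iterated integral *)

Section Measurability.

(** A countable base whose members lie in the family M. With M a product sigma-algebra it shows that
    open sets, hence continuous functions, on R^3 are measurable for the product structure that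
    underlies [integral_R3]. *)
Definition countable_base_in (T : topologicalType) (M : set (set T)) :=
  exists B : nat -> set T, (forall n, M (B n)) /\
    forall (x : T) (U : set T), nbhs x U -> exists n, B n x /\ B n `<=` U.

Lemma countable_base_prod (T U : topologicalType) (MT : set (set T)) (MU : set (set U))
    (M : set (set (T * U))) :
  countable_base_in MT -> countable_base_in MU ->
  (forall A B, MT A -> MU B -> M (A `*` B)) -> countable_base_in M.
Proof.
move=> [A [mA hA]] [B [mB hB]] h.
pose p n : nat * nat := odflt (0, 0)%N (unpickle n).
exists (fun n => A (p n).1 `*` B (p n).2); split => [n|[x y] W [[W1 W2] /= [w1 w2] W12]].
  exact: h.
have [n [nx nW]] := hA _ _ w1; have [m [my mW]] := hB _ _ w2.
exists (pickle (n, m)); rewrite /p pickleK /=; split => // -[a b] [/= ? ?].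
by apply: W12; split => /=; [apply: nW|apply: mW].
Qed.

Lemma open_of_countable_base (T : topologicalType) (M : set (set T)) (A : set T) :
  countable_base_in M -> M set0 ->
  (forall F : nat -> set T, (forall n, M (F n)) -> M (\bigcup_n F n)) -> open A -> M A.
Proof.
move=> [B [mB hB]] m0 mU oA.
have -> : A = \bigcup_n (if `[< B n `<=` A >] then B n else set0).
  apply/seteqP; split => [x Ax|x [n _]]; last by case: asboolP => // h; apply: h.
  have [n [nx nA]] := hB x A (open_nbhs_nbhs (conj oA Ax)).
  by exists n => //; case: asboolP.
by apply: mU => n; case: ifP.
Qed.

(** Products of the two exhausting sequences exhaust the product space because both are
    nondecreasing. The product measure thus becomes a factor to which Tonelli applies again. *)
Lemma sigma_finite_prod d1 d2 (T1 : measurableType d1) (T2 : measurableType d2) (R : realType)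
    (m1 : {sigma_finite_measure set T1 -> \bar R})
    (m2 : {sigma_finite_measure set T2 -> \bar R}) :
  sigma_finite setT ((m1 \x m2)%E : {measure set (T1 * T2)%type -> \bar R}).
Proof.
have /sigma_finiteP[F [TF ndF Foo]] := sigma_finiteT m1.
have /sigma_finiteP[G [TG ndG Goo]] := sigma_finiteT m2.
exists (fun n => F n `*` G n).
 rewrite -setXTT TF TG predeqE => -[x y]; split.
    move=> [/= [n _ Fnx] [k _ Gky]]; exists (maxn n k) => //; split.
    - by move: x Fnx; exact/subsetPset/ndF/leq_maxl.
    - by move: y Gky; exact/subsetPset/ndG/leq_maxr.
  by move=> [n _ []/= ? ?]; split; exists n.
move=> k; have [? ?] := Foo k; have [? ?] := Goo k.
split; first exact: measurableX.
have e := @product_measure1E _ _ _ _ R m1 m2 (F k) (G k) ltac:(assumption) ltac:(assumption).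
by apply: (eq_ind_r (fun y => y < +oo)%E _ e); rewrite lte_mul_pinfty// ge0_fin_numE.
Qed.

Lemma fubini_tonelli3 d1 d2 d3 (T1 : measurableType d1) (T2 : measurableType d2)
    (T3 : measurableType d3) (R : realType) (m1 : {sigma_finite_measure set T1 -> \bar R})
    (m2 : {sigma_finite_measure set T2 -> \bar R}) (m3 : {sigma_finite_measure set T3 -> \bar R})
    (f : T1 * T2 * T3 -> \bar R) :
  measurable_fun setT f -> (forall x, (0 <= f x)%E) ->
  (\int[(m1 \x m2) \x m3]_q f q = \int[m1]_a \int[m2]_b \int[m3]_c f (a, b, c))%E.
Proof.
move=> mf f0.
pose m12 : {sigma_finite_measure set (T1 * T2)%type -> \bar R} :=
  HB.pack (product_measure1 m1 m2) (Measure_isSigmaFinite.Build _ _ _ (product_measure1 m1 m2) (sigma_finite_prod m1 m2)).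
apply: (etrans (@fubini_tonelli1 _ _ _ _ R m12 m3 f mf f0)).
apply: (@fubini_tonelli1 _ _ _ _ R m1 m2 (fubini_F m3 f)).
  exact: measurable_fun_fubini_tonelli_F.
by move=> x; apply: integral_ge0 => y _; exact: f0.
Qed.

Variable R : realType.
Local Notation mu := (@lebesgue_measure R).
Local Notation T := (measurableTypeR R).

Lemma countable_base_R : @countable_base_in R (@measurable _ T).
Proof.
pose p n : rat * rat := odflt (0, 0) (unpickle n).
exists (fun n => `](ratr (p n).1), (ratr (p n).2)[%classic); split => [n|x U].
  exact: measurable_itv.
move=> /nbhs_ballP[e /= e0 xU].
have [q1] := @rat_in_itvoo R (x - e) x ltac:(lra).
have [q2] := @rat_in_itvoo R x (x + e) ltac:(lra).
rewrite !in_itv /= => /andP[h1 h2] /andP[h3 h4].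
exists (pickle (q1, q2)); rewrite /p pickleK /=; split => [|y]; first by rewrite in_itv /= h1 h4.
rewrite /= in_itv /= => /andP[y1 y2]; apply: xU; rewrite /ball /= ltr_norml.
by apply/andP; split; lra.
Qed.

Lemma continuous_measurable_R3 (f : R * R * R -> R) : continuous f ->
  measurable_fun [set: T * T * T] (f : T * T * T -> T).
Proof.
move=> fc; apply: (measurability _ (RGenOInfty.measurableE R)) => _ [_ [a ->] <-].
rewrite setTI; apply: (open_of_countable_base (T := (R * R * R)%type) (M := @measurable _ (T * T * T)%type)).
- apply: (@countable_base_prod (R * R)%type R (@measurable _ (T * T)%type) (@measurable _ T)).
  + apply: (countable_base_prod countable_base_R countable_base_R) => A B mA mB.
    exact: measurableX.
  + exact: countable_base_R.
  + by move=> A B mA mB; exact: measurableX.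
- exact: measurable0.
- by move=> F mF; apply: bigcupT_measurable.
- by apply: open_comp => [x _|]; [exact: fc|exact: interval_open].
Qed.

Lemma integral_line (M : R) (h : R -> R) : continuous h ->
  (forall x, M < `|x| -> h x = 0) -> (\int[mu]_x (h x)%:E = (seg_int (- M) M h)%:E)%E.
Proof.
move=> hc h0; rewrite seg_intE /Rintegral fineK; last first.
  apply: integrable_fin_num => //.
  apply: continuous_compact_integrable; first exact: segment_compact.
  exact: continuous_subspaceT.
rewrite [RHS]integral_mkcond; apply: eq_integral => x _.
rewrite patchE; case: ifPn => // /negP hx; congr (_%:E); apply: h0.
rewrite ltNge; apply/negP => xM; apply: hx.
by rewrite inE /= in_itv /= -ler_norml.
Qed.

Lemma integral_R3_ge0E (M : R) (f : 'rV[R]_3 -> R) : 0 <= M -> continuous f ->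
  (forall x, 0 <= f x) -> (forall x : 'rV[R]_3, (exists i, M < `|x 0 i|) -> f x = 0) ->
  (\int[((mu \x mu) \x mu)%E]_q (f (vec3 q.1.1 q.1.2 q.2))%:E = (box_int M f)%:E)%E.
Proof.
move=> M0 fc f0 fM; have [f1 f2 f3 f4] := box_int_conts M0 fc.
have c3 : continuous (fun q : R * R * R => f (vec3 q.1.1 q.1.2 q.2)) := comp_cont fc (@vec3_cont3 R).
have z (g : R -> R) : (forall c, g c = 0) -> seg_int (- M) M g = 0.
  move=> g0; rewrite (@eq_seg_int _ _ _ _ (fun=> 0))//.
  by rewrite seg_int_cst ?mul0r// ge0_cp.
have E := @fubini_tonelli3 _ _ _ _ _ _ R mu mu mu (fun q : T * T * T => (f (vec3 q.1.1 q.1.2 q.2))%:E)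
  ((measurable_EFinP _ _).2 (continuous_measurable_R3 c3)) (fun q => f0 (vec3 q.1.1 q.1.2 q.2)).
apply: (etrans E).
transitivity (\int[mu]_a (seg_int (- M) M (fun b => seg_int (- M) M (fun c => f (vec3 a b c))))%:E)%E.
  apply: eq_integral => a _ /=.
  transitivity (\int[mu]_b (seg_int (- M) M (fun c => f (vec3 a b c)))%:E)%E.
    apply: eq_integral => b _ /=; apply: integral_line => [|c hc]; first exact: f1.
    by apply: fM; exists 2%:R; rewrite vec3E.
  apply: integral_line => [|b hb]; first exact: f3.
  by apply: z => c; apply: fM; exists 1; rewrite vec3E.
rewrite box_intE; apply: integral_line => [|a ha]; first exact: f4.
rewrite (@eq_seg_int _ _ _ _ (fun=> 0)); first exact: z.
by move=> b _; apply: z => c; apply: fM; exists 0; rewrite vec3E.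
Qed.

Lemma integral_R3E (M : R) (f : 'rV[R]_3 -> R) : 0 <= M -> continuous f ->
  (forall x : 'rV[R]_3, (exists i, M < `|x 0 i|) -> f x = 0) -> integral_R3 f = box_int M f.
Proof.
move=> M0 fc fM.
have ac : continuous (fun x => `|f x|).
  by apply: (comp_cont (g := fun y : R => `|y|)) => // y; exact: norm_continuous.
(* Tonelli is available for nonnegative integrands; [f] is the difference of these two, both
   continuous and supported where [f] is. *)
pose g1 x := `|f x| + f x; pose g2 x := `|f x|.
have g1c : continuous g1 by exact: add_cont.
have g10 x : 0 <= g1 x by rewrite /g1 -lerBlDr sub0r lerNl lerNnormlW.
have g1M (x : 'rV[R]_3) : (exists i, M < `|x 0 i|) -> g1 x = 0.
  by move=> /fM; rewrite /g1 => ->; rewrite normr0 addr0.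
have g2M (x : 'rV[R]_3) : (exists i, M < `|x 0 i|) -> g2 x = 0.
  by move=> /fM; rewrite /g2 => ->; rewrite normr0.
have e1 := integral_R3_ge0E M0 g1c g10 g1M.
have e2 := integral_R3_ge0E M0 ac (fun x => normr_ge0 (f x)) g2M.
have int (g : 'rV[R]_3 -> R) : continuous g -> (forall x, 0 <= g x) ->
    (\int[((mu \x mu) \x mu)%E]_q (g (vec3 q.1.1 q.1.2 q.2))%:E = (box_int M g)%:E)%E ->
    ((mu \x mu) \x mu)%E.-integrable setT (EFin \o (fun q => g (vec3 q.1.1 q.1.2 q.2))).
  move=> gc g0 e; apply/integrableP; split.
    apply/measurable_EFinP; apply: continuous_measurable_R3.
    exact: (comp_cont gc (@vec3_cont3 R)).
  apply: (@le_lt_trans _ _ (box_int M g)%:E); last exact: ltry.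
  rewrite -e le_eqVlt; apply/orP; left; apply/eqP; apply: eq_integral => q _ /=.
  by rewrite ger0_norm.
have h := @RintegralB _ _ R ((mu \x mu) \x mu)%E setT
  (fun q => g1 (vec3 q.1.1 q.1.2 q.2)) (fun q => g2 (vec3 q.1.1 q.1.2 q.2)) measurableT
  (int _ g1c g10 e1) (int _ ac (fun x => normr_ge0 (f x)) e2).
have -> : integral_R3 f = \int[((mu \x mu) \x mu)%E]_x (g1 (vec3 x.1.1 x.1.2 x.2) - g2 (vec3 x.1.1 x.1.2 x.2)).
  by apply: eq_Rintegral => q _; rewrite /g1 /g2 addrAC subrr add0r.
rewrite h.
rewrite /Rintegral e1 e2 /= -(box_intB M0 g1c ac); apply: eq_box_int => x _.
by rewrite /g1 addrAC subrr add0r.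
Qed.

End Measurability.

(** * The spherical average of the exponential *)

Section SphereExp.
Variable R : realType.
Local Notation E := 'rV[R]_3.
Implicit Types (g h : R -> R -> R) (x b : E) (t p : R) (i j : 'I_3).

Definition sph t p : E := vec3 (sin p * cos t) (sin p * sin t) (cos p).
Definition sphi i t p : R := sph t p 0 i.

(** The integral of g(omega) e^(omega . x) over the unit sphere, with t the azimuth and p the polar
    angle. The free weight g makes F, its gradient and its Hessian members of one family:
    differentiation in direction v multiplies g by omega . v. *)
Definition sph_int g x : R :=
  seg_int 0 (2 * pi) (fun t => seg_int 0 pi (fun p => g t p * (expR (dotp (sph t p) x) * sin p))).

Lemma sin_comp (T : topologicalType) (f : T -> R) : continuous f -> continuous (fun y => sin (f y)).
Proof. by apply: comp_cont; exact: continuous_sin. Qed.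
Lemma cos_comp (T : topologicalType) (f : T -> R) : continuous f -> continuous (fun y => cos (f y)).
Proof. by apply: comp_cont; exact: continuous_cos. Qed.
Lemma expR_comp (T : topologicalType) (f : T -> R) : continuous f -> continuous (fun y => expR (f y)).
Proof. by apply: comp_cont; exact: continuous_expR. Qed.

Ltac solve_cont :=
  lazymatch goal with
  | |- forall q, continuous_at q (fun y => @?f y + @?g y) => apply: (@add_cont _ _ f g); solve_cont
  | |- forall q, continuous_at q (fun y => @?f y * @?g y) => apply: (@mul_cont _ _ f g); solve_cont
  | |- forall q, continuous_at q (fun y => - @?f y) => apply: (@opp_cont _ _ f); solve_cont
  | |- forall q, continuous_at q (fun y => sin (@?f y)) => apply: (@sin_comp _ f); solve_cont
  | |- forall q, continuous_at q (fun y => cos (@?f y)) => apply: (@cos_comp _ f); solve_cont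
  | |- _ => first [assumption | exact: fst_cont | exact: snd_cont | exact: cst_cont | idtac]
  end.

Lemma dotpE (v w : E) : dotp v w = v 0 0 * w 0 0 + v 0 1 * w 0 1 + v 0 2%:R * w 0 2%:R.
Proof. by rewrite /dotp sum3E. Qed.

Lemma sph_cont (T : topologicalType) (a c : T -> R) i :
  continuous a -> continuous c -> continuous (fun y => sphi i (a y) (c y)).
Proof.
move=> ac cc; have sa := sin_comp ac; have ca := cos_comp ac.
have sc := sin_comp cc; have co := cos_comp cc.
rewrite /sphi /sph; elim/ord3_ind: i.
- rewrite (_ : (fun y => _) = (fun y => sin (c y) * cos (a y))); last by apply: funext => y; rewrite vec3E.
  exact: mul_cont.
- rewrite (_ : (fun y => _) = (fun y => sin (c y) * sin (a y))); last by apply: funext => y; rewrite vec3E.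
  exact: mul_cont.
- by rewrite (_ : (fun y => _) = (fun y => cos (c y)))//; apply: funext => y; rewrite vec3E.
Qed.

Lemma sph_kernel_cont (T : topologicalType) (a c : T -> R) (z : T -> E) :
  continuous a -> continuous c -> continuous z ->
  continuous (fun y => expR (dotp (sph (a y) (c y)) (z y)) * sin (c y)).
Proof.
move=> ac cc zc; apply: mul_cont; last exact: sin_comp.
apply: expR_comp; rewrite /dotp; apply: sum_cont => i; apply: mul_cont.
  exact: sph_cont.
exact: (comp_cont (@coord_cont R i) zc).
Qed.

Let twopi_ge0 : (0 : R) <= 2 * pi. Proof. by rewrite mulr_ge0 ?pi_ge0. Qed.
Let pi_ge0' : (0 : R) <= pi. Proof. exact: pi_ge0. Qed.

Definition sph_test g := continuous (fun q : R * R => g q.1 q.2).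

Lemma sph_integrand_cont g : sph_test g ->
  continuous (fun q : E * R * R => g q.1.2 q.2 * (expR (dotp (sph q.1.2 q.2) q.1.1) * sin q.2)).
Proof.
move=> gc.
have f1 := @fst_cont (E * R)%type R; have f2 := comp_cont (@fst_cont E R) f1.
have f3 := comp_cont (@snd_cont E R) f1; have f4 := @snd_cont (E * R)%type R.
apply: mul_cont; last exact: sph_kernel_cont.
exact: (comp_cont (f := fun q : E * R * R => (q.1.2, q.2)) gc (pair_cont f3 f4)).
Qed.

Lemma sph_int_inner_cont g : sph_test g ->
  continuous (fun q : E * R => seg_int 0 pi (fun p => g q.2 p * (expR (dotp (sph q.2 p) q.1) * sin p))).
Proof.
move=> /sph_integrand_cont gc.
exact: (@seg_int_param_cont R (E * R)%type
  (fun q p => g q.2 p * (expR (dotp (sph q.2 p) q.1) * sin p)) _ _ pi_ge0' gc).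
Qed.

Lemma sph_int_cont g : sph_test g -> continuous (sph_int g).
Proof.
move=> /sph_int_inner_cont gc.
exact: (@seg_int_param_cont R E
  (fun x t => seg_int 0 pi (fun p => g t p * (expR (dotp (sph t p) x) * sin p))) _ _ twopi_ge0 gc).
Qed.

Lemma sph_int_conts g x : sph_test g ->
  (forall t, continuous (fun p => g t p * (expR (dotp (sph t p) x) * sin p))) /\
  continuous (fun t => seg_int 0 pi (fun p => g t p * (expR (dotp (sph t p) x) * sin p))).
Proof.
move=> gc; split => [t|].
  exact: (section_cont (f := fun (y : E * R) p => g y.2 p * (expR (dotp (sph y.2 p) y.1) * sin p))
    (u := (x, t)) (sph_integrand_cont gc)).
exact: (section_cont (f := fun x t => seg_int 0 pi (fun p => g t p * (expR (dotp (sph t p) x) * sin p)))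
    (u := x) (sph_int_inner_cont gc)).
Qed.

Lemma sph_intD g h x : sph_test g -> sph_test h ->
  sph_int (fun t p => g t p + h t p) x = sph_int g x + sph_int h x.
Proof.
move=> /(sph_int_conts x)[g1 g2] /(sph_int_conts x)[h1 h2].
rewrite /sph_int -(seg_intD twopi_ge0 g2 h2); apply: eq_seg_int => t _.
rewrite -(seg_intD pi_ge0' (g1 t) (h1 t)); apply: eq_seg_int => p _.
by rewrite mulrDl.
Qed.

Lemma sph_intZ k g x : sph_test g -> sph_int (fun t p => k * g t p) x = k * sph_int g x.
Proof.
move=> /(sph_int_conts x)[g1 g2].
rewrite /sph_int -(seg_intZ k twopi_ge0 g2); apply: eq_seg_int => t _.
rewrite -(seg_intZ k pi_ge0' (g1 t)); apply: eq_seg_int => p _.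
by rewrite -mulrA.
Qed.

Lemma eq_sph_int g h x : (forall t p, g t p = h t p) -> sph_int g x = sph_int h x.
Proof. by move=> e; do 2 (apply: eq_seg_int => ? _); rewrite e. Qed.

Lemma sph_int_ge0 g x : (forall t p, 0 <= g t p) -> 0 <= sph_int g x.
Proof.
move=> g0; apply: seg_int_ge0 => t _; apply: seg_int_ge0 => p hp.
by rewrite mulr_ge0// mulr_ge0 ?expR_ge0// sin_ge0_pi.
Qed.

Lemma sph_testM g h : sph_test g -> sph_test h -> sph_test (fun t p => g t p * h t p).
Proof. exact: mul_cont. Qed.

Lemma sph_test_sphi i : sph_test (sphi i).
Proof. by apply: sph_cont; [exact: fst_cont|exact: snd_cont]. Qed.

Lemma sph_test_dotp (v : E) : sph_test (fun t p => dotp (sph t p) v).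
Proof.
apply: sum_cont => i; apply: mul_cont; last exact: cst_cont.
exact: (@sph_test_sphi i).
Qed.

Lemma sph_test1 : sph_test (fun _ _ => 1).
Proof. exact: cst_cont. Qed.

Lemma deriv_at_coord x i j : deriv_at (fun y : E => y 0 j) x (delta_mx 0 i) (i == j)%:R.
Proof.
apply/deriv_at_line.
have -> : (fun s : R => (s *: delta_mx 0 i + x) 0 j) = (fun s => s * (i == j)%:R + x 0 j).
  by apply: funext => s; rewrite !mxE eqxx /= eq_sym.
have := deriv_atD (deriv_atM (deriv_at_id (0 : R)) (deriv_at_cst ((i == j)%:R : R) (0 : R) 1))
  (deriv_at_cst (x 0 j) (0 : R) 1).
by move/deriv_at_eq; apply; rewrite mulr0 mul1r !addr0.
Qed.

Lemma dotpD (w x y : E) : dotp w (x + y) = dotp w x + dotp w y.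
Proof. by rewrite !dotpE !mxE; ring. Qed.

Lemma dotpZ (w x : E) (k : R) : dotp w (k *: x) = k * dotp w x.
Proof. by rewrite !dotpE !mxE; ring. Qed.

Lemma deriv_at_dotp (w x v : E) : deriv_at (dotp w) x v (dotp w v).
Proof.
apply/deriv_at_line.
have -> : (fun s : R => dotp w (s *: v + x)) = (fun s => s * dotp w v + dotp w x).
  by apply: funext => s; rewrite dotpD dotpZ.
have := deriv_atD (deriv_atM (deriv_at_id (0 : R)) (deriv_at_cst (dotp w v) (0 : R) 1))
  (deriv_at_cst (dotp w x) (0 : R) 1).
by move/deriv_at_eq; apply; rewrite mulr0 mul1r !addr0.
Qed.

Lemma sph_int_deriv_dir g x (v : E) : sph_test g ->
  deriv_at (sph_int g) x v (sph_int (fun t p => g t p * dotp (sph t p) v) x).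
Proof.
move=> gc; apply/deriv_at_line.
pose l (s : R) : E := s *: v + x.
have lc : continuous l.
  move=> s; rewrite /l; apply: cvgD; last exact: cvg_cst.
  by apply: cvgZr_tmp; exact: cvg_id.
pose k g' (s t p : R) := g' t p * (expR (dotp (sph t p) (l s)) * sin p).
have kc g' : sph_test g' -> continuous (fun q : R * R * R => k g' q.1.1 q.1.2 q.2).
  move=> g'c; apply: (comp_cont (f := fun q : R * R * R => (l q.1.1, q.1.2, q.2)) (sph_integrand_cont g'c)).
  apply: pair_cont; last exact: snd_cont.
  apply: pair_cont; last by apply: (comp_cont (@snd_cont R R)); exact: fst_cont.
  by apply: (comp_cont lc); apply: (comp_cont (@fst_cont R R)); exact: fst_cont.
pose g' := fun t p => g t p * dotp (sph t p) v.
have g'c : sph_test g' by apply: sph_testM => //; exact: sph_test_dotp.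
have kd (s t p : R) : deriv_at (fun s => k g s t p) s 1 (k g' s t p).
  have h0 : deriv_at (fun s => dotp (sph t p) (l s)) s 1 (dotp (sph t p) v).
    have /deriv_at_line := deriv_at_dotp (sph t p) (l s) v.
    move=> h; have := @deriv_at_shift R (fun h : R => dotp (sph t p) (h *: v + l s)) s (- s) (dotp (sph t p) v).
    rewrite subrr => /(_ h); congr deriv_at; apply: funext => y.
    by rewrite /l addrA -scalerDl subrK.
  have h1 := deriv_at_comp (is_derive_expR _ : deriv_at _ _ _ _) h0.
  have := deriv_atZ (g t p) (deriv_atM h1 (deriv_at_cst (sin p) s 1)).
  by move/deriv_at_eq; apply; rewrite /k /g' mulr0 addr0; ring.
have e0 : x = l 0 by rewrite /l scale0r add0r.
rewrite {2}e0 /sph_int.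
have inner (s t : R) : deriv_at (fun s => seg_int 0 pi (k g s t)) s 1 (seg_int 0 pi (k g' s t)).
  apply: (@seg_int_param_deriv_all R (fun s p => k g s t p) (fun s p => k g' s t p) _ _ _ pi_ge0').
  - by move=> s'; exact: (section_cont (f := fun q p => k g q.1 q.2 p) (u := (s', t)) (kc _ gc)).
  - by move=> p s'; exact: kd.
  apply: (comp_cont (f := fun q : R * R => (q.1, t, q.2)) (kc _ g'c)).
  apply: pair_cont; last exact: snd_cont.
  by apply: pair_cont; [exact: fst_cont|exact: constant_cont].
have kcc g0 : sph_test g0 -> continuous (fun q : R * R => seg_int 0 pi (k g0 q.1 q.2)).
  by move=> /kc h; exact: (@seg_int_param_cont R (R * R)%type (fun q p => k g0 q.1 q.2 p) _ _ pi_ge0' h).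
apply: (@seg_int_param_deriv_all R (fun s t => seg_int 0 pi (k g s t)) (fun s t => seg_int 0 pi (k g' s t)) _ _ _ twopi_ge0).
- by move=> s; exact: (section_cont (f := fun s t => seg_int 0 pi (k g s t)) (u := s) (kcc _ gc)).
- by move=> t s; exact: inner.
- exact: kcc.
Qed.

Lemma sph_int_deriv g x i : sph_test g ->
  deriv_at (sph_int g) x (delta_mx 0 i) (sph_int (fun t p => g t p * sphi i t p) x).
Proof.
move=> gc; apply: deriv_at_eq (sph_int_deriv_dir x (delta_mx 0 i) gc) _.
apply: eq_sph_int => t p; congr (_ * _).
rewrite /dotp (bigD1 i)// big1 => [|j ji].
  by rewrite [delta_mx _ _ _ _]mxE !eqxx mulr1; exact: addr0.
by rewrite [delta_mx _ _ _ _]mxE (negPf ji) andbF mulr0.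
Qed.

(* The integrand is a divergence in the angular variables. *)
Lemma sph_int_div0 (G H dG dH : R -> R -> R) :
  (forall t p, deriv_at (G t) p 1 (dG t p)) -> (forall t p, deriv_at (H^~ p) t 1 (dH t p)) ->
  sph_test dG -> sph_test dH ->
  (forall t, G t 0 = 0 /\ G t pi = 0) -> (forall p, H 0 p = H (2 * pi) p) ->
  seg_int 0 (2 * pi) (fun t => seg_int 0 pi (fun p => dG t p + dH t p)) = 0.
Proof.
move=> Gd Hd dGc dHc G0 H0.
have Gs t := section_cont (u := t) dGc; have Hs t := section_cont (u := t) dHc.
have Hs' p := section_cont (f := fun p t => dH t p) (u := p) (swap_cont dHc).
rewrite (@eq_seg_int _ _ _ _ (fun t => seg_int 0 pi (dH t))); last first.
  move=> t _; rewrite (seg_intD pi_ge0' (Gs t) (Hs t)) (@seg_int_FTC _ (dG t) (G t))//.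
  by have [-> ->] := G0 t; rewrite subrr add0r.
rewrite seg_int_swap// (@eq_seg_int _ _ _ _ (fun=> 0)); first by rewrite seg_int_cst ?mul0r.
by move=> p _; rewrite (@seg_int_FTC _ (dH^~ p) (H^~ p)) ?H0 ?subrr//; exact: Hs'.
Qed.

(** Stated along a curve of angles so as to cover both coordinate directions: one of [a], [c] is
    constant in each use. *)
Lemma expw_deriv (a c da dc : R -> R) x s :
  deriv_at a s 1 (da s) -> deriv_at c s 1 (dc s) ->
  deriv_at (fun s => expR (dotp (sph (a s) (c s)) x)) s 1
    (expR (dotp (sph (a s) (c s)) x) *
     (x 0 0 * (cos (c s) * dc s * cos (a s) - sin (c s) * sin (a s) * da s) +
      x 0 1 * (cos (c s) * dc s * sin (a s) + sin (c s) * cos (a s) * da s) -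
      x 0 2%:R * (sin (c s) * dc s))).
Proof.
move=> ad cd.
have sd (f : R -> R) d : deriv_at f s 1 d -> deriv_at (fun s => sin (f s)) s 1 (cos (f s) * d).
  by move=> h; apply: deriv_at_comp h; exact: is_derive_sin.
have cod (f : R -> R) d : deriv_at f s 1 d -> deriv_at (fun s => cos (f s)) s 1 (- sin (f s) * d).
  by move=> h; apply: deriv_at_comp h; exact: is_derive_cos.
have h := deriv_atD (deriv_atD (deriv_atZ (x 0 0) (deriv_atM (sd _ _ cd) (cod _ _ ad)))
  (deriv_atZ (x 0 1) (deriv_atM (sd _ _ cd) (sd _ _ ad)))) (deriv_atZ (x 0 2%:R) (cod _ _ cd)).
have e : (fun s => dotp (sph (a s) (c s)) x) = (fun s => x 0 0 * (sin (c s) * cos (a s)) +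
    x 0 1 * (sin (c s) * sin (a s)) + x 0 2%:R * cos (c s)).
  by apply: funext => y; rewrite dotpE /sph !vec3E; ring.
have := deriv_at_comp (is_derive_expR _ : deriv_at _ _ _ _) h.
have e' y : dotp (sph (a y) (c y)) x = x 0 0 * (sin (c y) * cos (a y)) +
    x 0 1 * (sin (c y) * sin (a y)) + x 0 2%:R * cos (c y) := congr1 (fun f => f y) e.
rewrite -e'.
have -> : (fun y => expR (x 0 0 * (sin (c y) * cos (a y)) +
    x 0 1 * (sin (c y) * sin (a y)) + x 0 2%:R * cos (c y))) = (fun s => expR (dotp (sph (a s) (c s)) x)).
  by apply: funext => y; rewrite -e'.
by move/deriv_at_eq; apply; ring.
Qed.

(* The gradient and the Hessian of [sphere_exp]. *)
Definition sph1 i := sph_int (sphi i).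
Definition sph2 i j := sph_int (fun t p => sphi i t p * sphi j t p).

Lemma sph_int1E x : sph_int (fun _ _ => 1) x = sphere_exp x.
Proof.
rewrite /sphere_exp /integral_S2 /sph_int seg_intE; apply: eq_Rintegral => t _.
by rewrite seg_intE; apply: eq_Rintegral => p _; rewrite mul1r.
Qed.

Let expc x : continuous (fun q : R * R => expR (dotp (sph q.1 q.2) x)).
Proof.
apply: expR_comp; rewrite /dotp; apply: sum_cont => i; apply: mul_cont; last exact: cst_cont.
by apply: sph_cont; [exact: fst_cont|exact: snd_cont].
Qed.
Let s1 := sin_comp (@fst_cont R R). Let s2 := sin_comp (@snd_cont R R).
Let c1 := cos_comp (@fst_cont R R). Let c2 := cos_comp (@snd_cont R R).

Let sinDd t : deriv_at sin t 1 (cos t : R). Proof. exact: is_derive_sin. Qed.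
Let cosDd t : deriv_at cos t 1 (- sin t : R). Proof. exact: is_derive_cos. Qed.
Let idd t : deriv_at (fun s : R => s) t 1 1. Proof. exact: deriv_at_id. Qed.
Let cd0 (k t : R) : deriv_at (fun _ : R => k) t 1 0. Proof. exact: deriv_at_cst. Qed.

Let rotE i j x : x 0 i * sph1 j x - x 0 j * sph1 i x =
  sph_int (fun t p => x 0 i * sphi j t p + (- x 0 j) * sphi i t p) x.
Proof.
rewrite -mulNr -!sph_intZ; try exact: sph_test_sphi.
by rewrite -sph_intD//; apply: mul_cont; (try exact: cst_cont); exact: sph_test_sphi.
Qed.

(** F is radial, so grad F is parallel to x. Infinitesimally, (x_i omega_j - x_j omega_i) e^(omega .
    x) is up to sign the derivative of e^(omega . x) along a rotation field of the sphere; that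
    field is divergence free, so the integral vanishes. For the third axis the field is d/dt. *)
Lemma sph_rot01 x : x 0 0 * sph1 1 x = x 0 1 * sph1 0 x.
Proof.
apply/eqP; rewrite -subr_eq0 rotE; apply/eqP.
pose e t p := expR (dotp (sph t p) x).
pose H t p := - (e t p * sin p).
pose dH t p := - (e t p * (x 0 0 * - (sin p * sin t) + x 0 1 * (sin p * cos t)) * sin p).
rewrite -(@sph_int_div0 (fun _ _ => 0) H (fun _ _ => 0) dH) /=; last 6 first.
- by move=> t p; exact: cd0.
- move=> t p; have := deriv_atN (deriv_atM (@expw_deriv (fun s => s) (fun=> p) (fun=> 1) (fun=> 0) x t (idd t) (cd0 p t)) (cd0 (sin p) t)).
  by move/deriv_at_eq; apply; rewrite /dH /e; ring.
- exact: cst_cont.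
- by rewrite /sph_test /dH /e; cbv beta; solve_cont; exact: expc.
- by [].
- by move=> p; rewrite /H /e /sph sin0 cos0 mulr_natl sin2pi cos2pi.
apply: eq_seg_int => t _; apply: eq_seg_int => p _.
by rewrite /dH /e /sphi /sph !vec3E; ring.
Qed.

Lemma sph_rot12 x : x 0 1 * sph1 2%:R x = x 0 2%:R * sph1 1 x.
Proof.
apply/eqP; rewrite -subr_eq0 rotE; apply/eqP.
pose e t p := expR (dotp (sph t p) x).
(* Up to sign, [sin p] times the (p, t) components of the rotation field about the first axis, times
   e^(omega . x). The factor [sin p] is the area density and removes the singularity at the
   poles. *)
pose G t p := sin t * sin p * e t p.
pose H t p := cos p * cos t * e t p.
pose dG t p := sin t * cos p * e t p + sin t * sin p * (e t p *
  (x 0 0 * (cos p * cos t) + x 0 1 * (cos p * sin t) - x 0 2%:R * sin p)).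
pose dH t p := - (cos p * sin t) * e t p + cos p * cos t * (e t p *
  (x 0 0 * - (sin p * sin t) + x 0 1 * (sin p * cos t))).
rewrite -(@sph_int_div0 G H dG dH) /=; last 6 first.
- move=> t p; have := deriv_atM (deriv_atM (cd0 (sin t) p) (sinDd p)) (@expw_deriv (fun=> t) (fun s => s) (fun=> 0) (fun=> 1) x p (cd0 t p) (idd p)).
  by move/deriv_at_eq; apply; rewrite /dG /e; ring.
- move=> t p; have := deriv_atM (deriv_atM (cd0 (cos p) t) (cosDd t)) (@expw_deriv (fun s => s) (fun=> p) (fun=> 1) (fun=> 0) x t (idd t) (cd0 p t)).
  by move/deriv_at_eq; apply; rewrite /dH /e; ring.
- by rewrite /sph_test /dG /e; cbv beta; solve_cont; exact: expc.
- by rewrite /sph_test /dH /e; cbv beta; solve_cont; exact: expc.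
- by move=> t; rewrite /G sin0 sinpi !mulr0 !mul0r.
- by move=> p; rewrite /H /e /sph sin0 cos0 mulr_natl sin2pi cos2pi.
apply: eq_seg_int => t _; apply: eq_seg_int => p _; rewrite /dG /dH /e /sphi /sph !vec3E.
have sc : sin t * sin t = 1 - cos t * cos t by have := cos2Dsin2 t; rewrite !expr2; lra.
set E0 := expR _; transitivity ((x 0 1 * (sin p * cos p) * (sin t * sin t + cos t * cos t) -
  x 0 2%:R * (sin t * (sin p * sin p))) * E0); last by ring.
by rewrite sc; ring.
Qed.

Lemma sph_rot02 x : x 0 0 * sph1 2%:R x = x 0 2%:R * sph1 0 x.
Proof.
apply/eqP; rewrite -subr_eq0 rotE; apply/eqP.
pose e t p := expR (dotp (sph t p) x).
(* The same construction for the rotation about the second axis. *)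
pose G t p := cos t * sin p * e t p.
pose H t p := - (cos p * sin t * e t p).
pose dG t p := cos t * cos p * e t p + cos t * sin p * (e t p *
  (x 0 0 * (cos p * cos t) + x 0 1 * (cos p * sin t) - x 0 2%:R * sin p)).
pose dH t p := - (cos p * cos t * e t p + cos p * sin t * (e t p *
  (x 0 0 * - (sin p * sin t) + x 0 1 * (sin p * cos t)))).
rewrite -(@sph_int_div0 G H dG dH) /=; last 6 first.
- move=> t p; have := deriv_atM (deriv_atM (cd0 (cos t) p) (sinDd p)) (@expw_deriv (fun=> t) (fun s => s) (fun=> 0) (fun=> 1) x p (cd0 t p) (idd p)).
  by move/deriv_at_eq; apply; rewrite /dG /e; ring.
- move=> t p; have := deriv_atN (deriv_atM (deriv_atM (cd0 (cos p) t) (sinDd t)) (@expw_deriv (fun s => s) (fun=> p) (fun=> 1) (fun=> 0) x t (idd t) (cd0 p t))).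
  by move/deriv_at_eq; apply; rewrite /dH /e; ring.
- by rewrite /sph_test /dG /e; cbv beta; solve_cont; exact: expc.
- by rewrite /sph_test /dH /e; cbv beta; solve_cont; exact: expc.
- by move=> t; rewrite /G sin0 sinpi !mulr0 !mul0r.
- by move=> p; rewrite /H /e /sph sin0 cos0 mulr_natl sin2pi cos2pi.
apply: eq_seg_int => t _; apply: eq_seg_int => p _; rewrite /dG /dH /e /sphi /sph !vec3E.
have sc : sin t * sin t = 1 - cos t * cos t by have := cos2Dsin2 t; rewrite !expr2; lra.
set E0 := expR _; transitivity ((x 0 0 * (sin p * cos p) * (sin t * sin t + cos t * cos t) -
  x 0 2%:R * (cos t * (sin p * sin p))) * E0); last by ring.
by rewrite sc; ring.
Qed.

#[local] Opaque sph_int.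

Lemma sph_rot i j x : x 0 i * sph1 j x = x 0 j * sph1 i x.
Proof.
have h01 := sph_rot01 x; have h12 := sph_rot12 x; have h02 := sph_rot02 x.
elim/ord3_ind: i; elim/ord3_ind: j.
- reflexivity.
- exact: h01.
- exact: h02.
- exact: (esym h01).
- reflexivity.
- exact: h12.
- exact: (esym h02).
- exact: (esym h12).
- reflexivity.
Qed.

Lemma sphere_expE : @sphere_exp R = sph_int (fun _ _ => 1).
Proof. by apply: funext => x; rewrite sph_int1E. Qed.

Lemma sphere_exp_cont : continuous (@sphere_exp R).
Proof. by rewrite sphere_expE; apply: sph_int_cont; exact: sph_test1. Qed.

Lemma sph1_cont i : continuous (sph1 i).
Proof. by rewrite /sph1; apply: sph_int_cont; exact: sph_test_sphi. Qed.

Lemma sph2_cont i j : continuous (sph2 i j).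
Proof. by rewrite /sph2; apply: sph_int_cont; apply: sph_testM; exact: sph_test_sphi. Qed.

Lemma sphere_exp_deriv i x : deriv_at (@sphere_exp R) x (delta_mx 0 i) (sph1 i x).
Proof.
rewrite sphere_expE; apply: deriv_at_eq (sph_int_deriv x i sph_test1) _.
by apply: eq_sph_int => t p; rewrite mul1r.
Qed.

Lemma sph1_deriv i j x : deriv_at (sph1 i) x (delta_mx 0 j) (sph2 i j x).
Proof. by rewrite /sph1 /sph2; apply: sph_int_deriv; exact: sph_test_sphi. Qed.

Lemma sphi_sqr_sum t p : \sum_i sphi i t p ^+ 2 = 1.
Proof.
rewrite sum3E /sphi /sph !vec3E; have h1 := cos2Dsin2 t; have h2 := cos2Dsin2 p.
transitivity (sin p ^+ 2 * (cos t ^+ 2 + sin t ^+ 2) + cos p ^+ 2); first by ring.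
by rewrite h1 mulr1 addrC.
Qed.

Lemma sphi_norm_le i t p : `|sphi i t p| <= 1.
Proof.
rewrite -(@expr_le1 _ 2)// real_normK ?num_real// -(sphi_sqr_sum t p) (bigD1 i)//=.
by rewrite lerDl; apply: sumr_ge0 => j _; exact: sqr_ge0.
Qed.

Lemma sph_int_sum (G : 'I_3 -> R -> R -> R) x : (forall i, sph_test (G i)) ->
  sph_int (fun t p => \sum_i G i t p) x = \sum_i sph_int (G i) x.
Proof.
move=> Gc; rewrite sum3E -(sph_intD x (Gc 0) (Gc 1)).
rewrite -(sph_intD x _ (Gc 2%:R)); last exact: (add_cont (Gc 0) (Gc 1)).
by apply: eq_sph_int => t p; rewrite sum3E.
Qed.

(** The weights omega_i^2 add up to 1 on the sphere. *)
Lemma sphere_exp_lap x : sphere_exp x = \sum_i sph2 i i x.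
Proof.
rewrite /sph2 -(sph_int_sum (G := fun i t p => sphi i t p * sphi i t p)); last first.
  by move=> i; apply: sph_testM; exact: sph_test_sphi.
by rewrite -sph_int1E; apply: eq_sph_int => t p; rewrite -(sphi_sqr_sum t p).
Qed.

(** The quadratic form of the Hessian is the integral of (b . omega)^2 e^(omega . x). *)
Lemma sph2_quad_ge0 x b : 0 <= \sum_i \sum_j b 0 i * b 0 j * sph2 i j x.
Proof.
have Tij i j : sph_test (fun t p => sphi i t p * sphi j t p).
  by apply: sph_testM; exact: sph_test_sphi.
have TZ (k : R) g : sph_test g -> sph_test (fun t p => k * g t p).
  by move=> gc; apply: mul_cont => //; exact: cst_cont.
have e i : \sum_j b 0 i * b 0 j * sph2 i j x =
    sph_int (fun t p => \sum_j b 0 i * b 0 j * (sphi i t p * sphi j t p)) x.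
  rewrite (sph_int_sum (G := fun j t p => b 0 i * b 0 j * (sphi i t p * sphi j t p))); last first.
    by move=> j; exact: TZ.
  by apply: eq_bigr => j _; rewrite -(sph_intZ _ x (Tij i j)).
under eq_bigr => i _ do rewrite e.
rewrite -(sph_int_sum (G := fun i t p => \sum_j b 0 i * b 0 j * (sphi i t p * sphi j t p))); last first.
  move=> i; apply: (sum_cont (F := fun j (q : R * R) => b 0 i * b 0 j * (sphi i q.1 q.2 * sphi j q.1 q.2))) => j.
  exact: (TZ _ (fun t p => sphi i t p * sphi j t p) (Tij i j)).
apply: sph_int_ge0 => t p; rewrite [X in 0 <= X](_ : _ = (\sum_i b 0 i * sphi i t p) ^+ 2) ?sqr_ge0//.
by rewrite !sum3E; ring.
Qed.

Lemma sph2_diag_ge0 i x : 0 <= sph2 i i x.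
Proof. by rewrite /sph2; apply: sph_int_ge0 => t p; exact: sqr_ge0. Qed.

Lemma sphere_exp_ge0 x : 0 <= sphere_exp x.
Proof. by rewrite sphere_expE; apply: sph_int_ge0. Qed.

Lemma sph1_le i x : `|sph1 i x| <= sphere_exp x.
Proof.
rewrite sphere_expE /sph1 ler_norml; apply/andP; split.
- rewrite -subr_ge0 opprK addrC -(sph_intD x sph_test1 (@sph_test_sphi i)).
  by apply: sph_int_ge0 => t p; have := sphi_norm_le i t p; rewrite ler_norml; lra.
- rewrite -subr_ge0 -mulN1r -(sph_intZ _ x (@sph_test_sphi i)).
  rewrite -(sph_intD x sph_test1); last by apply: mul_cont; [exact: cst_cont|exact: sph_test_sphi].
  by apply: sph_int_ge0 => t p; have := sphi_norm_le i t p; rewrite ler_norml; lra.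
Qed.

Lemma sph_int_dotp v x : sph_int (fun t p => dotp (sph t p) v) x = \sum_i v 0 i * sph1 i x.
Proof.
rewrite (sph_int_sum (G := fun i t p => sphi i t p * v 0 i)); last first.
  by move=> i; apply: mul_cont; [exact: (@sph_test_sphi i)|exact: cst_cont].
apply: eq_bigr => i _; rewrite /sph1 -(sph_intZ _ x (@sph_test_sphi i)).
by apply: eq_sph_int => t p; rewrite mulrC.
Qed.

Lemma sphere_exp_deriv_dir x v : deriv_at (@sphere_exp R) x v (\sum_i v 0 i * sph1 i x).
Proof.
rewrite sphere_expE; apply: deriv_at_eq (sph_int_deriv_dir x v sph_test1) _.
by rewrite -sph_int_dotp; apply: eq_sph_int => t p; rewrite mul1r.
Qed.

Lemma sph1_deriv_dir i x v : deriv_at (sph1 i) x v (\sum_j sph2 i j x * v 0 j).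
Proof.
rewrite /sph1; apply: deriv_at_eq (sph_int_deriv_dir x v (@sph_test_sphi i)) _.
rewrite /sph2; have T j : sph_test (fun t p => sphi i t p * sphi j t p).
  by apply: sph_testM; exact: sph_test_sphi.
transitivity (\sum_j sph_int (fun t p => v 0 j * (sphi i t p * sphi j t p)) x); last first.
  by apply: eq_bigr => j _; rewrite (sph_intZ _ x (T j)) mulrC.
rewrite -(sph_int_sum (G := fun j t p => v 0 j * (sphi i t p * sphi j t p))); last first.
  by move=> j; apply: mul_cont; [exact: cst_cont|exact: T].
apply: eq_sph_int => t p; rewrite /dotp mulr_sumr; apply: eq_bigr => j _.
by rewrite -/(sphi j t p); ring.
Qed.

End SphereExp.

#[global] Opaque sphere_exp sph_int sph1 sph2.

(** * Tangential Hessian and growth of F *)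

Section SphereExpGrowth.
Variable R : realType.
Local Notation E := 'rV[R]_3.
Implicit Types (x b v : E) (i j k : 'I_3).

(** The identity x_i F_j = x_j F_i differentiated in x_k. *)
Lemma sph_rot_deriv i j k x :
  (i == k)%:R * sph1 j x + x 0 i * sph2 j k x = (j == k)%:R * sph1 i x + x 0 j * sph2 i k x.
Proof.
have h1 := deriv_atM (deriv_at_coord x k i) (sph1_deriv j k x).
have h2 := deriv_atM (deriv_at_coord x k j) (sph1_deriv i k x).
have e : (fun y : E => y 0 j * sph1 i y) = (fun y => y 0 i * sph1 j y).
    by apply: funext => y; exact: sph_rot.
rewrite e in h2; rewrite eq_sym [(j == k)]eq_sym; exact: (deriv_at_unique h1 h2).
Qed.

(* Differentiating the rotation identity and contracting gives D2F x = F x - 2 grad F. *)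
Lemma sph2_radial i x : \sum_j sph2 i j x * x 0 j = x 0 i * sphere_exp x - 2 * sph1 i x.
Proof.
have r k j := sph_rot_deriv i j k x.
have s : \sum_j ((i == j)%:R * sph1 j x + x 0 i * sph2 j j x) =
         \sum_j (1 * sph1 i x + x 0 j * sph2 i j x).
  by apply: eq_bigr => j _; rewrite r eqxx.
have l : \sum_j ((i == j)%:R * sph1 j x + x 0 i * sph2 j j x) = sph1 i x + x 0 i * sphere_exp x.
  rewrite big_split -(big_distrr (x 0 i)) -(sphere_exp_lap x); congr (_ + _).
  rewrite (bigD1 i) ?eqxx ?mul1r; last by [].
  rewrite big1; first exact: addr0.
  by move=> j /negPf; rewrite eq_sym => ->; rewrite mul0r.
have l' : \sum_j (1 * sph1 i x + x 0 j * sph2 i j x) = 3 * sph1 i x + \sum_j sph2 i j x * x 0 j.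
  rewrite big_split; congr (_ + _).
    by rewrite sum3E; ring.
  by apply: eq_bigr => j _; rewrite mulrC.
move: s; rewrite l l'; move: (\sum_j _) (sph1 i x) (x 0 i * sphere_exp x) => S a c h; lra.
Qed.

(** For a radial function of r = |x| the Hessian acts on vectors tangent to spheres as
    multiplication by F' / r. Here this is pure algebra, with [f] and [h] abstract families in place
    of the gradient and the Hessian. *)
Lemma tangent_algebra (x b f : 'I_3 -> R) (h : 'I_3 -> 'I_3 -> R) :
  (forall i j k, (i == k)%:R * f j + x i * h j k = (j == k)%:R * f i + x j * h i k) ->
  \sum_i b i * x i = 0 ->
  (\sum_i x i * x i) * (\sum_i \sum_j b i * b j * h i j) = (\sum_i b i * b i) * \sum_i x i * f i.
Proof.
rewrite !sum3E; move=> E bx.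
(* Multiply the differentiated rotation identity by x_i and sum over i: this expresses |x|^2
   h_jk. *)
have Rjk j k : (x 0 * x 0 + x 1 * x 1 + x 2%:R * x 2%:R) * h j k =
    (j == k)%:R * (x 0 * f 0 + x 1 * f 1 + x 2%:R * f 2%:R) +
    x j * (x 0 * h 0 k + x 1 * h 1 k + x 2%:R * h 2%:R k) - x k * f j.
  have e i : x i * (x i * h j k) = x i * ((j == k)%:R * f i + x j * h i k - (i == k)%:R * f j).
    by rewrite -E; ring.
  have d : x 0 * (0 == k)%:R + x 1 * (1 == k)%:R + x 2%:R * (2%:R == k)%:R = x k.
    by elim/ord3_ind: k {e} => /=; rewrite !(mulr0n, mulr1n, mulr0, mulr1, addr0, add0r).
  have := e 0; have := e 1; have := e 2%:R; rewrite -[x k]d.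
  move: ((j == k)%:R) ((0 == k)%:R) ((1 == k)%:R) ((2%:R == k)%:R) => a a0 a1 a2; lra.
rewrite !mulrDr.
have M j k : (x 0 * x 0 + x 1 * x 1 + x 2%:R * x 2%:R) * (b j * b k * h j k) =
    b j * b k * ((j == k)%:R * (x 0 * f 0 + x 1 * f 1 + x 2%:R * f 2%:R) +
    x j * (x 0 * h 0 k + x 1 * h 1 k + x 2%:R * h 2%:R k) - x k * f j).
  by rewrite -Rjk; ring.
rewrite !M !eqxx /= !mulr1n !mulr0n.
pose g k := x 0 * h 0 k + x 1 * h 1 k + x 2%:R * h 2%:R k.
apply/eqP; rewrite -subr_eq0; apply/eqP.
transitivity ((b 0 * x 0 + b 1 * x 1 + b 2%:R * x 2%:R) *
  (b 0 * g 0 + b 1 * g 1 + b 2%:R * g 2%:R - (b 0 * f 0 + b 1 * f 1 + b 2%:R * f 2%:R))).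
  by rewrite /g; ring.
by rewrite bx mul0r.
Qed.

Lemma sph2_tangent x (b : E) : dotp b x = 0 ->
  dotp x x * (\sum_i \sum_j b 0 i * b 0 j * sph2 i j x) = dotp b b * \sum_i x 0 i * sph1 i x.
Proof.
move=> bx; apply: (tangent_algebra (x := fun i => x 0 i) (b := fun i => b 0 i) (f := fun i => sph1 i x)
  (h := fun i j => sph2 i j x)); last exact: bx.
by move=> i j k; exact: sph_rot_deriv.
Qed.

(** With r = |x|, Lap F = F reads F = F'' + 2 F' / r, and F'' >= 0 gives 2 F' / r <= F. The
    auxiliary equality [e] computes r^2 F'' as the Hessian form at x itself. *)
Lemma sph2_tangent_le x (b : E) : dotp b x = 0 -> 0 < dotp x x ->
  2 * (\sum_i \sum_j b 0 i * b 0 j * sph2 i j x) <= dotp b b * sphere_exp x.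
Proof.
move=> bx x0; have t := sph2_tangent bx.
have q := sph2_quad_ge0 x x.
have e : \sum_i \sum_j x 0 i * x 0 j * sph2 i j x = dotp x x * sphere_exp x - 2 * \sum_i x 0 i * sph1 i x.
  transitivity (\sum_i x 0 i * (\sum_j sph2 i j x * x 0 j)).
    by apply: eq_bigr => i _; rewrite mulr_sumr; apply: eq_bigr => j _; ring.
  under eq_bigr => i _ do rewrite sph2_radial.
  rewrite /dotp mulr_suml mulr_sumr -sumrB; apply: eq_bigr => i _; ring.
rewrite e in q; move: t q x0.
have bb : 0 <= dotp b b by rewrite dotpE -!expr2 !addr_ge0 ?sqr_ge0.
move: (\sum_i _) (\sum_i _) (sphere_exp x) (dotp x x) (dotp b b) bb => u v F X B bb t q x0.
rewrite -(ler_pM2l x0) mulrCA t; have := mulr_ge0 bb q; lra.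
Qed.

(** At distance s from the origin F = F(0) sinh s / s, and the equality is cosh s + sinh s = e^s. It
    is derived from the radial equation s f'' = s f - 2 f', which makes (f + s f' + s f) e^-s
    constant. *)
Lemma sphere_exp_ray (v : E) (s : R) : dotp v v = 1 -> 0 <= s ->
  0 <= \sum_i v 0 i * sph1 i (s *: v) /\
  sphere_exp (s *: v) + s * (\sum_i v 0 i * sph1 i (s *: v)) + s * sphere_exp (s *: v) =
    sphere_exp (0 : E) * expR s.
Proof.
move=> v1 s0.
pose f (u : R) := sphere_exp (u *: v); pose p u := \sum_i v 0 i * sph1 i (u *: v).
pose q u := \sum_i \sum_j v 0 i * v 0 j * sph2 i j (u *: v).
have line (g : E -> R) (dg : E -> R) (u : R) : (forall x, deriv_at g x v (dg x)) ->
    deriv_at (fun y : R => g (y *: v)) u 1 (dg (u *: v)).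
  move=> h; have /deriv_at_line h' := h (u *: v).
  have := @deriv_at_shift R (fun y : R => g (y *: v + u *: v)) u (- u) (dg (u *: v)).
  rewrite subrr => /(_ h'); congr deriv_at; apply: funext => y.
  by rewrite -scalerDl subrK.
have fd u : deriv_at f u 1 (p u) := line _ _ u (fun x => sphere_exp_deriv_dir x v).
have pd u : deriv_at p u 1 (q u).
  have h i := deriv_atZ (v 0 i) (line _ _ u (fun x => sph1_deriv_dir i x v)).
  have := deriv_at_sum h; move/deriv_at_eq; apply.
  apply: eq_bigr => i _; rewrite mulr_sumr; apply: eq_bigr => j _; ring.
have q0 u : 0 <= q u by exact: sph2_quad_ge0.
have uq u : u * q u = u * f u - 2 * p u.
  transitivity (\sum_i v 0 i * (\sum_j sph2 i j (u *: v) * (u *: v) 0 j)).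
    rewrite /q mulr_sumr; apply: eq_bigr => i _; rewrite !mulr_sumr; apply: eq_bigr => j _.
    by rewrite mxE; ring.
  under eq_bigr => i _ do rewrite sph2_radial mxE.
  transitivity (u * f u * dotp v v - 2 * p u); last by rewrite v1 mulr1.
  by rewrite /p /f /dotp !mulr_sumr -sumrB; apply: eq_bigr => i _; ring.
have p0 : p 0 = 0 by have := uq 0; move: (p 0) (f 0) (q 0) => a c d; lra.
have ps : 0 <= p s.
  rewrite -p0; apply: (@le_of_deriv_ge0 R p q 0 s s0) => // u _.
  exact: deriv_at_cont (pd u).
split => //; rewrite -/(p s) -/(f s).
pose k u := (f u + u * p u + u * f u) * expR (- u).
have kd u : deriv_at k u 1 0.
  have i1 := deriv_at_id u.
  have e1 : deriv_at (fun u : R => expR (- u)) u 1 (expR (- u) * - 1).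
    exact: (deriv_at_comp (is_derive_expR _ : deriv_at _ _ _ _) (deriv_atN i1)).
  have := deriv_atM (deriv_atD (deriv_atD (fd u) (deriv_atM i1 (pd u))) (deriv_atM i1 (fd u))) e1.
  by move/deriv_at_eq; apply; rewrite uq; ring.
have := @eq_of_deriv0 R k 0 s s0 (fun u _ => deriv_at_cont (kd u)) (fun u _ => kd u).
have -> : k 0 = sphere_exp (0 : E).
  by rewrite /k -[in RHS](scale0r v) -/(f 0) oppr0 expR0; move: (f 0) (p 0) => a c; ring.
by move=> ->; rewrite /k -mulrA -expRD addNr expR0 mulr1.
Qed.

Lemma enorm_ge0 (x : E) : 0 <= enorm x.
Proof. exact: sqrtr_ge0. Qed.

Lemma dotpp_ge0 (x : E) : 0 <= dotp x x.
Proof. by rewrite dotpE -!expr2 !addr_ge0 ?sqr_ge0. Qed.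

Lemma enorm_sqr (x : E) : enorm x ^+ 2 = dotp x x.
Proof. by rewrite sqr_sqrtr// dotpp_ge0. Qed.

(** All three terms on the left of [sphere_exp_ray] are nonnegative. The second bound contains the
    decay 1 / |x| that keeps the integral of F over a ball of radius m at the order m e^m. *)
Lemma sphere_exp_bound (x : E) :
  sphere_exp x <= sphere_exp (0 : E) * expR (enorm x) /\
  enorm x * sphere_exp x <= sphere_exp (0 : E) * expR (enorm x).
Proof.
have [->|x0] := eqVneq x 0.
  have e0 : enorm (0 : E) = 0 by rewrite /enorm dotpE !mxE !mul0r !addr0 sqrtr0.
  by rewrite e0 expR0 mulr1 mul0r; split => //; exact: sphere_exp_ge0.
have n0 : 0 < enorm x.
  rewrite lt_neqAle enorm_ge0 andbT eq_sym; apply: contraNneq x0 => e.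
  have := enorm_sqr x; rewrite e expr0n /= dotpE => /esym h.
  have h3 := sqr_ge0 (x 0 0); have h4 := sqr_ge0 (x 0 1); have h5 := sqr_ge0 (x 0 2%:R).
  rewrite -!expr2 in h.
  have z (i : 'I_3) : x 0 i ^+ 2 = 0 -> x 0 i = 0 by move/eqP; rewrite sqrf_eq0 => /eqP.
  by apply/eqP; apply: rV3P; rewrite mxE; apply: z; lra.
have [] := @sphere_exp_ray ((enorm x)^-1 *: x) (enorm x).
- rewrite dotpZ (_ : dotp _ x = (enorm x)^-1 * dotp x x); last by rewrite !dotpE !mxE; ring.
  by rewrite -enorm_sqr; field; rewrite gt_eqF.
- exact: enorm_ge0.
rewrite scalerA divff ?gt_eqF// scale1r.
set p := \sum_i _; move=> p0 e.
have np := mulr_ge0 (ltW n0) p0; have f0 := sphere_exp_ge0 x.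
have nf := mulr_ge0 (ltW n0) f0.
move: np f0 nf e; move: (enorm x * p) (enorm x * sphere_exp x) (sphere_exp x) => a b c h1 h2 h3 h4.
by rewrite -h4; split; lra.
Qed.

End SphereExpGrowth.

(** * The integral of F over a ball *)

Section Cutoff.
Variable R : realType.
Local Notation E := 'rV[R]_3.

Lemma coord_le_enorm (x : E) i : `|x 0 i| <= enorm x.
Proof.
rewrite -(@ler_pXn2r _ 2) ?nnegrE ?normr_ge0 ?enorm_ge0// enorm_sqr real_normK ?num_real//.
rewrite /dotp (bigD1 i)//= -expr2 lerDl; apply: sumr_ge0 => j _.
by rewrite -expr2; exact: sqr_ge0.
Qed.

Lemma dotp_cont (T : topologicalType) (f g : T -> E) : continuous f -> continuous g ->
  continuous (fun y => dotp (f y) (g y)).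
Proof.
move=> fc gc; rewrite /dotp; apply: sum_cont => i.
by apply: mul_cont; [exact: (comp_cont (@coord_cont R i) fc)|exact: (comp_cont (@coord_cont R i) gc)].
Qed.

Lemma enorm_cont : continuous (@enorm R).
Proof.
apply: (comp_cont (g := @Num.sqrt R)); first exact: sqrt_continuous.
by apply: dotp_cont; exact: id_cont.
Qed.

(* The truncation of m - |x| to [0, 1]. *)
Definition cutoff (m : R) (x : E) : R := (1 + `|m - enorm x| - `|m - enorm x - 1|) / 2.

Lemma cutoff_cont m : continuous (cutoff m).
Proof.
have nc : continuous (fun y : R => `|y|) by move=> y; exact: norm_continuous.
have zc : continuous (fun x : E => m - enorm x) := sub_cont (@cst_cont R E m) enorm_cont.
apply: mul_cont; last exact: cst_cont.
apply: sub_cont; last exact: (comp_cont nc (sub_cont zc (@cst_cont R E 1))).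
exact: (add_cont (@cst_cont R E 1) (comp_cont nc zc)).
Qed.

Lemma cutoff_ge0 m x : 0 <= cutoff m x.
Proof. by rewrite /cutoff; case: (ger0P (m - enorm x)) => ?; case: (ger0P (m - enorm x - 1)) => ?; lra. Qed.

Lemma cutoff_le1 m x : cutoff m x <= 1.
Proof. by rewrite /cutoff; case: (ger0P (m - enorm x)) => ?; case: (ger0P (m - enorm x - 1)) => ?; lra. Qed.

Lemma cutoff_out m x : m <= enorm x -> cutoff m x = 0.
Proof. by rewrite /cutoff; case: (ger0P (m - enorm x)) => ?; case: (ger0P (m - enorm x - 1)) => ?; lra. Qed.

Lemma cutoff_in m x : enorm x + 1 <= m -> cutoff m x = 1.
Proof. by rewrite /cutoff; case: (ger0P (m - enorm x)) => ?; case: (ger0P (m - enorm x - 1)) => ?; lra. Qed.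

Lemma dotp_set_coord i s (x : E) :
  dotp (set_coord i s x) (set_coord i s x) = s ^+ 2 + (dotp x x - x 0 i ^+ 2).
Proof.
have e (y : E) : dotp y y = y 0 i ^+ 2 + \sum_(j | j != i) y 0 j ^+ 2.
  rewrite /dotp (bigD1 i) // expr2; congr (_ + _); apply: eq_bigr => j _; rewrite expr2.
rewrite !e set_coordE eqxx; set S := \sum_(j | _) _; set S' := \sum_(j | _) _.
have -> : S = S' by apply: eq_bigr => j /negPf ji; rewrite set_coordE ji.
by move: (x 0 i) S' => a b; ring.
Qed.

Lemma sub_le_of_norm (a c k : R) : `|a| <= k -> `|c| <= k -> a - c <= 2 * k.
Proof. by rewrite !ler_norml; lra. Qed.

(* Since F = sum_i F_ii with F_ii >= 0, each line integral telescopes to boundary values of F_i on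
   the sphere of radius m, which are at most F(0) e^m / m. *)
Lemma ball_int_sphere_exp (m : R) : 0 < m ->
  box_int m (fun x => sphere_exp x * cutoff m x) <= 24 * sphere_exp (0 : E) * (m * expR m).
Proof.
(* K bounds two end values of F_i. Three directions and the cross-section (2 m)^2 then give 3 * 2 *
   4 = 24. *)
move=> m0; have m0' := ltW m0.
pose K := 2 * (sphere_exp (0 : E) * expR m / m).
have F0 : 0 <= sphere_exp (0 : E) by exact: sphere_exp_ge0.
have K0 : 0 <= K by rewrite /K !mulr_ge0 ?invr_ge0 ?expR_ge0.
have gc i : continuous (fun x => sph2 i i x * cutoff m x).
  by apply: mul_cont; [exact: sph2_cont|exact: cutoff_cont].
have -> : box_int m (fun x => sphere_exp x * cutoff m x) = \sum_i box_int m (fun x => sph2 i i x * cutoff m x).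
  rewrite -(box_int_sum m0' gc); apply: eq_box_int => x _.
  by rewrite sphere_exp_lap mulr_suml.
have line i : box_int m (fun x => sph2 i i x * cutoff m x) <= K * (2 * m) ^+ 2.
  apply: (box_int_line_le m0' (i := i) (gc i)) => x.
  set g := fun s => _.
  have gcs : continuous g := comp_cont (gc i) (@set_coord_cont R i x).
  (* The squared distance of the line from the origin. The line meets the ball of radius m in the
     chord |s| <= l with l^2 = m^2 - d, and misses its interior when m^2 <= d. *)
  pose d := dotp x x - x 0 i ^+ 2.
  have d0 : 0 <= d.
    have := dotp_set_coord i 0 x; rewrite expr0n /= add0r -/d => <-.
    exact: dotpp_ge0.
  have en s : enorm (set_coord i s x) ^+ 2 = s ^+ 2 + d by rewrite enorm_sqr dotp_set_coord.
  have out s : m ^+ 2 <= s ^+ 2 + d -> g s = 0.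
    rewrite -en ler_pXn2r ?nnegrE ?enorm_ge0// => h.
    by rewrite /g cutoff_out ?mulr0.
  have [dm|dm] := leP (m ^+ 2) d.
    rewrite (@eq_seg_int _ _ _ _ (fun=> 0)); first by rewrite seg_int_cst ?mul0r//; lra.
    by move=> s _; apply: out; have := sqr_ge0 s; lra.
  pose l := Num.sqrt (m ^+ 2 - d).
  have l0 : 0 <= l by exact: sqrtr_ge0.
  have l2 : l ^+ 2 = m ^+ 2 - d by rewrite sqr_sqrtr// subr_ge0 ltW.
  have lm : l <= m by rewrite -(@ler_pXn2r _ 2) ?nnegrE// l2; lra.
  have outl s : l <= `|s| -> g s = 0.
    move=> h; apply: out; suff : l ^+ 2 <= s ^+ 2 by lra.
    by rewrite -[s ^+ 2]real_normK ?num_real// ler_pXn2r ?nnegrE.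
  rewrite (@seg_int_shrink _ _ _ (- l) l)//; last first.
  - by move=> s hs; apply: outl; rewrite ler_normr hs.
  - by move=> s hs; apply: outl; rewrite ler_normr orbC lerNr hs.
  - lra.
  - lra.
  have sc : continuous (fun s => sph2 i i (set_coord i s x)) := comp_cont (@sph2_cont R i i) (@set_coord_cont R i x).
  apply: (@le_trans _ _ (seg_int (- l) l (fun s => sph2 i i (set_coord i s x)))).
    apply: seg_int_le; [lra|exact: gcs|exact: sc|].
    move=> s _; rewrite /g -[leRHS]mulr1 ler_wpM2l ?sph2_diag_ge0 ?cutoff_le1//.
  rewrite (@seg_int_FTC _ _ (fun s => sph1 i (set_coord i s x)))//; [|lra|]; last first.
    by move=> s _; apply: deriv_at_set_coord; exact: sph1_deriv.
  have b s : `|s| = l -> `|sph1 i (set_coord i s x)| <= sphere_exp (0 : E) * expR m / m.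
    move=> sl; have e : enorm (set_coord i s x) = m.
      apply/eqP; rewrite -(@eqrXn2 _ 2) ?enorm_ge0// en -[s ^+ 2]real_normK ?num_real// sl l2.
      by apply/eqP; ring.
    apply: (le_trans (sph1_le i _)); have [_] := sphere_exp_bound (set_coord i s x); rewrite e.
    move: (sphere_exp (set_coord i s x)) (sphere_exp (0 : E) * expR m) => c b h.
    by rewrite (ler_pdivlMr _ _ m0) mulrC.
  have b2 := b (- l); rewrite normrN in b2.
  exact: (sub_le_of_norm (b l (ger0_norm l0)) (b2 (ger0_norm l0))).
apply: (@le_trans _ _ (\sum_(i < 3) K * (2 * m) ^+ 2)); first by apply: ler_sum => i _; exact: line.
rewrite big_const_ord iter_addr_0 /K -mulr_natr le_eqVlt; apply/orP; left; apply/eqP; field.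
by rewrite gt_eqF.
Qed.

End Cutoff.

(** * Convexity of the pressure *)

Section Pressure.
Variable R : realType.
Implicit Types (g l k y r : R).

Lemma deriv_at_expR_lin k y : deriv_at (fun y : R => expR (k * y)) y 1 (expR (k * y) * k).
Proof.
have h := deriv_atZ k (deriv_at_id y); rewrite mulr1 in h.
exact: (deriv_at_comp (is_derive_expR _ : deriv_at _ _ _ _) h).
Qed.

Lemma deriv_at_exp y : deriv_at (fun y : R => expR y) y 1 (expR y).
Proof. exact: is_derive_expR. Qed.

(** Bernoulli's inequality r^g >= 1 + g (r - 1) with r = e^y. *)
Lemma exp_convex_gap g y : 1 < g -> 0 <= expR (g * y) - g * expR y + (g - 1).
Proof.
move=> g1; pose f y := expR (g * y) - g * expR y + (g - 1).
pose f' y := expR (g * y) * g - g * expR y.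
have fd z : deriv_at f z 1 (f' z).
  have := deriv_atD (deriv_atB (deriv_at_expR_lin g z) (deriv_atZ g (deriv_at_exp z))) (deriv_at_cst (g - 1) z 1).
  by move/deriv_at_eq; apply; rewrite addr0.
have f0 : f 0 = 0 by rewrite /f mulr0 expR0; ring.
have e z : f' z = g * (expR (g * z) - expR z) by rewrite /f'; ring.
rewrite -/(f y) -f0; have [y0|y0] := leP 0 y.
  apply: (@le_of_deriv_ge0 R f f' 0 y y0) => z hz; [exact: deriv_at_cont (fd z)|exact: fd|].
  by rewrite e mulr_ge0//; [lra|rewrite subr_ge0 ler_expR; nra].
rewrite -lerN2; apply: (@le_of_deriv_ge0 R (fun z => - f z) (fun z => - f' z) y 0 (ltW y0)) => z hz.
- by apply: continuousN; exact: deriv_at_cont (fd z).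
- by apply: deriv_atN; exact: fd.
- rewrite e -mulrN opprB mulr_ge0//; [lra|rewrite subr_ge0 ler_expR; nra].
Qed.

(* Tangent line of the convex function r^g / g at (1 + l)^(1 / (g - 1)). *)
Lemma pressure_minorant g l r : 1 < g -> 0 <= l <= 1 -> 0 < r ->
  l * (r - 1) - (g - 1)^-1 * expR (g - 1)^-1 * l ^+ 2 <= (r `^ g - 1) / g - (r - 1).
Proof.
move=> g1 /andP[l0 l1] r0; pose b := (g - 1)^-1.
have b0 : 0 < b by rewrite invr_gt0; lra.
have gb : (g - 1) * b = 1 by rewrite /b divff// gt_eqF//; lra.
pose c := b * ln (1 + l); pose r1 := expR c.
have l1' : 0 < 1 + l by lra.
have ec : expR ((g - 1) * c) = 1 + l by rewrite /c mulrA gb mul1r lnK.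
have egc : expR (g * c) = r1 * (1 + l) by rewrite -ec /r1 -expRD; congr expR; ring.
(* At r / r1 Bernoulli's inequality is the tangent-line bound; at r1 it controls the value of that
   line at r = 1, up to the loss l (r1 - 1). *)
have h1 := exp_convex_gap (ln r - c) g1; have h2 := exp_convex_gap c g1.
(* The tangent point is within O(l) of 1, from c <= b l and e^c - 1 <= c e^c; this makes the loss
   quadratic in l. *)
have r1b : r1 - 1 <= b * expR b * l.
  have cb : c <= b * l by rewrite /c ler_pM2l//; apply: le_ln1Dx; lra.
  have cb' : c <= b by apply: (le_trans cb); rewrite -[leRHS]mulr1 ler_pM2l.
  have c0 : 0 <= c by rewrite /c mulr_ge0 ?ln_ge0 ?(ltW b0)//; lra.
  have := expR_ge1Dx (- c); rewrite expRN => h.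
  have r10 : 0 < r1 := expR_gt0 c.
  have : r1 - 1 <= c * r1.
    have : (1 - c) * r1 <= 1 by rewrite -ler_pdivlMr// div1r.
    lra.
  move=> h'; apply: (le_trans h').
  rewrite -mulrA [X in _ <= _ * X]mulrC mulrA; apply: ler_pM => //; first exact: ltW.
  by rewrite ler_expR.
have rg : r `^ g = expR (g * ln r) by rewrite /powR gt_eqF.
have er : expR (ln r - c) = r / r1 by rewrite expRD expRN lnK.
have eg : expR (g * (ln r - c)) = r `^ g / (r1 * (1 + l)) by rewrite mulrBr expRD expRN egc rg.
have r10 : 0 < r1 := expR_gt0 c.
rewrite eg er in h1; rewrite egc -/r1 in h2.
have h3 : 0 <= r `^ g - g * r * (1 + l) + (g - 1) * (r1 * (1 + l)).
  have := mulr_ge0 h1 (ltW (mulr_gt0 r10 l1')); apply: etrans; congr (0 <= _); field.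
  by rewrite !gt_eqF.
have g0 : 0 < g by lra.
have eg' : g * ((r `^ g - 1) / g - (r - 1)) = r `^ g - 1 - g * (r - 1) by field; rewrite gt_eqF.
rewrite -/b -(ler_pM2l g0) eg'.
have h4 : l * (r1 - 1) <= b * expR b * l ^+ 2 by rewrite expr2 mulrA [leLHS]mulrC ler_wpM2r.
move: (r `^ g) (b * expR b * l ^+ 2) h3 h4 h2 => p B h3 h4 h2.
have h5 : g * (l * (r1 - 1)) <= g * B by rewrite ler_pM2l.
nra.
Qed.

(* With y = L: p minus its rest value 1 / g, and the internal energy relative to the rest state. *)
Definition rel_energy g y := (expR (g * y) - g * expR y + (g - 1)) / (g * (g - 1)).
Definition rel_pressure g y := (expR (g * y) - 1) / g.

Lemma rel_energy_ge0 g y : 1 < g -> 0 <= rel_energy g y.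
Proof.
move=> g1; apply: divr_ge0; first exact: exp_convex_gap.
by rewrite mulr_ge0//; lra.
Qed.

Lemma rel_pressure_eq0 g y : 1 < g -> rel_pressure g y = 0 -> y = 0.
Proof.
move=> g1; have g0 : 0 < g by lra.
move=> /eqP; rewrite mulf_eq0 invr_eq0 (gt_eqF g0) orbF.
rewrite subr_eq0 -[X in _ == X]expR0 => /eqP/expR_inj/eqP.
by rewrite mulf_eq0 (gt_eqF g0) /= => /eqP.
Qed.

(* Both sides are y^2 to second order at 0. *)
Lemma rel_pressure_sqr_le g k : 1 < g -> 0 < k ->
  exists2 e : R, 0 < e & forall y, `|y| <= e ->
    rel_pressure g y ^+ 2 <= (1 + k) * (2 * rel_energy g y).
Proof.
move=> g1 k0; have g0 : 0 < g by lra.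
(* [G] and its derivative [G1] vanish at 0 and [G2 0 = 2 * k > 0], so [G] is convex near 0 with
   minimum 0 there. *)
pose G y := (1 + k) * (2 * rel_energy g y) - rel_pressure g y ^+ 2.
pose a := (1 + k) * (2 / (g * (g - 1))); pose c := (g^-1) ^+ 2.
pose G1 y := a * (expR (g * y) * g - g * expR y) - c * (2 * (expR (g * y) - 1) * (expR (g * y) * g)).
pose G2 y := a * (expR (g * y) * g * g - g * expR y) -
  c * (2 * (expR (g * y) * g * (expR (g * y) * g) + (expR (g * y) - 1) * (expR (g * y) * g * g))).
have GE y : G y = a * (expR (g * y) - g * expR y + (g - 1)) - c * (expR (g * y) - 1) * (expR (g * y) - 1).
  by rewrite /G /a /c /rel_energy /rel_pressure; field; rewrite !gt_eqF//; lra.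
have E1 y := deriv_at_expR_lin g y.
have Gd y : deriv_at G y 1 (G1 y).
  have -> : G = (fun y => a * (expR (g * y) - g * expR y + (g - 1)) - c * (expR (g * y) - 1) * (expR (g * y) - 1)).
    exact: funext.
  have hm := deriv_atB (E1 y) (deriv_at_cst 1 y 1).
  have := deriv_atB (deriv_atZ a (deriv_atD (deriv_atB (E1 y) (deriv_atZ g (deriv_at_exp y))) (deriv_at_cst (g - 1) y 1)))
    (deriv_atM (deriv_atZ c hm) hm).
  by move/deriv_at_eq; apply; rewrite /G1; ring.
have Gd1 y : deriv_at G1 y 1 (G2 y).
  have hm := deriv_atB (E1 y) (deriv_at_cst 1 y 1).
  have he : deriv_at (fun y => expR (g * y) * g) y 1 (expR (g * y) * g * g).
    have := deriv_atM (E1 y) (deriv_at_cst g y 1).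
    by move/deriv_at_eq; apply; rewrite mulr0 addr0.
  have := deriv_atB (deriv_atZ a (deriv_atB he (deriv_atZ g (deriv_at_exp y))))
    (deriv_atZ c (deriv_atM (deriv_atZ 2 hm) he)).
  by move/deriv_at_eq; apply; rewrite /G2; ring.
have G2c : continuous G2.
  have e1 : continuous (fun y : R => expR (g * y)) by move=> y; exact: deriv_at_cont (E1 y).
  have e2 : continuous (fun y : R => expR y) := @continuous_expR R.
  have cc (z : R) : continuous (fun _ : R => z) := @cst_cont R R z.
  have e3 := mul_cont e1 (cc g); have e4 := mul_cont e3 (cc g).
  apply: sub_cont; apply: mul_cont; [exact: cc| |exact: cc|].
    by apply: sub_cont; [exact: e4|apply: mul_cont; [exact: cc|exact: e2]].
  apply: mul_cont; [exact: cc|apply: add_cont; apply: mul_cont; [exact: e3|exact: e3| |exact: e4]].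
  by apply: sub_cont; [exact: e1|exact: cc].
have G20 : 0 < G2 0.
  rewrite /G2 mulr0 expR0 [X in 0 < X](_ : _ = 2 * k); first by rewrite mulr_gt0.
  by rewrite /a /c; field; rewrite !gt_eqF//; lra.
have G00 : G 0 = 0 by rewrite GE mulr0 expR0; ring.
have G10 : G1 0 = 0 by rewrite /G1 mulr0 expR0; ring.
have /cvgrPdist_lt/(_ _ G20)/nbhs_ballP[e /= e0 he] := G2c 0.
have P2 y : `|y| < e -> 0 <= G2 y.
  move=> ye; have := he y; rewrite /ball /= sub0r normrN => /(_ ye).
  by rewrite ltr_norml => /andP[]; lra.
exists (e / 2); first by rewrite divr_gt0.
move=> y ye; rewrite -subr_ge0 -/(G y) -G00.
have lt z : `|z| <= e / 2 -> 0 <= G2 z by move=> h; apply: P2; lra.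
rewrite ler_norml in ye; have [y0|y0] := leP 0 y.
  have G1p z : 0 <= z <= y -> 0 <= G1 z.
    move=> /andP[z0 zy]; rewrite -G10; apply: (@le_of_deriv_ge0 R G1 G2 0 z z0) => w hw.
    - exact: deriv_at_cont (Gd1 w).
    - exact: Gd1.
    - by apply: lt; rewrite ler_norml; apply/andP; split; lra.
  apply: (@le_of_deriv_ge0 R G G1 0 y y0) => w hw.
  - exact: deriv_at_cont (Gd w).
  - exact: Gd.
  - by apply: G1p; lra.
have G1n z : y <= z <= 0 -> G1 z <= 0.
  move=> /andP[yz z0]; rewrite -G10; apply: (@le_of_deriv_ge0 R G1 G2 z 0 z0) => w hw.
  - exact: deriv_at_cont (Gd1 w).
  - exact: Gd1.
  - by apply: lt; rewrite ler_norml; apply/andP; split; lra.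
rewrite -lerN2; apply: (@le_of_deriv_ge0 R (fun z => - G z) (fun z => - G1 z) y 0 (ltW y0)) => w hw.
- by apply: continuousN; exact: deriv_at_cont (Gd w).
- by apply: deriv_atN; exact: Gd.
- by rewrite oppr_ge0; apply: G1n; lra.
Qed.

End Pressure.

(** * Blowup of differential inequalities *)

Section DiscreteBlowup.
Variable R : realType.

(* As long as k y n <= (n + 8) / 8, the quantity 1 / y n + (8 k / 9) ln (n + 8) does not increase, so
   n is at most exponentially large in 1 / y 0; once the bound fails, y grows like (9/8)^n. *)
Lemma discrete_blowup (k c0 C : R) : 0 < k -> 0 < c0 -> 0 < C ->
  exists K : R, 0 < K /\ forall (eps : R) (N : nat) (y : nat -> R),
    0 < eps <= 1 -> c0 * eps <= y 0%N ->
    (forall n, (n < N)%N -> y n * (1 + Num.min (1 / 8) (k * y n / (n%:R + 8))) <= y n.+1) ->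
    (forall n, (n <= N)%N -> y n <= C * (n%:R + 8) ^+ 3) ->
    N%:R <= expR (K / eps).
Proof.
move=> k0 c00 C0.
(* The threshold past which a fourth power beats the cubic upper bound at the end of the proof. *)
have [m0 m03 m0z] : exists2 m : nat, (3 <= m)%N & 216 * 8 ^+ 4 * C * (8 * k) < m%:R.
  exists (Num.truncn (216 * 8 ^+ 4 * C * (8 * k))).+3 => //.
  have z0 : 0 <= 216 * 8 ^+ 4 * C * (8 * k) by rewrite !mulr_ge0// ltW.
  have /andP[_ h] := truncn_itv z0; apply: (lt_le_trans h).
  by rewrite ler_nat; exact: (leq_trans (leqnSn _) (leqnSn _)).
pose K1 := 9 / (8 * k * c0).
have K10 : 0 < K1 by rewrite /K1 divr_gt0// !mulr_gt0.
pose B : R := 40 + 4 * m0%:R.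
have B1 : 1 <= B by have : (0 : R) <= m0%:R by []; rewrite /B; lra.
exists (K1 + ln B); split; first by rewrite ltr_wpDr// ln_ge0.
move=> eps N y /andP[e0 e1] y0 step up.
have ypos n : (n <= N)%N -> 0 < y n /\ c0 * eps <= y n.
  elim: n => [_|n IH nN]; first by split => //; apply: lt_le_trans y0; rewrite mulr_gt0.
  have [yn cn] := IH (ltnW nN).
  have h : y n <= y n.+1.
    apply: le_trans (step n nN); rewrite -[leLHS]mulr1 ler_pM2l// lerDl le_min.
    by rewrite divr_ge0//= divr_ge0 ?addr_ge0// mulr_ge0// ltW.
  by split; [exact: lt_le_trans h|exact: le_trans h].
pose bd n := (y n)^-1 + 8 * k / 9 * ln (n%:R + 8) <= (y 0%N)^-1 + 8 * k / 9 * ln 8.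
have p8 (n : nat) : (0 : R) < n%:R + 8 by rewrite ltr_wpDl.
have bdN n : (n <= N)%N -> bd n -> n%:R + 8 <= 8 * expR (K1 / eps).
  move=> nN; rewrite /bd => h.
  have [y0p _] := ypos 0%N (leq0n _); have [ynp _] := ypos n nN.
  have h1 : 8 * k / 9 * (ln (n%:R + 8) - ln 8) <= (c0 * eps)^-1.
    have : (y 0%N)^-1 <= (c0 * eps)^-1 by rewrite lef_pV2 ?posrE ?mulr_gt0.
    have : 0 < (y n)^-1 by rewrite invr_gt0.
    by rewrite mulrBr; lra.
  have h2 : ln (n%:R + 8) - ln 8 <= K1 / eps.
    have k8 : 0 < 8 * k / 9 by rewrite divr_gt0// mulr_gt0.
    rewrite -(ler_pM2l k8); apply: (le_trans h1); rewrite /K1 le_eqVlt; apply/orP; left; apply/eqP.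
    by field; rewrite !gt_eqF.
  have h3 : ln (n%:R + 8) <= ln 8 + K1 / eps by lra.
  by move: h3; rewrite -ler_expR expRD !lnK ?posrE.
have claim n : (n <= N)%N ->
    (exists n1, [/\ (n1 <= n)%N, bd n1 & 1 / 8 < k * y n1 / (n1%:R + 8)]) \/ bd n.
  elim: n => [_|n IH nN]; first by right; rewrite /bd add0r.
  have [[n1 [h1 h2 h3]]|b] := IH (ltnW nN); first by left; exists n1; split => //; exact: leqW.
  have [big|small] := ltP (1 / 8) (k * y n / (n%:R + 8)); first by left; exists n.
  right; have := step n nN; rewrite (min_idPr small) => st.
  have [ynp _] := ypos n (ltnW nN); have [ysp _] := ypos n.+1 nN.
  set q := k * y n / (n%:R + 8) in small st.
  have q0 : 0 <= q by rewrite /q divr_ge0 ?mulr_ge0 ?ltW.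
  (* From 1 / (1 + q) <= 1 - 8 q / 9 for 0 <= q <= 1 / 8, the origin of the factor 8 / 9. *)
  have inv : (y n.+1)^-1 <= (y n)^-1 - 8 * k / 9 / (n%:R + 8).
    apply: (@le_trans _ _ ((y n * (1 + q))^-1)).
      by rewrite lef_pV2 ?posrE// mulr_gt0//; lra.
    have -> : (y n)^-1 - 8 * k / 9 / (n%:R + 8) = (y n)^-1 * (1 - 8 / 9 * q).
      by rewrite /q; field; rewrite !gt_eqF.
    rewrite invfM ler_pM2l ?invr_gt0// -div1r ler_pdivrMr; last by lra.
    nra.
  have lg : ln (n.+1%:R + 8 : R) <= ln (n%:R + 8) + (n%:R + 8)^-1.
    have -> : n.+1%:R + 8 = (n%:R + 8) * (1 + (n%:R + 8)^-1) :> R.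
      by rewrite -natr1; field; rewrite gt_eqF.
    have i0 : 0 < (n%:R + 8)^-1 :> R by rewrite invr_gt0.
    have pv : 0 < 1 + (n%:R + 8)^-1 :> R by exact: addr_gt0.
    rewrite lnM ?posrE//.
    by rewrite lerD2l; apply: le_ln1Dx; apply: lt_trans i0; rewrite ltrN10.
  have k8 : 0 <= 8 * k / 9 by rewrite divr_ge0// mulr_ge0// ltW.
  have := ler_wpM2l k8 lg; rewrite /bd in b *; rewrite mulrDr.
  by move: inv b; move: (ln _) (ln (n%:R + 8)) (ln 8) => l1 l2 l3; lra.
(* The fast regime perpetuates itself: (9 / 8) (n + 8) >= n + 9, which is why n is shifted by 8. *)
have big n1 j : (n1 + j <= N)%N -> 1 / 8 < k * y n1 / (n1%:R + 8) ->
    1 / 8 < k * y (n1 + j)%N / ((n1 + j)%:R + 8) /\ (9 / 8) ^+ j * (k ^-1) <= y (n1 + j)%N.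
  move=> + h; elim: j => [|j IH] jN.
    rewrite addn0; split => //; rewrite expr0 mul1r.
    rewrite ltr_pdivlMr// in h; rewrite -div1r ler_pdivrMr//.
    have : (0 : R) <= n1%:R by []; rewrite mulrC; lra.
  rewrite addnS in jN *; have [i1 i2] := IH (ltnW jN); have st := step _ jN.
  rewrite (min_idPl (ltW i1)) in st.
  have [yp _] := ypos _ (ltnW jN).
  split.
    rewrite ltr_pdivlMr// in i1; rewrite ltr_pdivlMr//.
    have h2 : k * (y (n1 + j)%N * (1 + 1 / 8)) <= k * y (n1 + j).+1 by rewrite ler_pM2l.
    rewrite -[(n1 + j).+1%:R]natr1; have : (0 : R) <= (n1 + j)%:R by [].
    by move: h2 i1; move: ((n1 + j)%:R) (y (n1 + j).+1) => u v; lra.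
  apply: le_trans st; rewrite exprS -mulrA mulrC.
  have -> : 1 + 1 / 8 = 9 / 8 :> R by lra.
  by rewrite ler_pM2r.
have fin : N%:R <= B * expR (K1 / eps).
  have X1 : 1 <= expR (K1 / eps) by rewrite -expR0 ler_expR divr_ge0// ltW.
  have m00 : (0 : R) <= m0%:R by [].
  have [[n1 [n1N b1 h1]]|b] := claim N (leqnn N); last first.
    have := bdN N (leqnn N) b; rewrite /B; nra.
  have b2 := bdN n1 n1N b1.
  have [NN|] := leqP N (5 * n1 + 4 * m0).
    have : N%:R <= (5 * n1 + 4 * m0)%:R :> R by rewrite ler_nat.
    rewrite natrD !natrM /B; nra.
  move=> NN; exfalso.
  (* After 4 w further steps, w = n1 + m0, Bernoulli gives (9 / 8)^(4 w) >= (w / 8)^4, against the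
     upper bound C (8 w)^3; the choice of [m0] makes them incompatible. *)
  have jN : (n1 + 4 * (n1 + m0) <= N)%N by rewrite mulnDr addnA -mulSn; exact: ltnW.
  have [_ g2] := big n1 (4 * (n1 + m0))%N jN h1.
  have u := up _ jN; have := le_trans g2 u.
  pose w : R := (n1 + m0)%:R.
  have w0 : 0 < w by rewrite /w ltr0n; apply: leq_trans (leq_addl _ _); exact: leq_trans m03.
  have e3 : (n1 + 4 * (n1 + m0))%:R + 8 <= 6 * w + 3 :> R.
    have m3 : 3 <= m0%:R :> R by rewrite ler_nat.
    have n10 : (0 : R) <= n1%:R by [].
    by rewrite /w natrD natrM natrD; move: m3 n10; move: (m0%:R) (n1%:R) => z1 z2; lra.
  have w2 : 2 <= w by rewrite /w ler_nat; apply: (@leq_trans m0); [exact: leq_trans m03|exact: leq_addl].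
  have bern (a : nat) : 1 + a%:R / 8 <= (9 / 8 : R) ^+ a.
    elim: a => [|a IH]; first by rewrite expr0 mul0r addr0.
    have a0 : (0 : R) <= a%:R by [].
    rewrite exprS -natr1; move: IH a0; move: (_ ^+ a) (a%:R) => p q; lra.
  have l1 : (w / 8) ^+ 4 * k^-1 <= (9 / 8) ^+ (4 * (n1 + m0)) * k^-1.
    rewrite ler_pM2r ?invr_gt0// mulnC exprM lerXn2r ?nnegrE ?divr_ge0 ?exprn_ge0 ?(ltW w0)//.
    by have := bern (n1 + m0)%N; rewrite -/w; lra.
  have l2 : C * ((n1 + 4 * (n1 + m0))%:R + 8) ^+ 3 <= C * (8 * w) ^+ 3.
    rewrite ler_pM2l// lerXn2r ?nnegrE ?addr_ge0 ?mulr_ge0 ?(ltW w0)//; lra.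
  move=> h; have := le_trans l1 (le_trans h l2).
  rewrite ler_pdivrMr// => h4.
  have h5 : w <= 512 * 8 ^+ 4 * C * k.
    have w3 : 0 < w ^+ 3 / 8 ^+ 4 by rewrite divr_gt0 ?exprn_gt0.
    rewrite -(ler_pM2l w3); move: h4; by congr (_ <= _); field.
  have h6 : m0%:R <= w by rewrite /w ler_nat leq_addl.
  have Ck : 0 < C * k by rewrite mulr_gt0.
  have h9 := m0z; rewrite (_ : 216 * 8 ^+ 4 * C * (8 * k) = 1728 * 4096 * (C * k)) in h9; last by ring.
  rewrite (_ : 512 * 8 ^+ 4 * C * k = 512 * 4096 * (C * k)) in h5; last by ring.
  move: h5 h6 h9 Ck; clear; move: (m0%:R) (C * k) => z1 z2; lra.
apply: (le_trans fin); rewrite [X in _ <= expR X]mulrDl expRD [leRHS]mulrC ler_pM2r ?expR_gt0//.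
have Bp : 0 < B by lra.
rewrite -{1}(lnK (_ : B \in Num.pos)) ?posrE// ler_expR ler_pdivlMr//.
by rewrite ler_piMr// ln_ge0.
Qed.

End DiscreteBlowup.

Section Growth.
Variables (R : realType) (C1 tau c1 : R) (X Y dY : R -> R).
Hypotheses (C10 : 0 < C1) (c10 : 0 <= c1).
Hypothesis Xc : forall t, 0 <= t <= tau -> {for t, continuous X}.
Hypothesis Yc : forall t, 0 <= t <= tau -> {for t, continuous Y}.
Hypothesis Xd : forall t, 0 < t < tau -> deriv_at X t 1 (Y t - 2 * X t).
Hypothesis Yd : forall t, 0 < t < tau -> deriv_at Y t 1 (dY t).
Hypothesis hY : forall t l, 0 < t < tau -> 0 <= l <= 1 -> l * X t - C1 * l ^+ 2 * (2 + t) <= dY t.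
Hypothesis Y0 : c1 <= Y 0.

(** The choice l = 0 in [hY] gives [0 <= dY]. *)
Lemma growth_mono s t : 0 <= s -> s <= t -> t <= tau -> Y s <= Y t.
Proof.
move=> s0 st ts; apply: (@le_of_deriv_ge0 R Y dY s t st) => u hu.
- by apply: Yc; lra.
- by apply: Yd; lra.
- have h01 : 0 <= (0 : R) <= 1 by rewrite lexx ler01.
  have hu' : 0 < u < tau by lra.
  by have := hY hu' h01; rewrite expr0n /= mulr0 !mul0r subrr.
Qed.

Lemma growth_ge0 s : 0 <= s -> s <= tau -> 0 <= Y s.
Proof. by move=> s0 st; apply: (le_trans c10); apply: (le_trans Y0); exact: growth_mono. Qed.

(** X relaxes at rate 2 towards Y / 2, and Y does not fall below [Y s]: the derivative of e^(2 u) (X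
    - Y s / 2) is e^(2 u) (Y u - Y s). *)
Lemma growth_low s t : 0 <= s -> s <= t -> t <= tau ->
  expR (2 * s) * (X s - Y s / 2) <= expR (2 * t) * (X t - Y s / 2).
Proof.
move=> s0 st ts.
apply: (@le_of_deriv_ge0 R (fun u => expR (2 * u) * (X u - Y s / 2))
  (fun u => expR (2 * u) * (Y u - Y s)) s t st) => u hu.
- apply: (@continuousM _ _ (fun u : R => expR (2 * u))); first exact: deriv_at_cont (deriv_at_expR_lin 2 u).
  by apply: (@continuousB _ R^o R X (fun=> Y s / 2)); [apply: Xc; lra|exact: cst_continuous].
- have hu' : 0 < u < tau by lra.
  have := deriv_atM (deriv_at_expR_lin 2 u) (deriv_atB (Xd hu') (deriv_at_cst (Y s / 2) u 1)).
  by move/deriv_at_eq; apply; field.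
- by rewrite mulr_ge0 ?expR_ge0// subr_ge0; apply: growth_mono; lra.
Qed.

Lemma exp2_ge (u : R) : 1 + 2 * u <= expR (2 * u). Proof. exact: expR_ge1Dx. Qed.

(** X may start negative; the drift Y >= c1 makes it nonnegative once t c1 reaches - X 0. *)
Lemma growth_pos t : 0 <= t <= tau -> - X 0 <= t * c1 -> 0 <= X t.
Proof.
move=> /andP[t0 tt] ht; have := growth_low (lexx 0) t0 tt; rewrite mulr0 expR0 mul1r => h.
rewrite -(pmulr_rge0 _ (expR_gt0 (2 * t))).
have Y00 : 0 <= Y 0 := le_trans c10 Y0.
have h3 := ler_wpM2r Y00 (exp2_ge t); have h1 := ler_wpM2l t0 Y0.
have {}h : X 0 - Y 0 / 2 <= expR (2 * t) * X t - expR (2 * t) * Y 0 / 2.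
  by apply: (le_trans h); rewrite le_eqVlt; apply/orP; left; apply/eqP; ring.
move: h h1 h3 ht; rewrite mulrDl mul1r -mulrA.
move: (expR (2 * t) * X t) (expR (2 * t) * Y 0) (t * Y 0) (t * c1) (X 0) (Y 0) => e1 e2 e3 e4 e5 e6; lra.
Qed.

Variable t0 : R.
Hypotheses (t00 : 0 <= t0) (ht0 : - X 0 <= t0 * c1).

(** One unit of time suffices for relaxation: e^2 >= 2, so at least half of Y s / 2 has been
    attained. *)
Lemma growth_ge s t : t0 <= s -> s + 1 <= t -> t <= tau -> Y s / 4 <= X t.
Proof.
move=> hs st tt; have s0 : 0 <= s := le_trans t00 hs.
have st' : s <= t by lra.
have h := growth_low s0 st' tt.
have xs : 0 <= X s.
  by apply: growth_pos; [lra|apply: (le_trans ht0); rewrite ler_wpM2r].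
have Ys : 0 <= Y s by apply: growth_ge0; lra.
have e1 : expR (2 * t) = expR (2 * s) * expR (2 * (t - s)) by rewrite -expRD; congr expR; ring.
have e3 : 2 <= expR (2 * (t - s)) by have := exp2_ge (t - s); lra.
rewrite e1 -mulrA ler_pM2l ?expR_gt0// in h.
have w0 : 0 < expR (2 * (t - s)) by lra.
rewrite -(ler_pM2l w0); move: h e3 xs Ys; rewrite mulrBr; move: (expR _) (X s) (X t) (Y s) => w x x' y.
nra.
Qed.

(* Optimal choice l = min (1, Y s / (8 C1 (s + 4))) in the differential inequality for Y. *)
Lemma growth_step s : t0 <= s -> s + 2 <= tau ->
  Y s * (1 + Num.min (1 / 8) (Y s / (64 * C1 * (s + 4)))) <= Y (s + 2).
Proof.
move=> hs st; have s0 : 0 <= s := le_trans t00 hs.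
have Ys : 0 <= Y s by apply: growth_ge0; lra.
have s4 : 0 < s + 4 by lra.
have Cs : 0 < 64 * C1 * (s + 4) by rewrite !mulr_gt0.
set mm := Num.min _ _.
have m1 : mm <= 1 / 8 by rewrite ge_min lexx.
have m2 : mm <= Y s / (64 * C1 * (s + 4)) by rewrite ge_min lexx orbT.
have m0 : 0 <= mm by rewrite le_min divr_ge0//= divr_ge0// ltW.
have m3 : mm * (64 * C1 * (s + 4)) <= Y s by rewrite -ler_pdivlMr.
clearbody mm.
have hm : 0 <= 8 * mm <= 1 by lra.
(* With l = 8 mm and X >= Y s / 4 the gain is at least 2 mm Y s and the loss at most mm Y s. *)
have lb u : s + 1 < u < s + 2 -> Y s * mm <= dY u.
  move=> hu; have hu' : 0 < u < tau by lra.
  apply: le_trans (hY hu' hm).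
  have su : s + 1 <= u by lra.
  have ut : u <= tau by lra.
  have xb := growth_ge hs su ut.
  have h1 : 8 * mm * (Y s / 4) <= 8 * mm * X u by rewrite ler_wpM2l// mulr_ge0.
  have h2 : mm * (mm * (64 * C1 * (s + 4))) <= mm * Y s by rewrite ler_wpM2l.
  have h3 : C1 * (8 * mm) ^+ 2 * (2 + u) <= C1 * (8 * mm) ^+ 2 * (s + 4).
    by rewrite ler_wpM2l ?mulr_ge0 ?sqr_ge0 ?(ltW C10)//; lra.
  move: h1 h2 h3; rewrite (_ : C1 * (8 * mm) ^+ 2 * (s + 4) = mm * (mm * (64 * C1 * (s + 4)))); last by ring.
  move: (C1 * _ * _) (mm * (mm * _)) (8 * mm * X u) => p q r; lra.
have s12 : s + 1 <= s + 2 by lra.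
have H : Y (s + 1) - Y s * mm * (s + 1) <= Y (s + 2) - Y s * mm * (s + 2).
  apply: (@le_of_deriv_ge0 R (fun u => Y u - Y s * mm * u) (fun u => dY u - Y s * mm) (s + 1) (s + 2) s12) => u hu.
  - apply: (@continuousB _ R^o R Y (fun u => Y s * mm * u)); first by apply: Yc; lra.
    by apply: continuousM; [exact: cst_continuous|exact: cvg_id].
  - have hu' : 0 < u < tau by lra.
    have := deriv_atB (Yd hu') (deriv_atZ (Y s * mm) (deriv_at_id u)).
    by move/deriv_at_eq; apply; rewrite mulr1.
  - by rewrite subr_ge0; exact: lb.
have : Y s <= Y (s + 1) by apply: growth_mono; lra.
by move: H; move: (Y (s + 1)) (Y (s + 2)) => y1 y2; lra.
Qed.

End Growth.

Section FunctionalBlowup.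
Variable R : realType.

(* With X = e^-t P and Y = e^-t (P + Q): X' = Y - 2 X and Y' >= l X - C1 l^2 (2 + t). *)
Lemma functional_blowup (C1 C2 K a b : R) : 0 < C1 -> 0 < C2 -> 0 <= K -> 0 < a + b ->
  exists eps0 C : R, [/\ 0 < eps0, 0 < C & forall (eps tau : R) (P Q dQ : R -> R),
    0 < eps <= eps0 -> 0 < tau ->
    (forall t, 0 <= t <= tau -> {for t, continuous P}) ->
    (forall t, 0 <= t <= tau -> {for t, continuous Q}) ->
    (forall t, 0 < t < tau -> deriv_at P t 1 (Q t)) ->
    (forall t, 0 < t < tau -> deriv_at Q t 1 (dQ t)) ->
    (forall t l, 0 < t < tau -> 0 <= l <= 1 ->
       P t + l * P t - C1 * l ^+ 2 * ((2 + t) * expR t) <= dQ t) ->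
    (forall t, 0 <= t <= tau -> P t <= C2 * (3 + t) ^+ 3 * expR t) ->
    P 0 = eps * a -> eps * b - K * eps ^+ 2 <= Q 0 ->
    tau <= expR (C / eps)].
Proof.
move=> C10 C20 K0 ab.
(* Half of a + b: the other half absorbs K eps^2 once eps <= c0 / (K + 1). *)
pose c0 := (a + b) / 2; have c00 : 0 < c0 by rewrite divr_gt0.
(* The time by which X is nonnegative. It is independent of eps, since X 0 and the lower bound for Y
   0 both scale like eps. *)
pose t0 := `|a| / c0; have t00 : 0 <= t0 by rewrite divr_ge0 ?normr_ge0 ?ltW.
(* At the sampling times s = t0 + 2 n one has s + 4 <= D (n + 8), the form required by
   [discrete_blowup]. *)
pose D := t0 + 4; have D4 : 4 <= D by rewrite /D; lra.
pose k := (64 * C1 * D)^-1.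
have k0 : 0 < k by rewrite invr_gt0 !mulr_gt0//; lra.
pose C := 4 * C2 * D ^+ 3.
have Cp : 0 < C.
  have D3 : 0 < D ^+ 3 by apply: exprn_gt0; lra.
  by rewrite /C mulr_gt0// mulr_gt0.
have [Kd [Kd0 dis]] := discrete_blowup k0 c00 Cp.
exists (Num.min 1 (c0 / (K + 1))), (Kd + ln (t0 + 5)); split.
- by rewrite lt_min ltr01 divr_gt0//; lra.
- by rewrite ltr_wpDr// ln_ge0//; lra.
move=> eps tau P Q dQ /andP[e0]; rewrite le_min => /andP[e1 eK] tau0 Pc Qc Pd Qd hQ Pup P0 Q0.
rewrite ler_pdivlMr in eK; last by lra.
pose E (t : R) := expR (- t).
have Ed t : deriv_at E t 1 (- E t).
  have := deriv_at_comp (deriv_at_exp (- t)) (deriv_atN (deriv_at_id t)).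
  by move/deriv_at_eq; apply; rewrite mulrN1.
have Ep t : 0 < E t by exact: expR_gt0.
have EE t : E t * expR t = 1 by rewrite /E -expRD addNr expR0.
pose X t := E t * P t; pose Y t := E t * (P t + Q t).
pose dY t := E t * (dQ t - P t).
have Ec t : {for t, continuous E} := deriv_at_cont (Ed t).
have Xc t : 0 <= t <= tau -> {for t, continuous X}.
  by move=> ht; apply: (@continuousM _ _ E P); [exact: Ec|exact: Pc].
have Yc t : 0 <= t <= tau -> {for t, continuous Y}.
  move=> ht; apply: (@continuousM _ _ E (fun t => P t + Q t)); first exact: Ec.
  by apply: (@continuousD _ R^o R P Q); [exact: Pc|exact: Qc].
have Xd t : 0 < t < tau -> deriv_at X t 1 (Y t - 2 * X t).
  move=> ht; have := deriv_atM (Ed t) (Pd t ht).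
  by move/deriv_at_eq; apply; rewrite /X /Y; ring.
have Yd t : 0 < t < tau -> deriv_at Y t 1 (dY t).
  move=> ht; have := deriv_atM (Ed t) (deriv_atD (Pd t ht) (Qd t ht)).
  by move/deriv_at_eq; apply; rewrite /dY; ring.
have hY t l : 0 < t < tau -> 0 <= l <= 1 -> l * X t - C1 * l ^+ 2 * (2 + t) <= dY t.
  move=> ht hl; have h := ler_wpM2l (ltW (Ep t)) (hQ t l ht hl).
  rewrite /dY /X mulrBr; move: h; rewrite mulrBr mulrDr.
  have -> : E t * (C1 * l ^+ 2 * ((2 + t) * expR t)) = C1 * l ^+ 2 * (2 + t) * (E t * expR t) by ring.
  by rewrite EE mulr1; lra.
have Y0 : c0 * eps <= Y 0.
  rewrite /Y /E oppr0 expR0 mul1r P0.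
  have : K * eps ^+ 2 <= c0 * eps.
    rewrite expr2 mulrA ler_pM2r//; lra.
  rewrite /c0; lra.
have X0 : X 0 = eps * a by rewrite /X /E oppr0 expR0 mul1r P0.
have c1p : 0 <= c0 * eps by rewrite mulr_ge0// ltW.
have ht0 : - X 0 <= t0 * (c0 * eps).
  rewrite X0 mulrA [t0 * c0]divfK ?gt_eqF// mulrC -mulNr ler_pM2r//.
  by rewrite -[`|a|]normrN ler_norm.
have Ymono := growth_mono Yc Yd hY.
have Yge0 := growth_ge0 c1p Yc Yd hY Y0.
have Xbig := growth_ge c1p Xc Yc Xd Yd hY Y0 t00 ht0.
have step := growth_step C10 c1p Xc Yc Xd Yd hY Y0 t00 ht0.
have fin (x : R) : x <= (t0 + 5) * expR (Kd / eps) -> x <= expR ((Kd + ln (t0 + 5)) / eps).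
  move=> h; apply: (le_trans h); have t5 : 0 < t0 + 5 by lra.
  rewrite [X in _ <= expR X]mulrDl expRD [leRHS]mulrC ler_pM2r ?expR_gt0//.
  rewrite -{1}(lnK (_ : t0 + 5 \in Num.pos)) ?posrE// ler_expR ler_pdivlMr//.
  by rewrite ler_piMr// ln_ge0//; lra.
apply: fin.
have X1 : 1 <= expR (Kd / eps) by rewrite -expR0 ler_expR divr_ge0// ltW.
have [small|large] := ltP tau (t0 + 1); first by nra.
have z0 : 0 <= (tau - t0 - 1) / 2 by rewrite divr_ge0//; lra.
have /andP[N1 N2] := truncn_itv z0.
set N := Num.truncn _ in N1 N2; rewrite -[N.+1%:R]natr1 in N2.
have Nb : N%:R <= expR (Kd / eps).
  apply: (dis eps N (fun n => Y (t0 + 2 * n%:R))).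
  - by rewrite e0.
  - by rewrite mulr0 addr0; apply: le_trans Y0 _; apply: Ymono; lra.
  - move=> n nN; have nN' : n%:R + 1 <= N%:R :> R by rewrite natr1 ler_nat.
    have n0 : (0 : R) <= n%:R by [].
    have -> : t0 + 2 * n.+1%:R = t0 + 2 * n%:R + 2 by rewrite -natr1; ring.
    have hs : t0 <= t0 + 2 * n%:R by lra.
    have hs2 : t0 + 2 * n%:R + 2 <= tau by lra.
    apply: le_trans (step _ hs hs2).
    have Ys : 0 <= Y (t0 + 2 * n%:R).
      by apply: Yge0; lra.
    rewrite ler_wpM2l// lerD2l le_min ge_min lexx /= ge_min; apply/orP; right.
    have n8 : 0 < n%:R + 8 :> R by lra.
    have D0 : 0 < D by lra.
    have -> : k * Y (t0 + 2 * n%:R) / (n%:R + 8) = Y (t0 + 2 * n%:R) / (64 * C1 * (D * (n%:R + 8))).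
      by rewrite /k; field; rewrite !gt_eqF.
    apply: ler_wpM2l => //; rewrite lef_pV2 ?posrE; first last.
    + by rewrite !mulr_gt0//; lra.
    + by rewrite !mulr_gt0.
    apply: ler_wpM2l; first by rewrite mulr_ge0// ltW.
    have := mulr_ge0 (ltW (lt_le_trans (ltr0Sn R 3) D4)) n0; rewrite /D; nra.
  - move=> n nN; have nN' : n%:R <= N%:R :> R by rewrite ler_nat.
    have n0 : (0 : R) <= n%:R by [].
    have hs : t0 <= t0 + 2 * n%:R by lra.
    have hs1 : 0 <= t0 + 2 * n%:R + 1 <= tau by lra.
    have xb := Xbig _ (t0 + 2 * n%:R + 1) hs (lexx _) (proj2 (andP hs1)).
    have pu := Pup (t0 + 2 * n%:R + 1) hs1.
    have xu : X (t0 + 2 * n%:R + 1) <= C2 * (3 + (t0 + 2 * n%:R + 1)) ^+ 3.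
      have := ler_wpM2l (ltW (Ep (t0 + 2 * n%:R + 1))) pu.
      by rewrite mulrCA EE mulr1.
    have cube : (3 + (t0 + 2 * n%:R + 1)) ^+ 3 <= (D * (n%:R + 8)) ^+ 3.
      have D0 : 0 <= D by lra.
      rewrite lerXn2r ?nnegrE; [by []|lra|by rewrite mulr_ge0//; lra|].
      have := mulr_ge0 t00 n0; rewrite /D; move: n0; move: (n%:R) => z hz0 hz; lra.
    rewrite exprMn in cube; have := ler_wpM2l (ltW C20) cube; rewrite /C.
    by move: xb xu; move: (Y _) (X _) (C2 * _) => y x z; rewrite mulrA => *; lra.
nra.
Qed.

End FunctionalBlowup.

(** * Balance laws *)

Section C1Fields.
Variables (R : realType) (tau : R).
Local Notation E := 'rV[R]_3.

(* Solutions enter as such fields by freezing them outside the time interval [0, tau], so that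
   continuity never has to be one-sided. *)
Record c1 := C1 {
  val : R -> E -> R;
  ct : R -> E -> R;
  cx : 'I_3 -> R -> E -> R;
  val_cont : continuous (fun q : R * E => val q.1 q.2);
  ct_cont : continuous (fun q : R * E => ct q.1 q.2);
  cx_cont : forall i, continuous (fun q : R * E => cx i q.1 q.2);
  ct_der : forall t x, 0 < t < tau -> deriv_at (fun t => val t x) t 1 (ct t x);
  cx_der : forall i t x, deriv_at (val t) x (delta_mx 0 i) (cx i t x) }.

Arguments val_cont : clear implicits.
Arguments ct_cont : clear implicits.
Arguments cx_cont : clear implicits.

Lemma swap_param_cont (f : E -> R) : continuous f -> continuous (fun q : R * E => f q.2).
Proof. by move=> fc; apply: (comp_cont fc); exact: snd_cont. Qed.

Definition c1cst (k : R) : c1 :=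
  @C1 (fun _ _ => k) (fun _ _ => 0) (fun _ _ _ => 0) (@cst_cont R _ k) (@cst_cont R _ 0)
    (fun _ => @cst_cont R _ 0) (fun t _ _ => deriv_at_cst k t 1) (fun i _ x => deriv_at_cst k x _).

Definition c1add (f g : c1) : c1 :=
  @C1 (fun t x => val f t x + val g t x) (fun t x => ct f t x + ct g t x)
    (fun i t x => cx f i t x + cx g i t x)
    (add_cont (val_cont f) (val_cont g)) (add_cont (ct_cont f) (ct_cont g))
    (fun i => add_cont (cx_cont f i) (cx_cont g i))
    (fun t x ht => deriv_atD (ct_der f x ht) (ct_der g x ht))
    (fun i t x => deriv_atD (cx_der f i t x) (cx_der g i t x)).

Definition c1mul (f g : c1) : c1 :=
  @C1 (fun t x => val f t x * val g t x) (fun t x => ct f t x * val g t x + val f t x * ct g t x)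
    (fun i t x => cx f i t x * val g t x + val f t x * cx g i t x)
    (mul_cont (val_cont f) (val_cont g))
    (add_cont (mul_cont (ct_cont f) (val_cont g)) (mul_cont (val_cont f) (ct_cont g)))
    (fun i => add_cont (mul_cont (cx_cont f i) (val_cont g)) (mul_cont (val_cont f) (cx_cont g i)))
    (fun t x ht => deriv_atM (ct_der f x ht) (ct_der g x ht))
    (fun i t x => deriv_atM (cx_der f i t x) (cx_der g i t x)).

Lemma pointwise_comp_cont (phi : R -> R) (f : c1) :
  (forall t x, {for val f t x, continuous phi}) -> continuous (fun q : R * E => phi (val f q.1 q.2)).
Proof.
move=> hc q; apply: (@continuous_comp _ _ _ (fun q : R * E => val f q.1 q.2) phi); first exact: val_cont.
exact: hc.
Qed.

Definition c1comp (phi dphi : R -> R) (f : c1)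
    (hd : forall t x, deriv_at phi (val f t x) 1 (dphi (val f t x)))
    (hc : forall t x, {for val f t x, continuous dphi}) : c1 :=
  @C1 (fun t x => phi (val f t x)) (fun t x => dphi (val f t x) * ct f t x)
    (fun i t x => dphi (val f t x) * cx f i t x)
    (pointwise_comp_cont (fun t x => deriv_at_cont (hd t x)))
    (mul_cont (pointwise_comp_cont hc) (ct_cont f))
    (fun i => mul_cont (pointwise_comp_cont hc) (cx_cont f i))
    (fun t x ht => deriv_at_comp (f := fun t => val f t x) (hd t x) (ct_der f x ht))
    (fun i t x => deriv_at_comp (f := val f t) (hd t x) (cx_der f i t x)).

Definition c1scale (k : R) (f : c1) : c1 := c1mul (c1cst k) f.
Definition c1sum (F : 'I_3 -> c1) : c1 := c1add (c1add (F 0) (F 1)) (F 2%:R).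

Definition c1space (f : E -> R) (df : 'I_3 -> E -> R) (fc : continuous f)
    (dfc : forall i, continuous (df i)) (fd : forall i x, deriv_at f x (delta_mx 0 i) (df i x)) : c1 :=
  @C1 (fun _ x => f x) (fun _ _ => 0) (fun i _ x => df i x) (swap_param_cont fc) (@cst_cont R _ 0)
    (fun i => swap_param_cont (dfc i)) (fun t x _ => deriv_at_cst (f x) t 1) (fun i _ x => fd i x).

Definition c1time (a da : R -> R) (dac : continuous da) (ad : forall t, deriv_at a t 1 (da t)) : c1 :=
  @C1 (fun t _ => a t) (fun t _ => da t) (fun _ _ _ => 0)
    (comp_cont (fun t => deriv_at_cont (ad t)) (@fst_cont R E)) (comp_cont dac (@fst_cont R E))
    (fun _ => @cst_cont R _ 0) (fun t _ _ => ad t) (fun i t x => deriv_at_cst (a t) x _).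

Lemma c1_slice_cont (f : c1) (t : R) : continuous (val f t).
Proof. exact: (section_cont (f := val f) (u := t) (val_cont f)). Qed.

Lemma box_int_val_cont (f : c1) M : 0 <= M -> continuous (fun t => box_int M (val f t)).
Proof. by move=> M0; have [_ _ _ h] := box_int_inner_cont M0 (val_cont f). Qed.

(** Differentiate under the integral and integrate the flux away: its i-th component vanishes on the
    two faces orthogonal to axis i. *)
Lemma box_balance (f : c1) (h : 'I_3 -> c1) (s : R -> E -> R) (M t : R) : 0 <= M -> 0 < t < tau ->
  (forall x, ct f t x + \sum_i cx (h i) i t x = s t x) ->
  (forall i (x : E), `|x 0 i| = M -> val (h i) t x = 0) ->
  deriv_at (fun t => box_int M (val f t)) t 1 (box_int M (s t)).
Proof.
move=> M0 ht e h0.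
have cS : continuous (fun x => \sum_i cx (h i) i t x).
  by apply: sum_cont => i; exact: (section_cont (f := cx (h i) i) (u := t) (cx_cont (h i) i)).
have cT : continuous (ct f t) := section_cont (f := ct f) (u := t) (ct_cont f).
have -> : box_int M (s t) = box_int M (ct f t).
  rewrite (@eq_box_int _ _ (s t) (fun x => ct f t x + \sum_i cx (h i) i t x)); last by move=> x _; rewrite e.
  rewrite (box_intD M0 cT cS) (box_int_sum M0); last first.
    by move=> i; exact: (section_cont (f := cx (h i) i) (u := t) (cx_cont (h i) i)).
  rewrite big1 ?addr0// => i _.
  apply: (@box_int_partial _ _ M0 (val (h i) t) _ i).
  - exact: (section_cont (f := cx (h i) i) (u := t) (cx_cont (h i) i)).
  - by move=> x; exact: cx_der.
  - exact: h0.
apply: (box_int_param_deriv M0); last exact: ct_cont.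
have /near_in_itvoo : t \in `]0, tau[%R by rewrite in_itv.
move=> hn; near=> u; split; first exact: c1_slice_cont.
move=> x; apply: ct_der.
have : u \in `]0, tau[%R by near: u.
by rewrite in_itv.
Unshelve. all: by end_near. Qed.

End C1Fields.

Arguments val_cont [R tau] c.
Arguments ct_cont [R tau] c.
Arguments cx_cont [R tau] c i.
Arguments c1_slice_cont [R tau] f t.
Arguments box_int_val_cont [R tau] f [M].

(** * The system in coordinates and its energy balance *)

Section Mhd.
Variables (R : realType) (tau g mu Sb : R).
Local Notation E := 'rV[R]_3.
Local Notation c1 := (c1 tau).
Hypotheses (g1 : 1 < g) (mu0 : 0 < mu).

Lemma deriv_at_ln (y : R) : 0 < y -> deriv_at (@ln R) y 1 y^-1.
Proof. exact: is_derive1_ln. Qed.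

Lemma inv_cont_at (y : R) : 0 < y -> {for y, continuous (fun z : R => z^-1)}.
Proof. by move=> y0; apply: inv_continuous; rewrite gt_eqF. Qed.

(* [log_c1 rho S] is L = ln rho + (S - Sb) / g, so that p = A rho^g e^S = e^(g L) / g and
   grad p = e^(g L) grad L. *)
Definition log_c1 (rho S : c1) (rho0 : forall t x, 0 < val rho t x) : c1 :=
  c1add (c1comp (fun t x => deriv_at_ln (rho0 t x)) (fun t x => inv_cont_at (rho0 t x)))
    (c1scale g^-1 (c1add S (c1cst tau (- Sb)))).

(** (curl B) x B and curl (u x B) are expanded into first derivatives, and the pressure gradient is
    e^(g L) grad L, with L the field [logv]. The equations are asked for 0 < t < tau, where the
    fields are not frozen. *)
Record mhd := Mhd {
  rho : c1; vel : 'I_3 -> c1; ent : c1; mag : 'I_3 -> c1;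
  rho_gt0 : forall t x, 0 < val rho t x;
  logv := log_c1 ent rho_gt0;
  mass_eq : forall t x, 0 < t < tau ->
    ct rho t x + \sum_j (cx rho j t x * val (vel j) t x + val rho t x * cx (vel j) j t x) = 0;
  mom_eq : forall i t x, 0 < t < tau ->
    val rho t x * (ct (vel i) t x + \sum_j val (vel j) t x * cx (vel i) j t x)
    + expR (g * val logv t x) * cx logv i t x
    - mu^-1 * (\sum_j (val (mag j) t x * cx (mag i) j t x - val (mag j) t x * cx (mag j) i t x)) = 0;
  ent_eq : forall t x, 0 < t < tau -> ct ent t x + \sum_j val (vel j) t x * cx ent j t x = 0;
  ind_eq : forall i t x, 0 < t < tau ->
    ct (mag i) t x - \sum_j (cx (vel i) j t x * val (mag j) t x + val (vel i) t x * cx (mag j) j t x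
      - cx (vel j) j t x * val (mag i) t x - val (vel j) t x * cx (mag i) j t x) = 0;
  div_eq : forall t x, 0 < t < tau -> \sum_j cx (mag j) j t x = 0 }.

(** The continuity equation divided by rho, plus 1 / g times the entropy equation. *)
Lemma log_transport (w : mhd) t x : 0 < t < tau ->
  ct (logv w) t x + \sum_j val (vel w j) t x * cx (logv w) j t x + \sum_j cx (vel w j) j t x = 0.
Proof.
move=> ht; have m := mass_eq w x ht; have e := ent_eq w x ht; have r0 := rho_gt0 w t x.
move: m e r0; rewrite !sum3E /=.
move: (val (rho w) t x) (ct (rho w) t x) (ct (ent w) t x) => r rt st.
move: (cx (rho w) 0 t x) (cx (rho w) 1 t x) (cx (rho w) 2%:R t x) => p0 p1 p2.
move: (cx (ent w) 0 t x) (cx (ent w) 1 t x) (cx (ent w) 2%:R t x) => s0 s1 s2.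
move: (val (vel w 0) t x) (val (vel w 1) t x) (val (vel w 2%:R) t x) => u0 u1 u2.
move: (cx (vel w 0) 0 t x) (cx (vel w 1) 1 t x) (cx (vel w 2%:R) 2%:R t x) => a0 a1 a2 m e r0.
have g0 : g != 0 by rewrite gt_eqF//; apply: lt_trans g1; exact: ltr01.
transitivity (r^-1 * (rt + (p0 * u0 + r * a0 + (p1 * u1 + r * a1) + (p2 * u2 + r * a2))) +
  g^-1 * (st + (u0 * s0 + u1 * s1 + u2 * s2))); last by rewrite m e !mulr0 addr0.
by field; rewrite g0 gt_eqF.
Qed.

Lemma deriv_at_rel_energy (y : R) :
  deriv_at (rel_energy g) y 1 ((expR (g * y) - expR y) / (g - 1)).
Proof.
have h := deriv_atD (deriv_atB (deriv_at_expR_lin g y) (deriv_atZ g (deriv_at_exp y))) (deriv_at_cst (g - 1) y 1).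
have := deriv_atM h (deriv_at_cst ((g * (g - 1))^-1) y 1).
move/deriv_at_eq; apply; rewrite mulr0 !addr0; field.
by rewrite !gt_eqF// ?subr_gt0//; apply: lt_trans g1.
Qed.

Lemma deriv_at_rel_pressure (y : R) : deriv_at (rel_pressure g) y 1 (expR (g * y)).
Proof.
have := deriv_atM (deriv_atB (deriv_at_expR_lin g y) (deriv_at_cst 1 y 1)) (deriv_at_cst g^-1 y 1).
move/deriv_at_eq; apply; rewrite mulr0 subr0 addr0 mulfK// gt_eqF//.
exact: lt_trans g1.
Qed.

Lemma exp_lin_cont (y : R) : {for y, continuous (fun y : R => expR (g * y))}.
Proof. exact: deriv_at_cont (deriv_at_expR_lin g y). Qed.

Lemma rel_energy_deriv_cont (y : R) : {for y, continuous (fun y : R => (expR (g * y) - expR y) / (g - 1))}.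
Proof.
apply: (@continuousM _ _ (fun y : R => expR (g * y) - expR y)); last exact: cst_continuous.
by apply: (@continuousB _ R^o); [exact: exp_lin_cont|exact: continuous_expR].
Qed.

Variable w : mhd.
Let u i := vel w i.
Let B i := mag w i.

Definition usq : c1 := c1sum (fun i => c1mul (u i) (u i)).
Definition bsq : c1 := c1sum (fun i => c1mul (B i) (B i)).
Definition udotb : c1 := c1sum (fun i => c1mul (u i) (B i)).
Definition int_energy : c1 :=
  c1comp (f := logv w) (fun t x => deriv_at_rel_energy _) (fun t x => rel_energy_deriv_cont (y := val (logv w) t x)).
Definition rpress : c1 :=
  c1comp (f := logv w) (fun t x => deriv_at_rel_pressure _) (fun t x => exp_lin_cont (y := val (logv w) t x)).
(** e^L obeys the continuity equation like the density, so the convex function H of L gives a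
    conserved internal energy whatever the entropy, minimal at rest. The magnetic part of [eflux] is
    the Poynting flux. *)
Definition energy : c1 :=
  c1add (c1add (c1scale 2^-1 (c1mul (rho w) usq)) int_energy) (c1scale (2 * mu)^-1 bsq).
Definition eflux (j : 'I_3) : c1 :=
  c1add (c1mul (u j) (c1add (c1add (c1scale 2^-1 (c1mul (rho w) usq)) int_energy) rpress))
    (c1scale mu^-1 (c1add (c1mul (u j) bsq) (c1scale (- 1) (c1mul udotb (B j))))).

(* Multiply mass by |u|^2 / 2, momentum by u, induction by B / mu, and use H' = H + pi. *)
Lemma energy_balance t x : 0 < t < tau -> ct energy t x + \sum_j cx (eflux j) j t x = 0.
Proof.
move=> ht; have m := mass_eq w x ht; have hl := log_transport w x ht.
have m0 := mom_eq w 0 x ht; have m1 := mom_eq w 1 x ht; have m2 := mom_eq w 2%:R x ht.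
have i0 := ind_eq w 0 x ht; have i1 := ind_eq w 1 x ht; have i2 := ind_eq w 2%:R x ht.
move: m hl m0 m1 m2 i0 i1 i2; rewrite !sum3E /energy /eflux /int_energy /rpress /usq /bsq /udotb /u /B.
move: (logv w) => L; rewrite /c1sum /c1scale /=.
rewrite /rel_energy /rel_pressure.
have g0 : g != 0 by rewrite gt_eqF//; apply: lt_trans g1; exact: ltr01.
have g10 : g - 1 != 0 by rewrite gt_eqF// subr_gt0.
have muN : mu != 0 by rewrite gt_eqF.
move: (val (rho w) t x) (ct (rho w) t x) => r rt.
move: (cx (rho w) 0 t x) (cx (rho w) 1 t x) (cx (rho w) 2%:R t x) => r0 r1 r2.
move: (expR (g * val L t x)) (expR (val L t x)) (ct L t x) => a b lt.
move: (cx L 0 t x) (cx L 1 t x) (cx L 2%:R t x) => l0 l1 l2.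
move: (val (vel w 0) t x) (val (vel w 1) t x) (val (vel w 2%:R) t x) => u0 u1 u2.
move: (ct (vel w 0) t x) (ct (vel w 1) t x) (ct (vel w 2%:R) t x) => v0 v1 v2.
move: (cx (vel w 0) 0 t x) (cx (vel w 0) 1 t x) (cx (vel w 0) 2%:R t x) => u00 u01 u02.
move: (cx (vel w 1) 0 t x) (cx (vel w 1) 1 t x) (cx (vel w 1) 2%:R t x) => u10 u11 u12.
move: (cx (vel w 2%:R) 0 t x) (cx (vel w 2%:R) 1 t x) (cx (vel w 2%:R) 2%:R t x) => u20 u21 u22.
move: (val (mag w 0) t x) (val (mag w 1) t x) (val (mag w 2%:R) t x) => b0 b1 b2.
move: (ct (mag w 0) t x) (ct (mag w 1) t x) (ct (mag w 2%:R) t x) => d0 d1 d2.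
move: (cx (mag w 0) 0 t x) (cx (mag w 0) 1 t x) (cx (mag w 0) 2%:R t x) => b00 b01 b02.
move: (cx (mag w 1) 0 t x) (cx (mag w 1) 1 t x) (cx (mag w 1) 2%:R t x) => b10 b11 b12.
move: (cx (mag w 2%:R) 0 t x) (cx (mag w 2%:R) 1 t x) (cx (mag w 2%:R) 2%:R t x) => b20 b21 b22.
move=> m hl m0 m1 m2 i0 i1 i2.
match type of m with ?M = _ => match type of hl with ?HL = _ =>
match type of m0 with ?M0 = _ => match type of m1 with ?M1 = _ => match type of m2 with ?M2 = _ =>
match type of i0 with ?I0 = _ => match type of i1 with ?I1 = _ => match type of i2 with ?I2 = _ =>
  transitivity ((u0 * u0 + u1 * u1 + u2 * u2) / 2 * M + u0 * M0 + u1 * M1 + u2 * M2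
    + (a - b) / (g - 1) * HL + mu^-1 * b0 * I0 + mu^-1 * b1 * I1 + mu^-1 * b2 * I2)
end end end end end end end end; last by rewrite m m0 m1 m2 hl i0 i1 i2 !mulr0 !addr0.
by field; rewrite g0 g10 muN.
Qed.

End Mhd.

(** * Finite propagation speed *)

Section VectorBounds.
Variable R : realType.
Local Notation E := 'rV[R]_3.

Lemma dotp_sqr_le (x y : E) : dotp x y ^+ 2 <= dotp x x * dotp y y.
Proof.
rewrite !dotpE; move: (x 0 0) (x 0 1) (x 0 2%:R) (y 0 0) (y 0 1) (y 0 2%:R) => a b c d e f.
rewrite -subr_ge0.
suff -> : (a * a + b * b + c * c) * (d * d + e * e + f * f) - (a * d + b * e + c * f) ^+ 2 =
  (a * e - b * d) ^+ 2 + (b * f - c * e) ^+ 2 + (a * f - c * d) ^+ 2 by rewrite !addr_ge0 ?sqr_ge0.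
by ring.
Qed.

Lemma dotp_norm_le (x y : E) : `|dotp x y| <= enorm x * enorm y.
Proof.
rewrite -(@ler_pXn2r _ 2) ?nnegrE ?normr_ge0 ?mulr_ge0 ?enorm_ge0//.
by rewrite real_normK ?num_real// exprMn !enorm_sqr dotp_sqr_le.
Qed.

Lemma dotp_le_enorm (x y : E) : dotp x y <= enorm x * enorm y.
Proof. exact: le_trans (ler_norm _) (dotp_norm_le x y). Qed.

Lemma enorm_triangle (x y : E) : enorm (x + y) <= enorm x + enorm y.
Proof.
rewrite -(@ler_pXn2r _ 2) ?nnegrE ?addr_ge0 ?enorm_ge0//.
rewrite sqrrD !enorm_sqr.
have -> : dotp (x + y) (x + y) = dotp x x + dotp x y *+ 2 + dotp y y.
  by rewrite !dotpE !mxE; move: (x 0 0) (x 0 1) (x 0 2%:R) (y 0 0) (y 0 1) (y 0 2%:R) => *; ring.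
by rewrite lerD2r lerD2l lerMn2r /= dotp_le_enorm.
Qed.

Lemma enormN (x : E) : enorm (- x) = enorm x.
Proof. by rewrite /enorm; congr Num.sqrt; rewrite !dotpE !mxE !mulrNN. Qed.

Lemma enormB_sym (x y : E) : enorm (x - y) = enorm (y - x).
Proof. by rewrite -enormN opprB. Qed.

(* (u.v)|b|^2 - (u.b)(b.v) = u.w with w = |b|^2 v - (b.v) b, and |w| <= |b|^2 |v|. *)
Lemma lorentz_flux_le (u v b : E) :
  dotp u v * dotp b b - dotp u b * dotp b v <= enorm u * (enorm v * dotp b b).
Proof.
pose w : E := dotp b b *: v - dotp b v *: b.
have -> : dotp u v * dotp b b - dotp u b * dotp b v = dotp u w.
  rewrite /w; move: (dotp b b) (dotp b v) => p q; rewrite !dotpE !mxE.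
  by move: (u 0 0) (u 0 1) (u 0 2%:R) (v 0 0) (v 0 1) (v 0 2%:R) (b 0 0) (b 0 1) (b 0 2%:R) => *; ring.
apply: (le_trans (dotp_le_enorm u w)); apply: ler_wpM2l; first exact: enorm_ge0.
rewrite -(@ler_pXn2r _ 2) ?nnegrE ?mulr_ge0 ?enorm_ge0 ?dotpp_ge0//.
rewrite exprMn !enorm_sqr.
have -> : dotp w w = dotp v v * dotp b b ^+ 2 - dotp b b * dotp b v ^+ 2.
  rewrite /w !dotpE !mxE.
  by move: (v 0 0) (v 0 1) (v 0 2%:R) (b 0 0) (b 0 1) (b 0 2%:R) => *; ring.
by rewrite gerBl mulr_ge0 ?sqr_ge0 ?dotpp_ge0.
Qed.

(** By Young, a |p| <= (a^2 + p^2) / 2 <= (1 + k) (r a^2 / 2 + H): sound carries energy at speed at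
    most 1 + k. Advection at speed a <= k adds the second k. *)
Lemma subsonic_scalar (a k r H p N X : R) : 0 <= a -> a <= k -> 0 <= N -> 0 <= H -> 0 <= r ->
  1 <= (1 + k) * r -> p ^+ 2 <= (1 + k) * (2 * H) -> X <= a * N * (r / 2 * a ^+ 2 + H + `|p|) ->
  X <= (1 + 2 * k) * N * (r / 2 * a ^+ 2 + H).
Proof.
move=> a0 ak N0 H0 r0 rk pk hX.
have q0 := normr_ge0 p; have : `|p| ^+ 2 <= (1 + k) * (2 * H) by rewrite real_normK ?num_real.
move: `|p| q0 hX => q q0 hX {}pk.
have aq : a * q <= (1 + k) * (r / 2 * a ^+ 2 + H).
  have h1 : a ^+ 2 <= (1 + k) * r * a ^+ 2 by rewrite ler_peMl ?sqr_ge0.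
  have h2 : 0 <= (a - q) ^+ 2 by exact: sqr_ge0.
  have e : (1 + k) * r * a ^+ 2 = 2 * ((1 + k) * (r / 2 * a ^+ 2)) by field.
  by rewrite e in h1; move: h2; rewrite sqrrB mulrDr -mulr_natl => h2; lra.
have X0 : 0 <= r / 2 * a ^+ 2 + H by rewrite addr_ge0// mulr_ge0 ?sqr_ge0// divr_ge0.
move: (r / 2 * a ^+ 2 + H) X0 aq hX => Y Y0 aq hX.
apply: (le_trans hX).
have -> : a * N * (Y + q) = N * (a * (Y + q)) by ring.
have -> : (1 + 2 * k) * N * Y = N * ((1 + 2 * k) * Y) by ring.
apply: ler_wpM2l => //; have : a * Y <= k * Y by apply: ler_wpM2r.
by rewrite mulrDr mulrDl; lra.
Qed.

Lemma subsonic_flux_le (u v b : E) (k r H p m N : R) : enorm u <= k -> enorm v <= N -> 0 <= H -> 0 <= r -> 0 <= m ->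
  1 <= (1 + k) * r -> p ^+ 2 <= (1 + k) * (2 * H) ->
  dotp u v * (r / 2 * dotp u u + H + p) + m * (dotp u v * dotp b b - dotp u b * dotp b v)
    <= (1 + 2 * k) * N * (r / 2 * dotp u u + H + m / 2 * dotp b b).
Proof.
move=> uk vN H0 r0 m0 rk pk; have a0 := enorm_ge0 u; have N0 : 0 <= N := le_trans (enorm_ge0 v) vN.
have k0 : 0 <= k := le_trans a0 uk.
rewrite [X in _ <= X]mulrDr; apply: lerD; last first.
  have b0 := dotpp_ge0 b; have mb0 : 0 <= m * dotp b b by exact: mulr_ge0.
  apply: (@le_trans _ _ (m * (k * (N * dotp b b)))).
    apply: ler_wpM2l => //; apply: (le_trans (lorentz_flux_le u v b)).
    by apply: ler_pM => //; rewrite ?mulr_ge0 ?enorm_ge0// ler_wpM2r.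
  have -> : m * (k * (N * dotp b b)) = k * (N * (m * dotp b b)).
    by move: (dotp b b) => *; ring.
  have -> : (1 + 2 * k) * N * (m / 2 * dotp b b) = k * (N * (m * dotp b b)) + 2^-1 * (N * (m * dotp b b)).
    by move: (dotp b b) => *; field.
  by rewrite lerDl !mulr_ge0// invr_ge0.
rewrite -enorm_sqr; apply: (subsonic_scalar (p := p) a0 uk N0 H0 r0 rk pk).
have Y0 : 0 <= r / 2 * enorm u ^+ 2 + H by rewrite addr_ge0// mulr_ge0 ?sqr_ge0// divr_ge0.
apply: (le_trans (ler_norm _)); rewrite normrM; apply: ler_pM => //.
  by apply: (le_trans (dotp_norm_le u v)); apply: ler_wpM2l.
by apply: (le_trans (ler_normD _ _)); rewrite (ger0_norm Y0).
Qed.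

(* max(0, z)^2 and its derivative. *)
Definition pos2 (z : R) : R := (z ^+ 2 + z * `|z|) / 2.
Definition dpos2 (z : R) : R := z + `|z|.

Lemma dpos2_ge0 z : 0 <= dpos2 z.
Proof. by rewrite /dpos2; case: (ger0P z) => ?; lra. Qed.

Lemma pos2E z : pos2 z = dpos2 z ^+ 2 / 4.
Proof.
rewrite /pos2 /dpos2; case: (ger0P z) => ? ; first by field.
by rewrite subrr expr0n mul0r; field.
Qed.

Lemma pos2_ge0 z : 0 <= pos2 z.
Proof. by rewrite pos2E divr_ge0 ?sqr_ge0. Qed.

Lemma dpos2_le0 z : z <= 0 -> dpos2 z = 0.
Proof. by move=> z0; rewrite /dpos2 ler0_norm ?subrr. Qed.

Lemma pos2_le0 z : z <= 0 -> pos2 z = 0.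
Proof. by move=> z0; rewrite pos2E dpos2_le0// expr0n mul0r. Qed.

Lemma pos2_gt0 z : 0 < z -> 0 < pos2 z.
Proof. by move=> z0; rewrite pos2E /dpos2 gtr0_norm// divr_gt0// exprn_gt0// addr_gt0. Qed.

Lemma dpos2_cont : continuous dpos2.
Proof.
have nc : continuous (fun y : R => `|y|) by move=> y; exact: norm_continuous.
exact: (add_cont (@id_cont _) nc).
Qed.

Lemma pos2_taylor (y z : R) : `|pos2 y - pos2 z - dpos2 z * (y - z)| <= (y - z) ^+ 2.
Proof.
rewrite ler_norml /pos2 /dpos2; apply/andP.
by split; case: (ger0P y) => hy; case: (ger0P z) => hz;
  have := sqr_ge0 (y - z); have := sqr_ge0 y; have := sqr_ge0 z; have := mulr_ge0 (normr_ge0 y) (normr_ge0 z); try rewrite (ger0_norm hy); try rewrite (ger0_norm hz);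
  try rewrite (ltr0_norm hy); try rewrite (ltr0_norm hz); nra.
Qed.

Lemma deriv_at_pos2 (z : R) : deriv_at pos2 z 1 (dpos2 z).
Proof.
apply: deriv_at_intro => e e0; near=> y.
have ye : `|y - z| <= e.
  by rewrite distrC; apply/ltW; near: y; exact: (nbhsx_ballx _ _ e0).
apply: (le_trans (pos2_taylor y z)).
by rewrite -real_normK ?num_real// expr2 ler_wpM2r.
Unshelve. all: by end_near. Qed.

End VectorBounds.

(** * The energy estimate in a backward cone *)

Section Cone.
Variables (R : realType) (tau g mu Sb : R) (w : mhd tau g mu Sb).
Local Notation E := 'rV[R]_3.
Hypotheses (g1 : 1 < g) (mu0 : 0 < mu).

Definition row_of (F : 'I_3 -> c1 tau) (t : R) (x : E) : E := \row_i val (F i) t x.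

Definition at_rest (t : R) (x : E) := [/\ val (rho w) t x = 1, forall i, val (vel w i) t x = 0,
  forall i, val (mag w i) t x = 0 & val (ent w) t x = Sb].

(** Closeness to rest, expressed by the three inequalities under which energy travels at speed at
    most 1 + 2 k. *)
Definition subsonic (k t : R) (x : E) := [/\ val (usq w) t x <= k ^+ 2, 1 <= (1 + k) * val (rho w) t x
  & rel_pressure g (val (logv w) t x) ^+ 2 <= (1 + k) * (2 * rel_energy g (val (logv w) t x))].

Lemma val_usq t x : val (usq w) t x = dotp (row_of (vel w) t x) (row_of (vel w) t x).
Proof. by rewrite dotpE !mxE. Qed.

Lemma val_bsq t x : val (bsq w) t x = dotp (row_of (mag w) t x) (row_of (mag w) t x).
Proof. by rewrite dotpE !mxE. Qed.

Lemma val_energy t x : val (energy g1 w) t x = val (rho w) t x / 2 * val (usq w) t x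
  + rel_energy g (val (logv w) t x) + mu^-1 / 2 * val (bsq w) t x.
Proof.
transitivity (2^-1 * (val (rho w) t x * val (usq w) t x) + rel_energy g (val (logv w) t x)
  + (2 * mu)^-1 * val (bsq w) t x); first reflexivity.
by rewrite mulrA (mulrC _ (val (rho w) t x)) invfM (mulrC 2^-1 (mu^-1)).
Qed.

Lemma energy_terms_ge0 t x : [/\ 0 <= val (rho w) t x / 2 * val (usq w) t x,
  0 <= rel_energy g (val (logv w) t x) & 0 <= mu^-1 / 2 * val (bsq w) t x].
Proof.
have r0 := ltW (rho_gt0 w t x); split; last 1 first.
- by rewrite val_bsq mulr_ge0 ?dotpp_ge0// divr_ge0 ?invr_ge0 ?(ltW mu0).
- by rewrite val_usq mulr_ge0 ?dotpp_ge0// divr_ge0.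
- exact: rel_energy_ge0.
Qed.

Lemma energy_ge0 t x : 0 <= val (energy g1 w) t x.
Proof. by have [a b c] := energy_terms_ge0 t x; rewrite val_energy !addr_ge0. Qed.

Lemma c1mul_ct (f h : c1 tau) t x : ct (c1mul f h) t x = ct f t x * val h t x + val f t x * ct h t x.
Proof. by []. Qed.

Lemma c1mul_cx (f h : c1 tau) i t x :
  cx (c1mul f h) i t x = cx f i t x * val h t x + val f t x * cx h i t x.
Proof. by []. Qed.

Lemma c1mul_val (f h : c1 tau) t x : val (c1mul f h) t x = val f t x * val h t x.
Proof. by []. Qed.

Lemma dotpp_eq0 (v : E) : dotp v v = 0 -> forall i, v 0 i = 0.
Proof.
move=> v0 i; apply/eqP; rewrite -normr_le0; apply: (le_trans (coord_le_enorm v i)).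
by rewrite /enorm v0 sqrtr0.
Qed.

(** H = 0 forces the relative pressure to vanish by the third condition of [subsonic], and then L =
    0. *)
Lemma energy_eq0 k t x : subsonic k t x -> val (energy g1 w) t x = 0 ->
  [/\ val (logv w) t x = 0, forall i, val (vel w i) t x = 0 & forall i, val (mag w i) t x = 0].
Proof.
move=> [_ _ hp]; rewrite val_energy => e0; have [a0 b0 c0] := energy_terms_ge0 t x.
have [a b c] : [/\ val (rho w) t x / 2 * val (usq w) t x = 0, rel_energy g (val (logv w) t x) = 0 &
    mu^-1 / 2 * val (bsq w) t x = 0].
  move: (val (rho w) t x / 2 * _) (rel_energy _ _) (mu^-1 / 2 * _) e0 a0 b0 c0 => a b c e0 a0 b0 c0.
  by split; lra.
split.
- move: hp; rewrite b !mulr0 => hp; apply: (rel_pressure_eq0 g1); apply/eqP.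
  by rewrite -sqrf_eq0 -(le_anti (introT andP (conj hp (sqr_ge0 _)))).
- move=> i; move/eqP: a; rewrite mulf_eq0 gt_eqF ?divr_gt0 ?rho_gt0// orFb val_usq => /eqP/dotpp_eq0/(_ i).
  by rewrite mxE.
- move=> i; move/eqP: c; rewrite mulf_eq0 gt_eqF ?divr_gt0 ?invr_gt0// orFb val_bsq => /eqP/dotpp_eq0/(_ i).
  by rewrite mxE.
Qed.

Lemma eflux_dot_le k N t x (v : E) : 0 <= k -> subsonic k t x -> enorm v <= N ->
  \sum_j val (eflux g1 w j) t x * v 0 j <= (1 + 2 * k) * N * val (energy g1 w) t x.
Proof.
move=> k0 [hu hr hp] hv.
have uk : enorm (row_of (vel w) t x) <= k.
  by rewrite -(@ler_pXn2r _ 2) ?nnegrE ?enorm_ge0// enorm_sqr -val_usq.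
have m0 : 0 <= mu^-1 by rewrite invr_ge0 ltW.
have := subsonic_flux_le (row_of (mag w) t x) uk hv (rel_energy_ge0 (val (logv w) t x) g1) (ltW (rho_gt0 w t x)) m0 hr hp.
rewrite -val_usq -val_bsq -val_energy; apply: le_trans.
rewrite le_eqVlt; apply/orP; left; apply/eqP.
rewrite sum3E !dotpE !mxE /eflux /int_energy /rpress /usq /bsq /udotb; move: (logv w) => L.
rewrite /c1sum /c1scale /=.
move: (rel_energy _ _) (rel_pressure _ _) => H p.
move: (v 0 0) (v 0 1) (v 0 2%:R) => v0 v1 v2.
move: (val (vel w 0) t x) (val (vel w 1) t x) (val (vel w 2%:R) t x) => u0 u1 u2.
move: (val (mag w 0) t x) (val (mag w 1) t x) (val (mag w 2%:R) t x) => b0 b1 b2.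
by move: (val (rho w) t x) (mu^-1) => r m; clear; field.
Qed.

Section Weight.
Variables (s a : R) (x1 : E).

Lemma cone_time_deriv (t : R) : deriv_at (fun t => s ^+ 2 * (a - t) ^+ 2) t 1 (- (2 * s ^+ 2 * (a - t))).
Proof.
have h := deriv_atB (deriv_at_cst a t 1) (deriv_at_id t).
have := deriv_atZ (s ^+ 2) (deriv_atM h h).
have -> : (fun t => s ^+ 2 * ((a - t) * (a - t))) = (fun t => s ^+ 2 * (a - t) ^+ 2) by apply: funext => y; rewrite expr2.
by move/deriv_at_eq; apply; ring.
Qed.

Lemma cone_space_deriv i (x : E) :
  deriv_at (fun x => - dotp (x1 - x) (x1 - x)) x (delta_mx 0 i) (2 * (x1 - x) 0 i).
Proof.
have h j := deriv_atB (deriv_at_cst (x1 0 j) x (delta_mx 0 i)) (deriv_at_coord x i j).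
have := deriv_atN (deriv_at_sum (fun j => deriv_atM (h j) (h j))).
have -> : (fun y : E => - (\sum_j (x1 0 j - y 0 j) * (x1 0 j - y 0 j))) = (fun x => - dotp (x1 - x) (x1 - x)).
  by apply: funext => y; rewrite /dotp; congr (- _); apply: eq_bigr => j _; rewrite !mxE.
move/deriv_at_eq; apply; rewrite (bigD1 i)//= big1 => [|j ji]; last first.
  by rewrite eq_sym (negPf ji) subrr mul0r mulr0 addr0.
by rewrite eqxx !mxE addr0 sub0r mulN1r mulrN1 -opprD opprK -mulr2n mulr_natl.
Qed.

Lemma cone_space_cont : continuous (fun x : E => - dotp (x1 - x) (x1 - x)).
Proof.
have h : continuous (fun x : E => x1 - x) by move=> y; apply: continuousB; [exact: cst_continuous|exact: id_cont].
exact: opp_cont (dotp_cont h h).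
Qed.

Lemma cone_time_cont : continuous (fun t : R => - (2 * s ^+ 2 * (a - t))).
Proof. by apply: opp_cont; apply: mul_cont; [exact: cst_cont|apply: sub_cont; [exact: cst_cont|exact: id_cont]]. Qed.

Lemma cone_space_dcont i : continuous (fun x : E => 2 * (x1 - x) 0 i).
Proof.
have h : continuous (fun x : E => x1 0 i - x 0 i) := sub_cont (@cst_cont R E (x1 0 i)) (@coord_cont R i).
have -> : (fun x : E => 2 * (x1 - x) 0 i) = (fun x => 2 * (x1 0 i - x 0 i)) by apply: funext => y; rewrite !mxE.
exact: (mul_cont (@cst_cont R E 2) h).
Qed.

(** s^2 (a - t)^2 - |x1 - x|^2: for t <= a it is positive exactly inside the backward cone of slope
    s with apex (a, x1). The squared positive part [cone_weight] is a C^1 weight supported there. *)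
Definition cone_fun : c1 tau := c1add (c1time tau cone_time_cont cone_time_deriv)
  (c1space tau cone_space_cont cone_space_dcont cone_space_deriv).

Definition cone_weight : c1 tau :=
  c1comp (f := cone_fun) (fun t x => deriv_at_pos2 _) (fun t x => @dpos2_cont R (val cone_fun t x)).

Lemma cone_fun_gt0 t x : 0 <= s -> t <= a -> (0 < val cone_fun t x) = (enorm (x1 - x) < s * (a - t)).
Proof.
move=> s0 ta; rewrite /= subr_gt0 -enorm_sqr -exprMn ltr_pXn2r ?nnegrE ?enorm_ge0//.
by rewrite mulr_ge0// subr_ge0.
Qed.

End Weight.

(** The integral of energy times weight does not increase: inside the cone |x1 - x| < s (a - t), so
    flux . (x1 - x) is at most s (s (a - t)) times the energy. It starts at 0, hence the energy
    vanishes wherever the weight is positive, and t1 < a makes it positive at x1. *)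
Lemma cone_rest (k t0 t1 a M : R) (x1 : E) : 0 <= k -> 0 <= t0 -> t0 < t1 -> t1 <= tau -> t1 < a ->
  enorm x1 + (1 + 2 * k) * (a - t0) <= M ->
  (forall t x, t0 < t < t1 -> enorm (x1 - x) < (1 + 2 * k) * (a - t) -> subsonic k t x) ->
  (forall x, enorm (x1 - x) < (1 + 2 * k) * (a - t0) -> val (energy g1 w) t0 x = 0) ->
  val (energy g1 w) t1 x1 = 0.
Proof.
move=> k0 t00 t01 t1tau t1a hM sub rest0; pose s := 1 + 2 * k.
have s0 : 0 < s by rewrite /s; lra.
have sa : 0 < s * (a - t0) by rewrite mulr_gt0// subr_gt0; lra.
have x1M : enorm x1 < M by apply: lt_le_trans hM; rewrite ltrDl.
have M0 : 0 <= M by apply: ltW; apply: le_lt_trans x1M; exact: enorm_ge0.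
pose W := cone_weight s a x1; pose f := c1mul (energy g1 w) W.
pose h i := c1mul (eflux g1 w i) W.
have W0 t x : t <= a -> s * (a - t) <= enorm (x1 - x) -> val W t x = 0.
  move=> ta hx; apply: pos2_le0; rewrite leNgt cone_fun_gt0 ?(ltW s0)//.
  by rewrite -leNgt.
pose src t x := val (energy g1 w) t x * ct W t x + \sum_j val (eflux g1 w j) t x * cx W j t x.
have bal t : t0 < t < t1 -> deriv_at (fun t => box_int M (val f t)) t 1 (box_int M (src t)).
  move=> /andP[ht0 ht1]; have ht : 0 < t < tau by apply/andP; split; lra.
  apply: (box_balance (f := f) (h := h) M0 ht) => [x|i x xM].
    have e := energy_balance g1 mu0 w x ht; rewrite /src /f /h c1mul_ct.
    under eq_bigr do rewrite c1mul_cx.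
    rewrite big_split -mulr_suml; move: (val W t x) => {}q.
    move: (ct (energy g1 w) t x) (\sum_j cx (eflux g1 w j) j t x) (\sum_j _) e => p r u e.
    by rewrite /= addrACA -mulrDl e mul0r add0r.
  rewrite /h c1mul_val W0 ?mulr0//; first lra.
  have h1 : M <= enorm x by rewrite -xM; exact: coord_le_enorm.
  have h2 : enorm x <= enorm (x1 - x) + enorm x1.
    by rewrite enormB_sym; apply: (le_trans _ (enorm_triangle _ _)); rewrite subrK.
  have h3 : s * (a - t) <= s * (a - t0) by rewrite ler_pM2l// lerD2l lerN2 ltW.
  by rewrite /s in h3 *; lra.
have src_le0 t x : t0 < t < t1 -> src t x <= 0.
  move=> ht; have ta : t <= a by lra.
  pose z := val (cone_fun s a x1) t x.
  have -> : src t x = 2 * dpos2 z * (\sum_j val (eflux g1 w j) t x * (x1 - x) 0 j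
      - s * (s * (a - t)) * val (energy g1 w) t x).
    rewrite /src /W /cone_weight /= -/z !sum3E !add0r.
    move: (val (energy g1 w) t x) (val (eflux g1 w 0) t x) (val (eflux g1 w 1) t x) (val (eflux g1 w 2%:R) t x).
    move: ((x1 - x) 0 0) ((x1 - x) 0 1) ((x1 - x) 0 2%:R) (dpos2 z) => *; ring.
  have [z0|z0] := ltP 0 z; last by rewrite (dpos2_le0 z0) mulr0 mul0r.
  have hz : enorm (x1 - x) < s * (a - t) by rewrite -cone_fun_gt0// ltW.
  apply: mulr_ge0_le0; first by rewrite mulr_ge0 ?dpos2_ge0.
  rewrite subr_le0; exact: (eflux_dot_le k0 (sub _ _ ht hz) (ltW hz)).
have cI := box_int_val_cont f M0.
have mono : box_int M (val f t1) <= box_int M (val f t0).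
  have := @le_of_deriv_ge0 R (fun t => - box_int M (val f t)) (fun t => - box_int M (src t)) t0 t1 (ltW t01).
  rewrite lerN2; apply.
  - move=> t _; exact: (opp_cont cI).
  - by move=> t ht; apply: deriv_atN; exact: bal.
  - move=> t ht; rewrite oppr_ge0 -oppr_ge0.
    have -> : - box_int M (src t) = box_int M (fun x => - src t x).
      have c1 : continuous (fun q : R * E => val (energy g1 w) q.1 q.2 * ct W q.1 q.2).
        exact: (mul_cont (val_cont (energy g1 w)) (ct_cont W)).
      have c2 : continuous (fun q : R * E => \sum_j val (eflux g1 w j) q.1 q.2 * cx W j q.1 q.2).
        by apply: sum_cont => j; exact: (mul_cont (val_cont (eflux g1 w j)) (cx_cont W j)).
      by rewrite -(box_intN M0) //; exact: (section_cont (f := src) (u := t) (add_cont c1 c2)).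
    by apply: box_int_ge0 => x _; rewrite oppr_ge0; exact: src_le0.
have f_ge0 t x : 0 <= val f t x by rewrite /f c1mul_val mulr_ge0 ?energy_ge0 ?pos2_ge0.
have z0 : box_int M (val f t0) = 0.
  rewrite (@eq_box_int _ _ _ (fun=> 0)); last first.
    move=> x _; have [hx|hx] := ltP (enorm (x1 - x)) (s * (a - t0)); rewrite /f c1mul_val.
      by rewrite rest0 ?mul0r.
    by rewrite (W0 t0 x (ltW (lt_trans t01 t1a)) hx) mulr0.
  by rewrite box_int_cst// mul0r.
have z1 : box_int M (val f t1) = 0.
  by apply/eqP; rewrite eq_le; apply/andP; split; [rewrite -z0; exact: mono|apply: box_int_ge0 => x _; exact: f_ge0].
have := box_int_eq0 M0 (c1_slice_cont f t1) (fun x _ => f_ge0 t1 x) z1 (x := x1).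
have hx i : - M < x1 0 i < M by rewrite -ltr_norml; apply: le_lt_trans x1M; exact: coord_le_enorm.
move/(_ hx)/eqP; rewrite /f c1mul_val mulf_eq0 => /orP[/eqP //|].
have zz : 0 < val (cone_fun s a x1) t1 x1.
  rewrite cone_fun_gt0 ?(ltW s0) ?(ltW t1a)// subrr /enorm dotpE !mxE !mul0r !addr0 sqrtr0.
  by rewrite mulr_gt0// subr_gt0.
by rewrite (gt_eqF (pos2_gt0 zz)).
Qed.

End Cone.

(** * Propagation of the rest state by short time steps *)

Section FiniteSpeed.
Variables (R : realType) (tau g mu Sb : R) (w : mhd tau g mu Sb).
Local Notation E := 'rV[R]_3.
Hypotheses (g1 : 1 < g) (mu0 : 0 < mu).

Lemma compact_box (m : R) : compact [set x : E | in_box m x].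
Proof.
have -> : [set x : E | in_box m x] = [set v : E | forall i, `[- m, m]%classic (v ord0 i)].
  by apply/seteqP; split => x h i; have := h i; rewrite /= in_itv.
exact: (@rV_compact R 3 (fun=> `[- m, m]%classic) (fun=> @segment_compact R (- m) m)).
Qed.

Lemma c1_time_cont (f : c1 tau) (x : E) : continuous (fun t => val f t x).
Proof.
have h : continuous (fun t : R => (t, x)).
  by apply: pair_cont; [apply: id_cont|apply: constant_cont].
exact: (comp_cont (val_cont f) h).
Qed.

(** The time shift h is the parameter of [near_uniform], taken near 0, over the compact set of all
    (s, x) in [0, tau] times the box. *)
Lemma time_uniform (f : c1 tau) (m e : R) : 0 < e ->
  exists2 d, 0 < d & forall s t x, 0 <= s <= tau -> `|t - s| <= d -> in_box m x ->
    `|val f t x - val f s x| <= e.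
Proof.
move=> e0; pose G (h : R) (q : R * E) := val f (q.1 + h) q.2.
have Gc : continuous (fun q : R * (R * E) => G q.1 q.2).
  have h1 : continuous (fun q : R * (R * E) => q.2.1) := comp_cont (@fst_cont _ _) (@snd_cont _ _).
  have h2 : continuous (fun q : R * (R * E) => q.2.2) := comp_cont (@snd_cont _ _) (@snd_cont _ _).
  exact: (comp_cont (val_cont f) (pair_cont (add_cont h1 (@fst_cont _ _)) h2)).
have K := compact_setX (@segment_compact R 0 tau) (@compact_box m).
have /nbhs_ballP[d /= d0 H] := near_uniform 0 K Gc e0.
exists (d / 2); first by rewrite divr_gt0.
move=> s t x hs hts hx; have h := H (t - s).
have /h/(_ (s, x)) : ball 0 d (t - s) by rewrite -ball_normE /ball_ /= sub0r normrN; apply: le_lt_trans hts _; rewrite ltr_pdivrMr// mulr_natr mulr2n ltrDl.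
rewrite /G /= addr0 (addrC s) subrK in_itv /= => h'.
by apply/ltW/h'; split.
Qed.

Lemma at_rest_logv t x : at_rest w t x -> val (logv w) t x = 0 /\ val (usq w) t x = 0.
Proof.
case=> hr hu _ hS; split; last by rewrite /usq /= !hu !mul0r !addr0.
by rewrite /= hr hS ln1 subrr mulr0 addr0.
Qed.

(** The same [d] serves every starting time s, so finitely many steps cover [0, tau]. *)
Lemma subsonic_near_rest (k m : R) : 0 < k -> exists2 d, 0 < d &
  forall s t x, 0 <= s <= tau -> `|t - s| <= d -> in_box m x -> at_rest w s x -> subsonic w k t x.
Proof.
move=> k0; have [e e0 he] := rel_pressure_sqr_le g1 k0.
have k20 : 0 < k ^+ 2 by exact: exprn_gt0.
have kk : 0 < k / (1 + k) by rewrite divr_gt0// addr_gt0.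
have [d1 d10 h1] := time_uniform (usq w) m k20.
have [d2 d20 h2] := time_uniform (rho w) m kk.
have [d3 d30 h3] := time_uniform (logv w) m e0.
exists (Num.min d1 (Num.min d2 d3)); first by rewrite !lt_min d10 d20 d30.
move=> s t x hs; rewrite !le_min => /and3P[ht1 ht2 ht3] hx hr.
have [hL hu] := at_rest_logv hr; have [hrho _ _ _] := hr; split.
- by have := h1 s t x hs ht1 hx; rewrite hu subr0; apply: le_trans; exact: ler_norm.
- have := h2 s t x hs ht2 hx; rewrite hrho ler_norml => /andP[h _].
  rewrite -[leLHS](_ : (1 + k) * (1 - k / (1 + k)) = 1); last by field; rewrite gt_eqF// addr_gt0.
  by rewrite ler_pM2l ?addr_gt0//; move: (k / (1 + k)) h => *; lra.
- by apply: he; have := h3 s t x hs ht3 hx; rewrite hL subr0.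
Qed.

(* Backward cones of speed s issued from this region stay in it. *)
Definition shell (s m t : R) (x : E) := 1 + s * t < enorm x < m - s * t.

Lemma shell_mono s m t t' x : 0 <= s -> t' <= t -> shell s m t x -> shell s m t' x.
Proof.
move=> s0 tt /andP[h1 h2]; have h : s * t' <= s * t by exact: ler_wpM2l.
by apply/andP; split; lra.
Qed.

Lemma shell_in_box s m t x : 0 <= s -> 0 <= t -> shell s m t x -> in_box m x.
Proof.
move=> s0 t0 /andP[_ h2] i; have h := mulr_ge0 s0 t0; have c := coord_le_enorm x i.
by rewrite -ler_norml; lra.
Qed.

(** During a step of length at most d the shell at rest remains subsonic, which is what the cone
    estimate requires; the cones used stay in the shell. *)
Lemma rest_step (k m d t0 t1 : R) : 0 < k -> 0 <= t0 -> t0 < t1 -> t1 <= tau -> t1 - t0 <= d ->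
  (forall s t x, 0 <= s <= tau -> `|t - s| <= d -> in_box m x -> at_rest w s x -> subsonic w k t x) ->
  (forall x, shell (1 + 2 * k) m t0 x -> at_rest w t0 x) ->
  forall x, shell (1 + 2 * k) m t1 x -> at_rest w t1 x.
Proof.
move=> k0 t00 t01 t1tau td sub rest0; set s := 1 + 2 * k.
have s0 : 0 < s by rewrite /s addr_gt0// mulr_gt0.
have s0' := ltW s0; have t0tau : 0 <= t0 <= tau by rewrite t00 /=; apply: le_trans t1tau; exact: ltW.
have subs t x : t0 <= t <= t1 -> shell s m t0 x -> subsonic w k t x.
  move=> ht hx; apply: (sub t0 t x t0tau) (rest0 x hx); last exact: shell_in_box s0' t00 hx.
  by move/andP: ht => [ht0 ht1]; rewrite ger0_norm ?subr_ge0//; apply: le_trans td; rewrite lerD2r.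
(* Energy estimate in the backward cone with apex slightly later than t. *)
have zero t x : t0 < t <= t1 -> shell s m t x ->
    [/\ val (logv w) t x = 0, forall i, val (vel w i) t x = 0 & forall i, val (mag w i) t x = 0].
  move=> /andP[ht0 ht1] hx; have /andP[hx1 hx2] := hx.
  have [i i0 hi] : exists2 i : R, 0 < i & 1 + s * (t + i) < enorm x < m - s * (t + i).
    pose j := Num.min (enorm x - (1 + s * t)) (m - s * t - enorm x).
    have j0 : 0 < j by rewrite lt_min !subr_gt0 hx1 hx2.
    exists (j / (2 * s)); first by rewrite divr_gt0// mulr_gt0.
    have -> : s * (t + j / (2 * s)) = s * t + j / 2 by field; rewrite gt_eqF.
    have jl : j <= enorm x - (1 + s * t) by rewrite ge_min lexx.
    have jr : j <= m - s * t - enorm x by rewrite ge_min lexx orbT.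
    by apply/andP; split; lra.
  have cone y t' : t0 <= t' -> t' <= t -> enorm (x - y) < s * (t + i - t') -> shell s m t' y.
    move=> h0 h1 hy; have a1 := enorm_triangle (x - y) y; have a2 := enorm_triangle (y - x) x.
    rewrite !subrK (enormB_sym y x) in a1 a2.
    have e1 : s * (t + i - t') = s * (t + i) - s * t' by ring.
    by move/andP: hi => [b1 b2]; rewrite e1 in hy; apply/andP; split; lra.
  apply: (energy_eq0 (g1 := g1) mu0 (k := k)); first by apply: subs; [rewrite ht1 ltW|apply: shell_mono hx; rewrite ?ltW].
  apply: (cone_rest (g1 := g1) mu0 (k := k) (t0 := t0) (a := t + i) (M := enorm x + s * (t + i - t0))) => //.
  - exact: ltW.
  - exact: le_trans ht1 t1tau.
  - by rewrite ltrDl.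
  - move=> t' y /andP[h0 h1] hy; apply: subs; first by rewrite !ltW//; apply: lt_le_trans ht1.
    apply: (shell_mono s0' (ltW h0)); exact: cone (ltW h0) (ltW h1) hy.
  - move=> y hy; have hr := rest0 y (cone y t0 (lexx _) (ltW ht0) hy).
    have [hL hu] := at_rest_logv hr; have [_ _ hb _] := hr.
    rewrite val_energy hu hL /bsq /= !hb !mul0r !addr0 !mulr0 add0r addr0 /rel_energy mulr0 expR0 mulr1.
    by rewrite (addrC 1) addrACA subrr addr0 addNr mul0r.
move=> x hx; have [hL hu hb] : _ := zero t1 x (introT andP (conj t01 (lexx _))) hx.
(* The energy sees L but not S itself. As u = 0 on the step, S is constant in time at x, so S = Sb;
   then L = 0 yields rho = 1. *)
have hS : val (ent w) t0 x = val (ent w) t1 x.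
  apply: (@eq_of_deriv0 R (fun t => val (ent w) t x)); first exact: ltW.
    have h := @c1_time_cont (ent w) x.
    by move=> t _; exact: h.
  move=> t /andP[h0 h1]; have ht : 0 < t < tau.
    by rewrite (le_lt_trans t00 h0) (lt_le_trans h1 t1tau).
  have [_ {}hu _] : _ := zero t x (introT andP (conj h0 (ltW h1))) (shell_mono s0' (ltW h1) hx).
  have e := ent_eq w x ht; rewrite sum3E !hu !mul0r !addr0 in e.
  by have := ct_der (ent w) x ht; rewrite e.
have [_ _ _ hS0] := rest0 x (shell_mono s0' (ltW t01) hx).
have hS1 : val (ent w) t1 x = Sb by rewrite -hS.
split => //.
by move: hL; rewrite /= hS1 subrr mulr0 addr0 => /eqP; rewrite ln_eq0 ?rho_gt0// => /eqP.
Qed.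

Lemma rest_shell (k m t : R) : 0 < k -> (forall x, 1 < enorm x -> at_rest w 0 x) ->
  0 <= t <= tau -> forall x, shell (1 + 2 * k) m t x -> at_rest w t x.
Proof.
move=> k0 rest0 /andP[t0 ttau]; have [d d0 hd] := subsonic_near_rest m k0.
suff [n] : exists n : nat, t <= n%:R * d.
  elim: n t t0 ttau => [t t0 _|n IH t t0 ttau tn x hx].
    rewrite mul0r => t0' x; have -> : t = 0 by apply/eqP; rewrite eq_le t0' t0.
    by rewrite /shell mulr0 addr0 => /andP[? _]; exact: rest0.
  have [tn'|tn'] := leP t (n%:R * d); first exact: (IH t t0 ttau tn').
  have nd0 : 0 <= n%:R * d by rewrite mulr_ge0// ltW.
  apply: (rest_step k0 nd0 tn' ttau _ hd) hx.
    by rewrite lerBlDr; apply: (le_trans tn); rewrite -[n.+1%:R]natr1 mulrDl mul1r addrC.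
  by apply: IH => //; apply: ltW; apply: lt_le_trans ttau.
have td0 : 0 <= t / d by rewrite divr_ge0// ltW.
have /andP[_ h] := truncn_itv td0.
by exists (Num.truncn (t / d)).+1; rewrite -ler_pdivrMr// ltW.
Qed.

Lemma finite_speed (t : R) (x : E) : (forall x, 1 < enorm x -> at_rest w 0 x) ->
  0 <= t <= tau -> 1 + t < enorm x -> at_rest w t x.
Proof.
move=> rest0 ht hx; have /andP[t0 _] := ht.
(* Then 2 k t is at most half of the gap |x| - (1 + t), so x still lies outside the region reached
   at speed 1 + 2 k. *)
pose k := (enorm x - (1 + t)) / (4 * (1 + t)).
have t1 : 0 < 1 + t by lra.
have k0 : 0 < k by rewrite divr_gt0 ?mulr_gt0// subr_gt0.
apply: (rest_shell (k := k) (m := enorm x + (1 + 2 * k) * t + 1) k0 rest0 ht).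
have kt : 4 * (k * t) <= enorm x - (1 + t) - 4 * k.
  by rewrite le_eqVlt; apply/orP; left; apply/eqP; rewrite /k; move: (enorm x) => n; field; rewrite gt_eqF.
by rewrite /shell mulrDl mul1r -mulrA; move: (k * t) (enorm x) kt hx => kt n; lra.
Qed.

End FiniteSpeed.

(** * Growth of the momentum functional *)

Lemma light_cone_in_box (R : realType) (t tau : R) : 0 <= t <= tau -> 1 + t < tau + 3.
Proof. lra. Qed.

Section Functionals.
Variables (R : realType) (tau g mu Sb : R) (w : mhd tau g mu Sb).
Local Notation E := 'rV[R]_3.
Hypotheses (g1 : 1 < g) (mu0 : 0 < mu) (tau0 : 0 < tau).
Hypothesis rest0 : forall x, 1 < enorm x -> at_rest w 0 x.

Let M := tau + 3.

Lemma box_radius_ge0 : 0 <= M.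
Proof. by rewrite /M addr_ge0// ltW. Qed.

Lemma rest_out t x : 0 <= t <= tau -> 1 + t < enorm x -> at_rest w t x.
Proof. by move=> ht; exact: (finite_speed g1 mu0 rest0). Qed.

Lemma rest_boundary t (x : E) i : 0 <= t <= tau -> `|x 0 i| = M -> at_rest w t x.
Proof.
move=> ht hx; apply: rest_out => //; apply: (lt_le_trans _ (coord_le_enorm x i)); rewrite hx.
exact: light_cone_in_box.
Qed.

Lemma itv_oo_cc (t : R) : 0 < t < tau -> 0 <= t <= tau.
Proof. by move=> /andP[/ltW -> /ltW ->]. Qed.

Lemma conserved_box_int (f : c1 tau) (h : 'I_3 -> c1 tau) t :
  (forall t x, 0 < t < tau -> ct f t x + \sum_j cx (h j) j t x = 0) ->
  (forall i t x, at_rest w t x -> val (h i) t x = 0) -> 0 <= t <= tau ->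
  box_int M (val f t) = box_int M (val f 0).
Proof.
move=> e h0 /andP[t0 ttau]; symmetry; apply: (eq_of_deriv0 (f := fun t => box_int M (val f t)) t0).
  by move=> u _; exact: (box_int_val_cont f box_radius_ge0).
move=> u /andP[u0 ut]; have hu : 0 < u < tau by rewrite u0 (lt_le_trans ut).
have := @box_balance _ _ f h (fun _ _ => 0) M u box_radius_ge0 hu (fun x => e u x hu).
rewrite box_int_cst ?box_radius_ge0// mul0r; apply => i x hx; apply: h0.
exact: rest_boundary (itv_oo_cc hu) hx.
Qed.

Let entropy_defect : c1 tau := c1add (c1cst tau Sb) (c1scale (- 1) (ent w)).
Let defect2 : c1 tau :=
  c1comp (f := entropy_defect) (fun t x => deriv_at_pos2 _) (fun t x => @dpos2_cont R (val entropy_defect t x)).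

Lemma entropy_ge t x : (forall x, Sb <= val (ent w) 0 x) -> 0 <= t <= tau -> Sb <= val (ent w) t x.
Proof.
move=> S0 ht; have [hx|hx] := ltP (1 + t) (enorm x).
  by have [_ _ _ ->] := rest_out ht hx.
pose f := c1mul (rho w) defect2; pose h j := c1mul (c1mul (rho w) (vel w j)) defect2.
have f_ge0 t' y : 0 <= val f t' y by rewrite c1mul_val mulr_ge0 ?pos2_ge0// ltW// rho_gt0.
have := @conserved_box_int f h t; have -> : box_int M (val f 0) = 0.
  rewrite (@eq_box_int _ _ _ (fun=> 0)) ?box_int_cst ?mul0r ?box_radius_ge0// => y _.
  by rewrite c1mul_val [val defect2 _ _]pos2_le0 ?mulr0//= mulN1r subr_le0.
have e t' y : 0 < t' < tau -> ct f t' y + \sum_j cx (h j) j t' y = 0.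
  move=> ht'; have := mass_eq w y ht'; have := ent_eq w y ht'.
  rewrite !sum3E /f /h /defect2 /entropy_defect /c1scale /=.
  move: (pos2 _) (dpos2 _) => p d.
  move: (val (rho w) t' y) (ct (rho w) t' y) (ct (ent w) t' y) => r rt st.
  move: (cx (rho w) 0 t' y) (cx (rho w) 1 t' y) (cx (rho w) 2%:R t' y) => p0 p1 p2.
  move: (cx (ent w) 0 t' y) (cx (ent w) 1 t' y) (cx (ent w) 2%:R t' y) => s0 s1 s2.
  move: (val (ent w) t' y).
  move: (val (vel w 0) t' y) (val (vel w 1) t' y) (val (vel w 2%:R) t' y) => u0 u1 u2.
  move: (cx (vel w 0) 0 t' y) (cx (vel w 1) 1 t' y) (cx (vel w 2%:R) 2%:R t' y) => a0 a1 a2 S He Hm.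
  match type of He with ?X = _ => match type of Hm with ?Y = _ =>
    transitivity (p * Y - r * d * X) end end; last by rewrite He Hm !mulr0 subrr.
  by clear; ring.
have h0 i t' y : at_rest w t' y -> val (h i) t' y = 0.
  by move=> [_ hu _ _]; rewrite !c1mul_val hu mulr0 mul0r.
move/(_ e h0 ht) => z.
have := box_int_eq0 box_radius_ge0 (c1_slice_cont f t) (fun y _ => f_ge0 t y) z (x := x).
have hb i : - M < x 0 i < M.
  by rewrite -ltr_norml; apply: (le_lt_trans (coord_le_enorm x i)); apply: (le_lt_trans hx);
    exact: light_cone_in_box.
move/(_ hb)/eqP; rewrite c1mul_val mulf_eq0 gt_eqF ?rho_gt0//= => /eqP p0.
rewrite leNgt; apply/negP => hS; move: p0; rewrite mulN1r => p0.
have : 0 < Sb - val (ent w) t x by rewrite subr_gt0.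
by move/pos2_gt0; rewrite p0 ltxx.
Qed.

Let F0 := sphere_exp (0 : E).
Let Fc : c1 tau := c1space tau (@sphere_exp_cont R) (fun i => @sph1_cont R i) (fun i x => @sphere_exp_deriv R i x).
Let Gc i : c1 tau := c1space tau (@sph1_cont R i) (fun j => @sph2_cont R i j) (fun j x => @sph1_deriv R i j x).

Definition excess : c1 tau := c1add (rho w) (c1cst tau (- 1)).
Definition potential : c1 tau := c1mul excess Fc.
Definition momentum : c1 tau := c1sum (fun i => c1mul (c1mul (rho w) (vel w i)) (Gc i)).
(** Reynolds stress, pressure and Maxwell stress. The pressure is taken relative to rest so that the
    whole tensor vanishes there. *)
Definition stress (i j : 'I_3) : c1 tau :=
  c1add (c1mul (rho w) (c1mul (vel w i) (vel w j)))
    (c1add (c1scale (i == j)%:R (c1add (rpress g1 w) (c1scale (2 * mu)^-1 (bsq w))))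
      (c1scale (- mu^-1) (c1mul (mag w i) (mag w j)))).

Lemma excess_conserved t : 0 <= t <= tau -> box_int M (val excess t) = box_int M (val excess 0).
Proof.
apply: (@conserved_box_int _ (fun j => c1mul (rho w) (vel w j))) => [u x hu|i u x [_ hu _ _]].
  by have := mass_eq w x hu; rewrite /= addr0.
by rewrite c1mul_val hu mulr0.
Qed.

Lemma potential_deriv t : 0 < t < tau ->
  deriv_at (fun t => box_int M (val potential t)) t 1 (box_int M (val momentum t)).
Proof.
move=> ht; apply: (box_balance (h := fun j => c1mul (c1mul (rho w) (vel w j)) Fc) box_radius_ge0 ht) => [x|i x hx].
  have := mass_eq w x ht; rewrite !sum3E /potential /momentum /excess /c1sum /=.
  move: (sphere_exp x) (sph1 0 x) (sph1 1 x) (sph1 2%:R x) => F f0 f1 f2.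
  move: (val (rho w) t x) (ct (rho w) t x) => r rt.
  move: (cx (rho w) 0 t x) (cx (rho w) 1 t x) (cx (rho w) 2%:R t x) => p0 p1 p2.
  move: (val (vel w 0) t x) (val (vel w 1) t x) (val (vel w 2%:R) t x) => u0 u1 u2.
  move: (cx (vel w 0) 0 t x) (cx (vel w 1) 1 t x) (cx (vel w 2%:R) 2%:R t x) => a0 a1 a2 m.
  match type of m with ?Y = _ => match goal with |- _ = ?X => transitivity (F * Y + X) end end;
    last by rewrite m mulr0 add0r.
  by clear; ring.
have [_ hu _ _] := rest_boundary (itv_oo_cc ht) hx.
by rewrite !c1mul_val hu mulr0 mul0r.
Qed.

Ltac linear_momentum m mi dv u b mu :=
  match type of m with ?X = _ => match type of mi with ?Y = _ => match type of dv with ?Z = _ =>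
    transitivity (u * X + Y + - mu^-1 * b * Z); last by rewrite m mi dv !mulr0 !addr0
  end end end; clear m mi dv; by field.

(** Conservative form of the momentum equation: add u_i times the continuity equation and subtract
    B_i / mu times div B. *)
Lemma stress_balance i t x : 0 < t < tau ->
  ct (c1mul (rho w) (vel w i)) t x + \sum_j cx (stress i j) j t x = 0.
Proof.
move=> ht; have m := mass_eq w x ht; have mi := mom_eq w i x ht; have dv := div_eq w x ht.
move: m mi dv; rewrite !sum3E /stress /rpress /bsq; move: (logv w) => L; rewrite /c1sum /c1scale /=.
have muN : mu != 0 by rewrite gt_eqF.
move: (rel_pressure _ _) (expR _) => P a.
move: (val (rho w) t x) (ct (rho w) t x) => r rt.
move: (cx (rho w) 0 t x) (cx (rho w) 1 t x) (cx (rho w) 2%:R t x) => p0 p1 p2.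
move: i; apply: ord3_ind => /=; rewrite ?eqxx /=.
all: move: (cx L 0 t x) (cx L 1 t x) (cx L 2%:R t x) => l0 l1 l2.
all: move: (val (vel w 0) t x) (val (vel w 1) t x) (val (vel w 2%:R) t x) => u0 u1 u2.
all: move: (ct (vel w 0) t x) (ct (vel w 1) t x) (ct (vel w 2%:R) t x) => v0 v1 v2.
all: move: (cx (vel w 0) 0 t x) (cx (vel w 0) 1 t x) (cx (vel w 0) 2%:R t x) => u00 u01 u02.
all: move: (cx (vel w 1) 0 t x) (cx (vel w 1) 1 t x) (cx (vel w 1) 2%:R t x) => u10 u11 u12.
all: move: (cx (vel w 2%:R) 0 t x) (cx (vel w 2%:R) 1 t x) (cx (vel w 2%:R) 2%:R t x) => u20 u21 u22.
all: move: (val (mag w 0) t x) (val (mag w 1) t x) (val (mag w 2%:R) t x) => b0 b1 b2.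
all: move: (cx (mag w 0) 0 t x) (cx (mag w 0) 1 t x) (cx (mag w 0) 2%:R t x) => b00 b01 b02.
all: move: (cx (mag w 1) 0 t x) (cx (mag w 1) 1 t x) (cx (mag w 1) 2%:R t x) => b10 b11 b12.
all: move: (cx (mag w 2%:R) 0 t x) (cx (mag w 2%:R) 1 t x) (cx (mag w 2%:R) 2%:R t x) => b20 b21 b22.
all: move=> m mi dv.
linear_momentum m mi dv u0 b0 mu.
linear_momentum m mi dv u1 b1 mu.
linear_momentum m mi dv u2 b2 mu.
Qed.

End Functionals.

Lemma stress_contraction (R : realType) (u b : 'I_3 -> R) (f : 'I_3 -> 'I_3 -> R) (r q m : R) :
  \sum_i \sum_j (r * (u i * u j) + ((i == j)%:R * q + m * (b i * b j))) * f i j =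
  r * (\sum_i \sum_j u i * u j * f i j) + q * (\sum_i f i i) + m * (\sum_i \sum_j b i * b j * f i j).
Proof.
rewrite !mulr_sumr -!big_split; apply: eq_bigr => i _.
under eq_bigr do rewrite mulrDl mulrDl.
rewrite !big_split /= addrA; congr (_ + _ + _).
- by rewrite mulr_sumr; apply: eq_bigr => j _; rewrite !mulrA.
- rewrite (bigD1 i)//= eqxx mul1r big1 ?addr0// => j ji.
  by rewrite eq_sym (negPf ji) !mul0r.
- by rewrite mulr_sumr; apply: eq_bigr => j _; rewrite !mulrA.
Qed.

(** * The lower bound for Q' and the upper bound for P *)

Section MomentumGrowth.
Variables (R : realType) (tau g mu Sb : R) (w : mhd tau g mu Sb).
Local Notation E := 'rV[R]_3.
Hypotheses (g1 : 1 < g) (mu0 : 0 < mu) (tau0 : 0 < tau).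
Hypothesis rest0 : forall x, 1 < enorm x -> at_rest w 0 x.
Hypothesis ent0 : forall x, Sb <= val (ent w) 0 x.
Hypothesis mag_tangent : forall t x, 0 < t < tau -> dotp (row_of (mag w) t x) x = 0.
Hypothesis mag_origin : forall t, 0 < t < tau -> row_of (mag w) t 0 = 0.

Lemma c1sum_val (F : 'I_3 -> c1 tau) t x : val (c1sum F) t x = \sum_i val (F i) t x.
Proof. by rewrite sum3E. Qed.

Lemma c1sum_ct (F : 'I_3 -> c1 tau) t x : ct (c1sum F) t x = \sum_i ct (F i) t x.
Proof. by rewrite sum3E. Qed.

Lemma c1sum_cx (F : 'I_3 -> c1 tau) j t x : cx (c1sum F) j t x = \sum_i cx (F i) j t x.
Proof. by rewrite sum3E. Qed.

Lemma row_ofE (F : 'I_3 -> c1 tau) t x i : row_of F t x 0 i = val (F i) t x.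
Proof. by rewrite mxE. Qed.

Lemma val_stress i j t x : val (stress w g1 i j) t x =
  val (rho w) t x * (row_of (vel w) t x 0 i * row_of (vel w) t x 0 j)
  + ((i == j)%:R * (rel_pressure g (val (logv w) t x) + (2 * mu)^-1 * val (bsq w) t x)
  + - mu^-1 * (row_of (mag w) t x 0 i * row_of (mag w) t x 0 j)).
Proof. by rewrite !row_ofE. Qed.

Lemma val_stress_rest i j t x : at_rest w t x -> val (stress w g1 i j) t x = 0.
Proof.
move=> hr; have [_ hu hb _] := hr; have [hL _] := at_rest_logv hr.
have hB : val (bsq w) t x = 0 by rewrite c1sum_val big1// => k _; rewrite c1mul_val hb mul0r.
by rewrite val_stress hB hL !row_ofE !hu !hb /rel_pressure !mulr0 expR0 subrr mul0r !addr0 !mulr0 addr0.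
Qed.

(** The contraction of the stress with the Hessian of F; one integration by parts shows that its
    integral is Q'. *)
Definition stress_work t x := \sum_i \sum_j val (stress w g1 i j) t x * sph2 i j x.

Lemma momentum_deriv t : 0 < t < tau -> deriv_at (fun t => box_int (tau + 3) (val (momentum w) t)) t 1
  (box_int (tau + 3) (stress_work t)).
Proof.
move=> ht.
pose G i : c1 tau := c1space tau (@sph1_cont R i) (fun j => @sph2_cont R i j) (fun j x => @sph1_deriv R i j x).
pose q i := c1mul (rho w) (vel w i).
apply: (box_balance (f := c1sum (fun i => c1mul (q i) (G i)))
  (h := fun j => c1sum (fun i => c1mul (stress w g1 i j) (G i))) (box_radius_ge0 tau0) ht) => [x|j x hx].
  have sb i : ct (q i) t x + \sum_j cx (stress w g1 i j) j t x = 0 := stress_balance w g1 mu0 i x ht.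
  rewrite /stress_work; move: (stress w g1) q sb => T q sb.
  rewrite c1sum_ct; under [X in _ + X]eq_bigr do rewrite c1sum_cx.
  rewrite exchange_big -big_split; apply: eq_bigr => i _ /=.
  by rewrite big_split -mulr_suml /= mulr0 addr0 addrA -mulrDl sb mul0r add0r.
have hr := rest_boundary g1 mu0 rest0 (itv_oo_cc ht) hx.
by rewrite c1sum_val big1// => i _; rewrite c1mul_val val_stress_rest ?mul0r.
Qed.

Lemma stress_workE t x : stress_work t x =
  val (rho w) t x * (\sum_i \sum_j row_of (vel w) t x 0 i * row_of (vel w) t x 0 j * sph2 i j x)
  + (rel_pressure g (val (logv w) t x) + (2 * mu)^-1 * val (bsq w) t x) * sphere_exp x
  - mu^-1 * (\sum_i \sum_j row_of (mag w) t x 0 i * row_of (mag w) t x 0 j * sph2 i j x).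
Proof.
rewrite sphere_exp_lap /stress_work.
under eq_bigr do under eq_bigr do rewrite val_stress.
by rewrite stress_contraction mulNr.
Qed.

Lemma stress_work_rest t x : at_rest w t x -> stress_work t x = 0.
Proof. by move=> hr; rewrite /stress_work big1// => i _; rewrite big1// => j _; rewrite val_stress_rest ?mul0r. Qed.

Lemma stress_work_ge t x : 0 < t < tau ->
  rel_pressure g (val (logv w) t x) * sphere_exp x <= stress_work t x.
Proof.
move=> ht; rewrite stress_workE mulrDl -addrA -addrA addrCA lerDl.
have h1 := mulr_ge0 (ltW (rho_gt0 w t x)) (sph2_quad_ge0 x (row_of (vel w) t x)).
apply: addr_ge0 => //; rewrite subr_ge0 val_bsq invfM.
suff h : 2 * (\sum_i \sum_j row_of (mag w) t x 0 i * row_of (mag w) t x 0 j * sph2 i j x) <=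
    dotp (row_of (mag w) t x) (row_of (mag w) t x) * sphere_exp x.
  rewrite (mulrC 2^-1) -!mulrA; apply: ler_wpM2l; first by rewrite invr_ge0 ltW.
  by rewrite ler_pdivlMl.
(* The tangential estimate divides by |x|^2; at the origin B itself is 0. *)
have [x0|x0] := ltP 0 (dotp x x); first exact: sph2_tangent_le (mag_tangent x ht) x0.
have -> : x = 0.
  apply/rowP => i; rewrite mxE; apply: (dotpp_eq0 (v := x)).
  by apply/eqP; rewrite eq_le x0 dotpp_ge0.
rewrite mag_origin// big1 ?mulr0 => [|i _]; last by rewrite big1 // => j _; rewrite mxE !mul0r.
by rewrite mulr_ge0 ?dotpp_ge0 ?sphere_exp_ge0.
Qed.

(** e^(g L) = rho^g e^(S - Sb), and S >= Sb persists by [entropy_ge]. *)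
Lemma rel_pressure_ge t x : 0 <= t <= tau ->
  (val (rho w) t x `^ g - 1) / g <= rel_pressure g (val (logv w) t x).
Proof.
move=> ht; have g0 : 0 < g by apply: lt_trans g1.
rewrite /rel_pressure ler_pM2r ?invr_gt0// lerD2r /powR gt_eqF ?rho_gt0// ler_expR /=.
rewrite mulrDr lerDl !mulr_ge0 ?invr_ge0 ?(ltW g0)//.
by rewrite subr_ge0; exact: (entropy_ge g1 mu0 tau0 rest0 x ent0 ht).
Qed.

Let K := (g - 1)^-1 * expR (g - 1)^-1.

(** The cutoff is a continuous substitute for the indicator of the light cone. Where |x| <= 1 + t it
    equals 1 and [pressure_minorant] applies; elsewhere the state is at rest, so the right side is 0
    and the left side nonpositive. *)
Lemma stress_work_minorant t x l : 0 < t < tau -> 0 <= l <= 1 ->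
  val (potential w) t x + l * val (potential w) t x - K * l ^+ 2 * (sphere_exp x * cutoff (2 + t) x)
    <= stress_work t x.
Proof.
move=> ht hl; have F0 := sphere_exp_ge0 x; have ht' := itv_oo_cc ht.
have K0 : 0 <= K * l ^+ 2 by rewrite mulr_ge0 ?sqr_ge0// mulr_ge0 ?expR_ge0// invr_ge0 subr_ge0 ltW.
have eP : val (potential w) t x = (val (rho w) t x - 1) * sphere_exp x by [].
have [hx|hx] := ltP (1 + t) (enorm x).
  have hr := rest_out g1 mu0 rest0 ht' hx; rewrite stress_work_rest// eP; case: hr => -> _ _ _.
  by rewrite subrr mul0r mulr0 !add0r oppr_le0 mulr_ge0// mulr_ge0// cutoff_ge0.
apply: (le_trans _ (stress_work_ge x ht)); rewrite cutoff_in; last by move: hx; lra.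
have := le_trans (pressure_minorant g1 hl (rho_gt0 w t x)) (lerB (rel_pressure_ge x ht') (lexx (val (rho w) t x - 1))).
rewrite -/K eP mulr1; move: (val (rho w) t x - 1) (rel_pressure _ _) (K * l ^+ 2) K0 => d p k k0 h.
have := ler_wpM2r F0 h; rewrite !mulrBl; move: (sphere_exp x) => F.
by rewrite mulrA; lra.
Qed.

(** The ball has radius 2 + t, whence the factor e^2. *)
Lemma momentum_growth t l : 0 < t < tau -> 0 <= l <= 1 ->
  box_int (tau + 3) (val (potential w) t) + l * box_int (tau + 3) (val (potential w) t)
    - (K * (24 * sphere_exp (0 : E) * expR 2) + 1) * l ^+ 2 * ((2 + t) * expR t) <= box_int (tau + 3) (stress_work t).
Proof.
move=> ht hl; have M0 := box_radius_ge0 tau0; have /andP[t0 ttau] := ht.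
have m0 : 0 < 2 + t by rewrite addr_gt0.
have Pc : continuous (val (potential w) t) := c1_slice_cont (potential w) t.
have Xc : continuous (fun x => sphere_exp x * cutoff (2 + t) x) := mul_cont (@sphere_exp_cont R) (@cutoff_cont R (2 + t)).
have Sc : continuous (stress_work t).
  apply: sum_cont => i; apply: sum_cont => j.
  exact: (mul_cont (c1_slice_cont (stress w g1 i j) t) (@sph2_cont R i j)).
have lPc : continuous (fun x => l * val (potential w) t x) := mul_cont (@cst_cont R E l) Pc.
have kXc : continuous (fun x => K * l ^+ 2 * (sphere_exp x * cutoff (2 + t) x)) := mul_cont (@cst_cont R E _) Xc.
have := box_int_le M0 (sub_cont (add_cont Pc lPc) kXc) Sc (fun x _ => stress_work_minorant x ht hl).
rewrite (box_intB M0 (add_cont Pc lPc) kXc) (box_intD M0 Pc lPc) (box_intZ M0 _ Pc) (box_intZ M0 _ Xc).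
apply: le_trans; rewrite lerD2l lerN2.
rewrite (@box_int_shrink _ (2 + t)) ?(ltW m0)//; first last.
- by move=> x [i hi]; rewrite cutoff_out ?mulr0//; apply: le_trans hi (coord_le_enorm x i).
- by move: ttau; clear; move=> h; apply: ltW; rewrite addrC ltrD// ltr_nat.
have h := ball_int_sphere_exp m0.
have Kl : 0 <= K * l ^+ 2 by rewrite mulr_ge0 ?sqr_ge0// mulr_ge0 ?expR_ge0// invr_ge0 subr_ge0 ltW.
apply: (le_trans (ler_wpM2l Kl h)); rewrite expRD.
have -> : K * l ^+ 2 * (24 * sphere_exp (0 : E) * ((2 + t) * (expR 2 * expR t))) =
  K * (24 * sphere_exp (0 : E) * expR 2) * l ^+ 2 * ((2 + t) * expR t).
  by move: (sphere_exp _) (expR 2) (expR t) K => *; ring.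
apply: ler_wpM2r; first by rewrite mulr_ge0 ?expR_ge0// ltW.
by apply: ler_wpM2r; rewrite ?sqr_ge0// lerDl.
Qed.

(** In the light cone (rho - 1) F <= rho F <= F(0) e^(1 + t) rho, and there rho is the excess plus
    the cutoff. The excess has a conserved integral; the cutoff contributes at most the volume of a
    cube of side 2 (2 + t). *)
Lemma potential_le t m0 : 0 <= t <= tau -> box_int (tau + 3) (val (excess w) 0) <= m0 -> 0 <= m0 ->
  box_int (tau + 3) (val (potential w) t) <=
    (sphere_exp (0 : E) * expR 1 * (m0 + 8) + 1) * (3 + t) ^+ 3 * expR t.
Proof.
move=> ht hm m00; have M0 := box_radius_ge0 tau0; have /andP[t0 ttau] := ht.
have F0 : 0 <= sphere_exp (0 : E) := sphere_exp_ge0 _.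
have m1 : 0 < 2 + t by rewrite ltr_wpDr.
have h0 : 0 <= sphere_exp (0 : E) * expR (1 + t) by rewrite mulr_ge0 ?expR_ge0.
have pw x : val (potential w) t x <= sphere_exp (0 : E) * expR (1 + t) * (val (excess w) t x + cutoff (2 + t) x).
  have -> : val (potential w) t x = val (excess w) t x * sphere_exp x by [].
  have [hx|hx] := ltP (1 + t) (enorm x).
    have -> : val (excess w) t x = 0 by rewrite /=; case: (rest_out g1 mu0 rest0 ht hx) => -> _ _ _; rewrite subrr.
    by rewrite mul0r add0r mulr_ge0// cutoff_ge0.
  rewrite cutoff_in; last by move: hx; lra.
  have -> : val (excess w) t x + 1 = val (rho w) t x by rewrite /= subrK.
  have [hF _] := sphere_exp_bound x.
  have hF' : sphere_exp x <= sphere_exp (0 : E) * expR (1 + t).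
    by apply: (le_trans hF); apply: ler_wpM2l => //; rewrite ler_expR.
  apply: (@le_trans _ _ (sphere_exp x * val (rho w) t x)).
    by rewrite /= mulrBl mul1r mulrC gerBl sphere_exp_ge0.
  by apply: ler_wpM2r => //; apply: ltW; exact: rho_gt0.
have Pc := c1_slice_cont (potential w) t; have Ec := c1_slice_cont (excess w) t.
have Xc := @cutoff_cont R (2 + t).
have := box_int_le M0 Pc (mul_cont (@cst_cont R E _) (add_cont Ec Xc)) (fun x _ => pw x).
rewrite (box_intZ M0 _ (add_cont Ec Xc)) (box_intD M0 Ec Xc) => h; apply: (le_trans h) => {h}.
have hJ : box_int (tau + 3) (val (excess w) t) <= m0 by rewrite (excess_conserved g1 mu0 tau0 rest0 ht).
have hX : box_int (tau + 3) (cutoff (2 + t)) <= (2 * (2 + t)) ^+ 3.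
  rewrite (@box_int_shrink _ (2 + t)) ?(ltW m1)//; first last.
  - by move=> x [i hi]; rewrite cutoff_out//; apply: le_trans hi (coord_le_enorm x i).
  - by apply: ltW; rewrite addrC ler_ltD// ltr_nat.
  have := box_int_le (ltW m1) Xc (@cst_cont R E 1) (fun x _ => cutoff_le1 _ x).
  by rewrite box_int_cst ?(ltW m1)// mul1r.
apply: (le_trans (ler_wpM2l h0 (lerD hJ hX))).
have t3 : 1 <= (3 + t) ^+ 3 by rewrite exprn_ege1// -[leLHS]addr0 lerD// ler1n.
have h8 : m0 + (2 * (2 + t)) ^+ 3 <= (m0 + 8) * (3 + t) ^+ 3.
  rewrite exprMn mulrDl; apply: lerD; first by rewrite ler_peMr.
  have -> : (2 ^+ 3 : R) = 8 by rewrite -natrX.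
  by apply: ler_wpM2l => //; rewrite lerXn2r ?nnegrE ?(ltW m1)// ?addr_ge0// lerD2r ler_nat.
apply: (le_trans (ler_wpM2l h0 h8)); rewrite expRD.
have -> : sphere_exp (0 : E) * (expR 1 * expR t) * ((m0 + 8) * (3 + t) ^+ 3) =
  sphere_exp (0 : E) * expR 1 * (m0 + 8) * (3 + t) ^+ 3 * expR t.
  by move: (sphere_exp _) (expR 1) (expR t) ((3 + t) ^+ 3) => *; ring.
apply: ler_wpM2r; first exact: expR_ge0.
by apply: ler_wpM2r; rewrite ?lerDl//; apply: le_trans t3.
Qed.

End MomentumGrowth.

Section Lifespan.
Variables (R : realType) (g mu Sb : R).
Local Notation E := 'rV[R]_3.

(** [a] and [b] stand for the two integrals of the positivity assumption. [K] allows for the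
    quadratic term of rho u = (1 + eps rho0) eps u0. *)
Lemma lifespan_bound (m0 a b K : R) : 1 < g -> 0 < mu -> 0 <= m0 -> 0 <= K -> 0 < a + b ->
  exists eps0 C : R, [/\ 0 < eps0, 0 < C & forall (eps tau : R) (w : mhd tau g mu Sb),
    0 < eps <= eps0 -> 0 < tau ->
    (forall x, 1 < enorm x -> at_rest w 0 x) -> (forall x, Sb <= val (ent w) 0 x) ->
    (forall t x, 0 < t < tau -> dotp (row_of (mag w) t x) x = 0) ->
    (forall t, 0 < t < tau -> row_of (mag w) t 0 = 0) ->
    box_int (tau + 3) (val (excess w) 0) <= m0 ->
    box_int (tau + 3) (val (potential w) 0) = eps * a ->
    eps * b - K * eps ^+ 2 <= box_int (tau + 3) (val (momentum w) 0) ->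
    tau <= expR (C / eps)].
Proof.
move=> g1 mu0 m00 K0 ab; have F0 : 0 <= sphere_exp (0 : E) := sphere_exp_ge0 _.
(* The summand 1 in each constant makes it positive from 0 <= F(0) alone. *)
pose C1 := (g - 1)^-1 * expR (g - 1)^-1 * (24 * sphere_exp (0 : E) * expR 2) + 1.
pose C2 := sphere_exp (0 : E) * expR 1 * (m0 + 8) + 1.
have C10 : 0 < C1.
  by rewrite ltr_wpDl// !mulr_ge0 ?expR_ge0// invr_ge0 subr_ge0 ltW.
have C20 : 0 < C2 by rewrite ltr_wpDl// !mulr_ge0 ?expR_ge0// addr_ge0.
have [eps0 [C [e0 c0 H]]] := functional_blowup C10 C20 K0 ab.
exists eps0, C; split=> // eps tau w he tau0 rest0 ent0 tang orig hm hP hQ.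
have M0 := box_radius_ge0 tau0.
apply: (H eps tau (fun t => box_int (tau + 3) (val (potential w) t))
  (fun t => box_int (tau + 3) (val (momentum w) t)) (fun t => box_int (tau + 3) (stress_work w g1 t))
  he tau0 _ _ _ _ _ _ hP hQ).
- by move=> t _; exact: (box_int_val_cont (potential w) M0).
- by move=> t _; exact: (box_int_val_cont (momentum w) M0).
- by move=> t ht; exact: potential_deriv.
- by move=> t ht; exact: momentum_deriv.
- by move=> t l ht hl; exact: momentum_growth.
- by move=> t ht; exact: potential_le.
Qed.

End Lifespan.

(** * Restriction of a solution to a compact time interval *)

Section Clamp.
Variables (R : realType) (T : \bar R) (tau : R).
Local Notation E := 'rV[R]_3.
Hypotheses (tau0 : 0 < tau) (tauT : (tau%:E < T)%E).

Definition clamp (t : R) : R := Num.max 0 (Num.min t tau).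

Lemma clamp_itv t : 0 <= clamp t <= tau.
Proof. by rewrite /clamp le_max lexx ge_max (ltW tau0) ge_min lexx orbT. Qed.

Lemma clampE t : 0 <= t <= tau -> clamp t = t.
Proof. by move=> /andP[t0 t1]; rewrite /clamp min_l// max_r. Qed.

Lemma clamp_cont : continuous clamp.
Proof.
move=> t; apply: (@continuous_max _ _ (fun=> 0) (fun t => Num.min t tau)); first exact: cst_continuous.
by apply: (@continuous_min _ _ (fun t => t) (fun=> tau)); [exact: id_cont|exact: cst_continuous].
Qed.

Lemma slab_itv t (x : E) : 0 <= t <= tau -> slab T (t, x).
Proof. by move=> /andP[t0 t1]; split => //=; apply: le_lt_trans tauT; rewrite lee_fin. Qed.

(** The clamped time always lies in [0, tau], so continuity within the slab becomes continuity on
    the whole space. *)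
Lemma slab_comp_cont (W : normedModType R) (f : R * E -> W) :
  {within slab T, continuous f} -> continuous (fun q : R * E => f (clamp q.1, q.2)).
Proof.
move=> /subspace_continuousP H q.
have c : continuous (fun q : R * E => (clamp q.1, q.2)).
  by apply: pair_cont; [exact: (comp_cont clamp_cont (@fst_cont _ _))|exact: snd_cont].
have h : (fun q : R * E => (clamp q.1, q.2)) @ q --> within (slab T) (nbhs (clamp q.1, q.2)).
  move=> A hA.
  have h1 : \forall y \near q, slab T (clamp y.1, y.2) -> A (clamp y.1, y.2) := c q [set y | slab T y -> A y] hA.
  have h2 : \forall y \near q, A (clamp y.1, y.2).
    by apply: filterS h1 => y; apply; exact: (slab_itv _ (clamp_itv _)).
  exact: h2.
exact: (cvg_comp _ _ h (H (clamp q.1, q.2) (slab_itv _ (clamp_itv _)))).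
Qed.

Variables (W : normedModType R) (L : W -> R).
Hypotheses (LZ : forall a v, L (a *: v) = a * L v) (LB : forall v v', L (v - v') = L v - L v').
Hypothesis Lc : continuous L.

Lemma deriv_at_of_derivable (V : normedModType R) (f : V -> W) x v :
  derivable f x v -> deriv_at (fun y => L (f y)) x v (L ('D_v f x)).
Proof.
move=> df.
have c : (fun h => h^-1 *: (((fun y => L (f y)) \o shift x) (h *: v) - L (f x))) @ 0^' --> L ('D_v f x).
  have -> : (fun h => h^-1 *: (((fun y => L (f y)) \o shift x) (h *: v) - L (f x))) =
    L \o (fun h => h^-1 *: ((f \o shift x) (h *: v) - f x)) by apply: funext => h /=; rewrite LZ LB.
  exact: (cvg_comp _ _ df (@Lc _)).
by apply: DeriveDef; [exact: (cvgP _ c)|exact: (cvg_lim _ c)].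
Qed.

(** For t > 0 every small h has t + h >= 0, so the restricted quotient is the ordinary one; clamping
    is the identity nearby. *)
Lemma deriv_at_of_time_derivable (f : R -> E -> W) t x : 0 < t < tau -> time_derivable f t x ->
  deriv_at (fun t => L (f (clamp t) x)) t 1 (L (dt f t x)).
Proof.
move=> ht df; have /andP[t0 t1] := ht.
have itv : \forall h \near 0^', 0 < t + h < tau.
  have d0 : 0 < Num.min t (tau - t) by rewrite lt_min t0 subr_gt0.
  apply: filterS (dnbhs0_lt d0) => h; rewrite lt_min !ltr_norml => /andP[/andP[h1 _] /andP[_ h2]].
  by apply/andP; split; lra.
have q : (fun h => h^-1 *: (f (t + h) x - f t x)) @ 0^' --> dt f t x.
  move=> A hA.
  have h1 : \forall h \near 0^', 0 <= t + h -> A (h^-1 *: (f (t + h) x - f t x)) := df A hA.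
  by apply: filterS2 itv h1 => h /andP[/ltW h0 _]; apply.
have c : (fun h => h^-1 *: (((fun t => L (f (clamp t) x)) \o shift t) (h *: 1) - L (f (clamp t) x))) @ 0^'
    --> L (dt f t x).
  apply: cvg_trans (cvg_comp _ _ q (@Lc _)); apply: near_eq_cvg; apply: filterS itv => h hh /=.
  by rewrite LZ LB [h%:A]mulr1 (addrC h) (clampE (itv_oo_cc hh)) (clampE (itv_oo_cc ht)).
by apply: DeriveDef; [exact: (cvgP _ c)|exact: (cvg_lim _ c)].
Qed.

Lemma class_C1_time (f : R -> E -> W) (hf : class_C1 T f) t x : 0 < t < tau ->
  deriv_at (fun t => L (f (clamp t) x)) t 1 (L (dt f (clamp t) x)).
Proof.
move=> ht; have ht' := itv_oo_cc ht; rewrite [in L (dt _ _ _)](clampE ht').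
by case: hf => _ c2 _ _ _; exact: (deriv_at_of_time_derivable ht (c2 t x (slab_itv x ht'))).
Qed.

Lemma class_C1_space (f : R -> E -> W) (hf : class_C1 T f) i t x :
  deriv_at (fun x => L (f (clamp t) x)) x (delta_mx 0 i) (L (partial i (f (clamp t)) x)).
Proof. by apply: deriv_at_of_derivable; case: hf => _ _ _ c4 _; apply: c4; exact: slab_itv (clamp_itv t). Qed.

Lemma class_C1_cont (f : R -> E -> W) (hf : class_C1 T f) :
  [/\ continuous (fun q : R * E => L (f (clamp q.1) q.2)),
      continuous (fun q : R * E => L (dt f (clamp q.1) q.2)) &
      forall i, continuous (fun q : R * E => L (partial i (f (clamp q.1)) q.2))].
Proof.
case: hf => [c1 _ c3 _ c5]; split; last move=> i.
- exact: (comp_cont Lc (slab_comp_cont c1)).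
- exact: (comp_cont Lc (slab_comp_cont c3)).
- exact: (comp_cont Lc (slab_comp_cont (c5 i))).
Qed.

Definition clamped_c1 (f : R -> E -> W) (hf : class_C1 T f) : c1 tau :=
  @C1 _ tau (fun t x => L (f (clamp t) x)) (fun t x => L (dt f (clamp t) x))
    (fun i t x => L (partial i (f (clamp t)) x))
    (let: And3 h _ _ := class_C1_cont hf in h) (let: And3 _ h _ := class_C1_cont hf in h)
    (let: And3 _ _ h := class_C1_cont hf in h) (class_C1_time hf) (class_C1_space hf).

End Clamp.

(** * Magnetic force and induction in coordinates *)

Section VectorCalculus.
Variable R : realType.
Local Notation E := 'rV[R]_3.

Lemma partial_deriv_at (f : E -> R) x i d : deriv_at f x (delta_mx 0 i) d -> partial i (f : E -> R^o) x = d.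
Proof. by case. Qed.

Lemma cross_antisym_coord (d : 'I_3 -> 'I_3 -> R) (v : E) i :
  cross (vec3 (d 1 2%:R - d 2%:R 1) (d 2%:R 0 - d 0 2%:R) (d 0 1 - d 1 0)) v 0 i =
  \sum_j (v 0 j * d j i - v 0 j * d i j).
Proof.
rewrite /cross sum3E; move: i; apply: ord3_ind; rewrite !vec3E.
all: move: (v 0 0) (v 0 1) (v 0 2%:R) (d 0 0) (d 1 1) (d 2%:R 2%:R) => *.
all: move: (d 0 1) (d 0 2%:R) (d 1 0) (d 1 2%:R) (d 2%:R 0) (d 2%:R 1) => *.
all: by ring.
Qed.

Lemma cross_curl_coord (b : E -> E) x i : cross (curl b x) (b x) 0 i =
  \sum_j (b x 0 j * partial j (fun y => b y 0 i : R^o) x - b x 0 j * partial i (fun y => b y 0 j : R^o) x).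
Proof. exact: (cross_antisym_coord (fun i j => partial i (fun y => b y 0 j : R^o) x)). Qed.

Lemma curl_cross_coord (u b : E -> E) (du db : 'I_3 -> 'I_3 -> R) x i :
  (forall i j, deriv_at (fun y => u y 0 i) x (delta_mx 0 j) (du i j)) ->
  (forall i j, deriv_at (fun y => b y 0 i) x (delta_mx 0 j) (db i j)) ->
  curl (fun y => cross (u y) (b y)) x 0 i =
  \sum_j (du i j * b x 0 j + u x 0 i * db j j - du j j * b x 0 i - u x 0 j * db i j).
Proof.
move=> hu hb.
have h k l j : deriv_at (fun y => u y 0 k * b y 0 l - u y 0 l * b y 0 k) x (delta_mx 0 j)
    (du k j * b x 0 l + u x 0 k * db l j - (du l j * b x 0 k + u x 0 l * db k j)).
  exact: deriv_atB (deriv_atM (hu k j) (hb l j)) (deriv_atM (hu l j) (hb k j)).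
have c (k l m : 'I_3) j : (forall y, cross (u y) (b y) 0 m = u y 0 k * b y 0 l - u y 0 l * b y 0 k) ->
    partial j (fun y => cross (u y) (b y) 0 m : R^o) x =
    du k j * b x 0 l + u x 0 k * db l j - (du l j * b x 0 k + u x 0 l * db k j).
  move=> e; have -> : (fun y => cross (u y) (b y) 0 m) = (fun y => u y 0 k * b y 0 l - u y 0 l * b y 0 k).
    exact: funext.
  exact: partial_deriv_at.
have c0 j := c 1 2%:R 0 j (fun y => ltac:(by rewrite /cross vec3E)).
have c1 j := c 2%:R 0 1 j (fun y => ltac:(by rewrite /cross vec3E)).
have c2 j := c 0 1 2%:R j (fun y => ltac:(by rewrite /cross vec3E)).
rewrite /curl sum3E; move: i; apply: ord3_ind; rewrite vec3E !(c0, c1, c2).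
all: move: (u x 0 0) (u x 0 1) (u x 0 2%:R) (b x 0 0) (b x 0 1) (b x 0 2%:R); clear => *.
all: move: (du 0 0) (du 0 1) (du 0 2%:R) (du 1 0) (du 1 1) (du 1 2%:R) (du 2%:R 0) (du 2%:R 1) (du 2%:R 2%:R) => *.
all: move: (db 0 0) (db 0 1) (db 0 2%:R) (db 1 0) (db 1 1) (db 1 2%:R) (db 2%:R 0) (db 2%:R 1) (db 2%:R 2%:R) => *.
all: by ring.
Qed.

End VectorCalculus.

(** * From a C^1 solution to the coordinate system *)

Section Solution.
Variables (R : realType) (T : \bar R) (tau g mu Sb A : R).
Local Notation E := 'rV[R]_3.
Hypotheses (tau0 : 0 < tau) (tauT : (tau%:E < T)%E) (g1 : 1 < g) (mu0 : 0 < mu).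
Hypothesis AE : A = (g * expR Sb)^-1.
Variables (rho S : R -> E -> R) (u B : R -> E -> E).
Hypothesis sol : C1_mhd_solution A g mu T rho u S B.

Let rhoC : class_C1 T (rho : R -> E -> R^o). Proof. by case: sol => -[]. Qed.
Let uC : class_C1 T u. Proof. by case: sol => -[]. Qed.
Let SC : class_C1 T (S : R -> E -> R^o). Proof. by case: sol => -[]. Qed.
Let BC : class_C1 T B. Proof. by case: sol => -[]. Qed.

Let idZ (a : R) (v : R^o) : a *: v = a * v :> R. Proof. by []. Qed.
Let idB (v v' : R^o) : v - v' = v - v' :> R. Proof. by []. Qed.
Let coordZ i (a : R) (v : E) : (a *: v) 0 i = a * v 0 i. Proof. by rewrite mxE. Qed.
Let coordB i (v v' : E) : (v - v') 0 i = v 0 i - v' 0 i. Proof. by rewrite !mxE. Qed.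

Let coordD i (v v' : E) : (v + v') 0 i = v 0 i + v' 0 i. Proof. by rewrite mxE. Qed.
Let coord0 i : (0 : E) 0 i = 0. Proof. by rewrite mxE. Qed.

Definition scalar_c1 (f : R -> E -> R) (hf : class_C1 T (f : R -> E -> R^o)) : c1 tau :=
  clamped_c1 tau0 tauT (L := fun v : R^o => v : R) idZ idB (@id_cont _) hf.
Definition coord_c1 (f : R -> E -> E) (hf : class_C1 T f) (i : 'I_3) : c1 tau :=
  clamped_c1 tau0 tauT (L := fun v : E => v 0 i) (coordZ i) (coordB i) (@coord_cont R i) hf.

Lemma scalar_deriv (f : R -> E -> R) (hf : class_C1 T (f : R -> E -> R^o)) i t x : 0 <= t <= tau ->
  deriv_at (f t) x (delta_mx 0 i) (partial i (f t : E -> R^o) x).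
Proof. by move=> ht; have := cx_der (scalar_c1 hf) i t x; rewrite /= (clampE ht). Qed.

Lemma coord_deriv (f : R -> E -> E) (hf : class_C1 T f) j i t x : 0 <= t <= tau ->
  deriv_at (fun y => f t y 0 j) x (delta_mx 0 i) (partial i (f t) x 0 j).
Proof. by move=> ht; have := cx_der (coord_c1 hf j) i t x; rewrite /= (clampE ht). Qed.

Lemma sol_rho_gt0 t x : 0 < val (scalar_c1 rhoC) t x.
Proof. by case: sol => _ h; have [] := h (clamp tau t) x (slab_itv tauT x (clamp_itv tau0 t)). Qed.

Lemma sol_eqs t x : 0 < t < tau -> mhd_at A g mu rho u S B t x.
Proof. by move=> ht; case: sol => _ h; have [] := h t x (slab_itv tauT x (itv_oo_cc ht)). Qed.

Lemma sol_mass t x : 0 < t < tau ->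
  ct (scalar_c1 rhoC) t x + \sum_j (cx (scalar_c1 rhoC) j t x * val (coord_c1 uC j) t x
    + val (scalar_c1 rhoC) t x * cx (coord_c1 uC j) j t x) = 0.
Proof.
move=> ht; have ht' := itv_oo_cc ht; have [e _ _ _ _] := sol_eqs x ht.
rewrite /= (clampE ht') -[RHS]e; congr (_ + _); apply: eq_bigr => j _; symmetry.
apply: partial_deriv_at.
have -> : (fun y => (rho t y *: u t y) 0 j) = (fun y => rho t y * u t y 0 j).
  by apply: funext => y; rewrite mxE.
exact: deriv_atM (scalar_deriv rhoC j x ht') (coord_deriv uC j j x ht').
Qed.

Lemma pressureE t x : 0 <= t <= tau -> pressure A g rho S t x =
  expR (g * val (log_c1 g Sb (scalar_c1 SC) sol_rho_gt0) t x) * g^-1.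
Proof.
move=> ht; have r0 := sol_rho_gt0 t x; move: r0; rewrite /= (clampE ht) /pressure AE => r0.
have g0 : g != 0 by rewrite gt_eqF//; apply: lt_trans g1.
rewrite /powR gt_eqF// mulrDr mulVKf// !expRD expRN invfM.
have c0 : expR Sb != 0 by rewrite gt_eqF ?expR_gt0.
move: (expR (g * ln (rho t x))) (expR (S t x)) (expR Sb) c0 => a b c c0.
by field; rewrite g0 c0.
Qed.

Lemma sol_mom i t x : 0 < t < tau ->
  val (scalar_c1 rhoC) t x * (ct (coord_c1 uC i) t x
    + \sum_j val (coord_c1 uC j) t x * cx (coord_c1 uC i) j t x)
  + expR (g * val (log_c1 g Sb (scalar_c1 SC) sol_rho_gt0) t x)
    * cx (log_c1 g Sb (scalar_c1 SC) sol_rho_gt0) i t x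
  - mu^-1 * (\sum_j (val (coord_c1 BC j) t x * cx (coord_c1 BC i) j t x
    - val (coord_c1 BC j) t x * cx (coord_c1 BC j) i t x)) = 0.
Proof.
move=> ht; have ht' := itv_oo_cc ht; have [_ + _ _ _] := sol_eqs x ht.
move/(congr1 (fun v : E => v 0 i)); rewrite coordB !coordD !coordZ coordD summxE cross_curl_coord coord0 [grad _ _ 0 i]mxE.
have -> : partial i (pressure A g rho S t : E -> R^o) x =
    expR (g * val (log_c1 g Sb (scalar_c1 SC) sol_rho_gt0) t x)
    * cx (log_c1 g Sb (scalar_c1 SC) sol_rho_gt0) i t x.
  apply: partial_deriv_at; move: (log_c1 _ _ _ _) (@pressureE t) => L eL.
  have -> : pressure A g rho S t = (fun y => expR (g * val L t y) * g^-1) by apply: funext => y; rewrite eL.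
  have := deriv_atM (deriv_at_comp (deriv_at_expR_lin g _) (cx_der L i t x)) (deriv_at_cst g^-1 x (delta_mx 0 i)).
  move/deriv_at_eq; apply; have g0 : g != 0 by rewrite gt_eqF//; apply: lt_trans g1.
  by move: (expR _) (cx L i t x) => *; field.
move: (log_c1 _ _ _ _) => L; rewrite /= (clampE ht') => e; rewrite -[RHS]e; congr (_ * (_ + _) + _ - _ * _).
- by apply: eq_bigr => j _; rewrite coordZ.
- by apply: eq_bigr => j _; rewrite !(partial_deriv_at (coord_deriv BC _ _ x ht')).
Qed.

Lemma sol_ent t x : 0 < t < tau ->
  ct (scalar_c1 SC) t x + \sum_j val (coord_c1 uC j) t x * cx (scalar_c1 SC) j t x = 0.
Proof.
move=> ht; have ht' := itv_oo_cc ht; have [_ _ e _ _] := sol_eqs x ht.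
by rewrite /= (clampE ht') -[RHS]e; congr (_ + _); apply: eq_bigr => j _; rewrite mxE.
Qed.

Lemma sol_ind i t x : 0 < t < tau ->
  ct (coord_c1 BC i) t x - \sum_j (cx (coord_c1 uC i) j t x * val (coord_c1 BC j) t x
    + val (coord_c1 uC i) t x * cx (coord_c1 BC j) j t x
    - cx (coord_c1 uC j) j t x * val (coord_c1 BC i) t x
    - val (coord_c1 uC j) t x * cx (coord_c1 BC i) j t x) = 0.
Proof.
move=> ht; have ht' := itv_oo_cc ht; have [_ _ _ + _] := sol_eqs x ht.
move/(congr1 (fun v : E => v 0 i)); rewrite coordB.
rewrite (curl_cross_coord i (fun k j => coord_deriv uC k j x ht') (fun k j => coord_deriv BC k j x ht')).
by rewrite coord0 /= (clampE ht').
Qed.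

Lemma sol_div t x : 0 < t < tau -> \sum_j cx (coord_c1 BC j) j t x = 0.
Proof.
move=> ht; have ht' := itv_oo_cc ht; have [_ _ _ _ e] := sol_eqs x ht.
rewrite /= (clampE ht') -[RHS]e; apply: eq_bigr => j _.
by rewrite (partial_deriv_at (coord_deriv BC j j x ht')).
Qed.

Definition sol_mhd : mhd tau g mu Sb :=
  Mhd sol_mass sol_mom sol_ent sol_ind sol_div.

End Solution.

(** * Geometry of the magnetic field and initial values *)

Section InitialData.
Variable R : realType.
Local Notation E := 'rV[R]_3.

Lemma cont_punctured0 (f : R -> R) : continuous f -> (forall h, h != 0 -> f h = 0) -> f 0 = 0.
Proof.
move=> fc f0; apply/eqP/negPn/negP => n0.
have e0 : 0 < `|f 0| by rewrite normr_gt0.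
have /nbhs_ballP[d /= d0 H] : \forall h \near (0 : R), `|f 0 - f h| < `|f 0|.
  by have /cvgrPdist_lt := fc 0; exact.
have d2 : 0 < d / 2 by rewrite divr_gt0.
have hd : ball 0 d (d / 2).
  by rewrite -ball_normE /ball_ /= sub0r normrN gtr0_norm// ltr_pdivrMr// mulr_natr mulr2n ltrDl.
by have := H _ hd; rewrite /= (f0 _ (lt0r_neq0 d2)) subr0 ltxx.
Qed.

Lemma dotp_delta (v : E) i : dotp v (delta_mx 0 i) = v 0 i.
Proof.
rewrite /dotp (bigD1 i)//= big1 => [|j ji]; first by rewrite addr0 !mxE !eqxx mulr1.
by rewrite mxE eqxx (negPf ji) mulr0.
Qed.

Lemma row_scaleE (a : R) (v : E) i : (a *: v) 0 i = a * v 0 i.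
Proof. by rewrite mxE. Qed.

Lemma zero_coord i : (0 : E) 0 i = 0.
Proof. by rewrite mxE. Qed.

Lemma ray_cont (x v : E) : continuous (fun h : R => x + h *: v).
Proof. by move=> h; apply: cvgD; [exact: cvg_cst|apply: cvgZr_tmp; exact: cvg_id]. Qed.

(** Off the axis e_theta is orthogonal to x. A point of the axis is the limit of x + h e_1 as h
    tends to 0. *)
Lemma azimuthal_orthogonal (b : E -> E) (k : E -> R) : continuous b ->
  (forall x, 0 < cyl_r x -> b x = k x *: e_theta x) -> forall x, dotp (b x) x = 0.
Proof.
move=> bc hb.
have off x : 0 < cyl_r x -> dotp (b x) x = 0.
  move=> hx; rewrite hb// dotpE !row_scaleE /e_theta !vec3E.
  by move: (cyl_r x)^-1 (x 0 0) (x 0 1) (x 0 2%:R) (k x) => *; ring.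
move=> x; have [hx|hx] := ltP 0 (cyl_r x); first exact: off.
have x0 : x 0 0 = 0 /\ x 0 1 = 0.
  have : x 0 0 ^+ 2 + x 0 1 ^+ 2 <= 0 by rewrite leNgt -sqrtr_gt0 -leNgt.
  rewrite le_eqVlt ltNge addr_ge0 ?sqr_ge0//= orbF paddr_eq0 ?sqr_ge0// !sqrf_eq0.
  by move=> /andP[/eqP -> /eqP ->].
pose y (h : R) : E := x + h *: delta_mx 0 0.
have := @cont_punctured0 (fun h => dotp (b (y h)) (y h)).
rewrite /y scale0r addr0; apply.
  exact: (dotp_cont (comp_cont bc (@ray_cont x _)) (@ray_cont x _)).
move=> h h0; apply: off; rewrite /cyl_r !mxE /= x0.1 x0.2 !add0r mulr1 mulr0 expr0n addr0.
by rewrite sqrtr_sqr normr_gt0.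
Qed.

(** At h e_i with h nonzero, orthogonality says that the i-th component of b is 0; let h tend to
    0. *)
Lemma orthogonal_field_origin (b : E -> E) : continuous b -> (forall x, dotp (b x) x = 0) -> b 0 = 0.
Proof.
move=> bc hb; apply/rowP => i; rewrite mxE.
pose y (h : R) : E := 0 + h *: delta_mx 0 i.
have := @cont_punctured0 (fun h => b (y h) 0 i); rewrite /y scale0r addr0; apply.
  exact: (comp_cont (@coord_cont R i) (comp_cont bc (@ray_cont 0 _))).
move=> h h0; have := hb (y h); rewrite {2}/y add0r dotpZ dotp_delta => /eqP.
by rewrite mulf_eq0 (negPf h0) /y add0r => /eqP.
Qed.

Lemma grad_sphere_exp x i : grad (@sphere_exp R) x 0 i = sph1 i x.
Proof. by rewrite mxE; apply: partial_deriv_at; exact: sphere_exp_deriv. Qed.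

Lemma integral_ball (M : R) (f : E -> R) : 1 <= M -> continuous f ->
  (forall x, 1 < enorm x -> f x = 0) -> integral_R3 f = box_int M f.
Proof.
move=> M1 fc f0; apply: integral_R3E => //; first by apply: le_trans M1.
move=> x [i hi]; apply: f0; apply: (le_lt_trans M1); apply: (lt_le_trans hi); exact: coord_le_enorm.
Qed.

Lemma lt_between (a : R) (T : \bar R) : (a%:E < T)%E -> exists2 t, a < t & (t%:E < T)%E.
Proof.
case: T => [r| |] //; last by move=> _; exists (a + 1); rewrite ?ltrDl// ltry.
by rewrite lte_fin => ar; exists ((a + r) / 2); rewrite ?lte_fin; lra.
Qed.

End InitialData.

Section InitialState.
Variables (R : realType) (T : \bar R) (tau g mu Sb A : R).
Local Notation E := 'rV[R]_3.
Hypotheses (tau0 : 0 < tau) (tauT : (tau%:E < T)%E) (g1 : 1 < g) (AE : A = (g * expR Sb)^-1).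
Variables (den S : R -> E -> R) (u B : R -> E -> E).
Hypothesis sol : C1_mhd_solution A g mu T den u S B.
Variables (eps : R) (rho0 S0 : E -> R) (u0 B0 : E -> E).
Hypothesis init : forall x, [/\ den 0 x = 1 + eps * rho0 x, u 0 x = eps *: u0 x,
  B 0 x = eps *: B0 x & S 0 x = Sb + eps * S0 x].
Hypotheses (rho0c : continuous rho0) (u0c : continuous u0).
Hypotheses (rho0s : forall x, 1 < enorm x -> rho0 x = 0) (S0s : forall x, 1 < enorm x -> S0 x = 0).
Hypotheses (u0s : forall x, 1 < enorm x -> u0 x = 0) (B0s : forall x, 1 < enorm x -> B0 x = 0).

Let w : mhd tau g mu Sb := sol_mhd tau0 tauT g1 AE sol.
Let M := tau + 3.

Lemma box_radius_ge1 : 1 <= M.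
Proof. by rewrite /M addrC; apply: (@le_trans _ _ 3); rewrite ?ler1n// lerDl ltW. Qed.

Let M0 : 0 <= M := le_trans ler01 box_radius_ge1.

Lemma initial_values x : [/\ val (rho w) 0 x = 1 + eps * rho0 x, forall i, val (vel w i) 0 x = eps * u0 x 0 i,
  forall i, val (mag w i) 0 x = eps * B0 x 0 i & val (ent w) 0 x = Sb + eps * S0 x].
Proof.
have c0 : clamp tau 0 = 0 by apply: clampE; rewrite lexx ltW.
have [h1 h2 h3 h4] := init x.
by split => [|i|i|]; rewrite /= c0 ?h1 ?h2 ?h3 ?h4 ?row_scaleE.
Qed.

Lemma initial_rest x : 1 < enorm x -> at_rest w 0 x.
Proof.
move=> hx; have [h1 h2 h3 h4] := initial_values x; split=> [|i|i|].
- by rewrite h1 rho0s// mulr0 addr0.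
- by rewrite h2 u0s// zero_coord mulr0.
- by rewrite h3 B0s// zero_coord mulr0.
- by rewrite h4 S0s// mulr0 addr0.
Qed.

Lemma initial_excess : box_int M (val (excess w) 0) = eps * integral_R3 rho0.
Proof.
rewrite (integral_ball box_radius_ge1 rho0c rho0s) -(box_intZ M0 _ rho0c); apply: eq_box_int => x _.
have [h1 _ _ _] := initial_values x.
have -> : val (excess w) 0 x = val (rho w) 0 x + - 1 by [].
by rewrite h1 addrAC subrr add0r.
Qed.

Lemma initial_potential :
  box_int M (val (potential w) 0) = eps * integral_R3 (fun x => rho0 x * sphere_exp x).
Proof.
have fc : continuous (fun x => rho0 x * sphere_exp x) := mul_cont rho0c (@sphere_exp_cont R).
rewrite (integral_ball box_radius_ge1 fc); last by move=> x hx; rewrite rho0s// mul0r.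
rewrite -(box_intZ M0 _ fc); apply: eq_box_int => x _.
have [h1 _ _ _] := initial_values x.
have -> : val (potential w) 0 x = (val (rho w) 0 x + - 1) * sphere_exp x by [].
by rewrite h1 addrAC subrr add0r mulrA.
Qed.

Lemma grad_dotp_cont : continuous (fun x => dotp (grad (@sphere_exp R) x) (u0 x)).
Proof.
apply: sum_cont => i; apply: mul_cont; last exact: (comp_cont (@coord_cont R i) u0c).
have -> : (fun x => grad (@sphere_exp R) x 0 i) = sph1 i by apply: funext => x; rewrite grad_sphere_exp.
exact: sph1_cont.
Qed.

(** The eps^2 term is the product of the density and velocity perturbations. *)
Lemma initial_momentum : box_int M (val (momentum w) 0) =
  eps * integral_R3 (fun x => dotp (grad (@sphere_exp R) x) (u0 x))
  + eps ^+ 2 * integral_R3 (fun x => rho0 x * dotp (grad (@sphere_exp R) x) (u0 x)).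
Proof.
have gc := grad_dotp_cont; have rgc := mul_cont rho0c gc.
rewrite (integral_ball box_radius_ge1 gc); last first.
  by move=> x hx; rewrite /dotp big1// => i _; rewrite u0s// zero_coord mulr0.
rewrite (integral_ball box_radius_ge1 rgc); last by move=> x hx; rewrite rho0s// mul0r.
rewrite -(box_intZ M0 _ gc) -(box_intZ M0 _ rgc).
rewrite -(box_intD M0 (mul_cont (@cst_cont R E eps) gc) (mul_cont (@cst_cont R E (eps ^+ 2)) rgc)).
apply: eq_box_int => x _; have [h1 h2 _ _] := initial_values x.
rewrite c1sum_val; under eq_bigr do rewrite !c1mul_val h1 h2.
rewrite /dotp; under [in RHS]eq_bigr do rewrite grad_sphere_exp.
rewrite !sum3E /=; move: (rho0 x) (u0 x 0 0) (u0 x 0 1) (u0 x 0 2%:R) (sph1 0 x) (sph1 1 x) (sph1 2%:R x) => *.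
by ring.
Qed.

Lemma solution_mag_row t x : 0 < t < tau -> row_of (mag w) t x = B t x.
Proof. by move=> ht; apply/rowP => i; rewrite mxE /= (clampE (itv_oo_cc ht)). Qed.

Lemma solution_mag_cont t : 0 < t < tau -> continuous (B t).
Proof.
move=> ht; have [[_ _ _ [h _ _ _ _]] _] := sol.
have := section_cont (f := fun t x => B (clamp tau t) x) (u := t) (slab_comp_cont tau0 tauT h).
by rewrite (clampE (itv_oo_cc ht)).
Qed.

End InitialState.

Theorem theorem1p1 (R : realType) (gamma mu Sbar A : R)
    (rho0 S0 : 'rV[R]_3 -> R) (u0 B0 : 'rV[R]_3 -> 'rV[R]_3)
    (gamma_gt1 : 1 < gamma) (mu_gt0 : 0 < mu)
    (A_def : A = (gamma * expR Sbar)^-1)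
    (rho0_smooth : smooth (rho0 : _ -> R^o))
    (S0_smooth : smooth (S0 : _ -> R^o))
    (u0_smooth : smooth u0) (B0_smooth : smooth B0)
    (rho0_supp : supported_in_unit_ball (rho0 : _ -> R^o))
    (S0_supp : supported_in_unit_ball (S0 : _ -> R^o))
    (u0_supp : supported_in_unit_ball u0)
    (B0_supp : supported_in_unit_ball B0)
    (B0_div : forall x, divg B0 x = 0)
    (S_init_ge : forall eps x, 0 < eps -> Sbar <= Sbar + eps * S0 x)
    (data_pos :
      0 < integral_R3 (fun x => rho0 x * sphere_exp x)
          + integral_R3 (fun x => dotp (grad (@sphere_exp R) x) (u0 x))) :
  exists eps0 C : R, [/\ 0 < eps0, 0 < C &
    forall eps : R, 0 < eps <= eps0 ->
    forall (T : \bar R)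
      (rho : R -> 'rV[R]_3 -> R) (u : R -> 'rV[R]_3 -> 'rV[R]_3)
      (S : R -> 'rV[R]_3 -> R) (B : R -> 'rV[R]_3 -> 'rV[R]_3),
    (0 < T)%E ->
    axisymmetric_C1_solution A gamma mu T rho u S B ->
    (forall x, [/\ rho 0 x = 1 + eps * rho0 x, u 0 x = eps *: u0 x,
                   B 0 x = eps *: B0 x & S 0 x = Sbar + eps * S0 x]) ->
    (T <= (expR (C / eps))%:E)%E].
Proof.
have rho0c : continuous rho0 := rho0_smooth 0.
have u0c : continuous u0 := u0_smooth 0.
pose D x := dotp (grad (@sphere_exp R) x) (u0 x).
have [eps0 [C [e0 C0 H]]] := lifespan_bound Sbar gamma_gt1 mu_gt0 (normr_ge0 (integral_R3 rho0))
  (normr_ge0 (integral_R3 (fun x => rho0 x * D x))) data_pos.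
(* With eps <= 1 the initial mass excess is bounded independently of eps. *)
exists (Num.min 1 eps0), C; split => //; first by rewrite lt_min ltr01 e0.
move=> eps; rewrite le_min => /and3P[eps_gt0 eps1 epse0] T rho u S B T0 [sol axi] init.
rewrite leNgt; apply/negP => /lt_between[tau tauC tauT].
(* If T exceeded e^(C / eps), so would some tau < T; the restriction to [0, tau] contradicts
   [lifespan_bound]. This also covers T = +oo. *)
have tau0 : 0 < tau := lt_trans (expR_gt0 _) tauC.
move: tauC; rewrite ltNge => /negP; apply.
pose w := sol_mhd tau0 tauT gamma_gt1 A_def sol.
have tangent t x : 0 < t < tau -> dotp (B t x) x = 0.
  move=> ht; have [ur [uz [Bth [pc [Sc h]]]]] := axi.
  apply: (@azimuthal_orthogonal _ (B t) (fun x => Bth t (cyl_r x) (x 0 2%:R))).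
    exact: (solution_mag_cont tau0 tauT sol ht).
  by move=> y hy; have [] := h t y (slab_itv tauT y (itv_oo_cc ht)) hy.
apply: (H eps tau w) => //.
- by rewrite eps_gt0.
- exact: (initial_rest tau0 tauT gamma_gt1 A_def sol init rho0_supp S0_supp u0_supp B0_supp).
- move=> x; have [_ _ _ ->] := initial_values tau0 tauT gamma_gt1 A_def sol init x.
  exact: S_init_ge.
- by move=> t x ht; rewrite solution_mag_row// tangent.
- move=> t ht; rewrite solution_mag_row//; apply: orthogonal_field_origin; last by move=> x; exact: tangent.
  exact: (solution_mag_cont tau0 tauT sol ht).
- rewrite (initial_excess tau0 tauT gamma_gt1 A_def sol init rho0c rho0_supp).
  apply: (le_trans (ler_norm _)); rewrite normrM (gtr0_norm eps_gt0).
  exact: ler_piMl (normr_ge0 _) eps1.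
- exact: (initial_potential tau0 tauT gamma_gt1 A_def sol init rho0c rho0_supp).
- rewrite (initial_momentum tau0 tauT gamma_gt1 A_def sol init rho0c u0c rho0_supp u0_supp).
  rewrite -mulrN1 lerD2l mulrAC mulrN1 mulrC ler_wpM2l ?sqr_ge0// lerNl.
  by rewrite -normrN ler_norm.
Qed.
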